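(* Let $I,J\subset\mathbf{k}^\times$ be two $\mathbb{Z}\rtimes\mathbb{Z}_2$-orbits with $I\cap J=\emptyset$. Let $\nu=\nu_1+\nu_2\in{}^\theta\mathbb{N}(I\cup J)$ with $\nu_1\in{}^\theta\mathbb{N}I$ and $\nu_2\in{}^\theta\mathbb{N}J$. Then the algebras $\mathfrak{W}_\nu$ and $\mathfrak{W}_{\nu_1}\otimes_{\mathbf{k}}\mathfrak{W}_{\nu_2}$ are Morita equivalent.
   Context: **Setting.** $\mathbf{k}$ is a field with $\operatorname{char}\mathbf{k}\neq 2$; $p,q\in\mathbf{k}^\times$ are fixed with $p\neq\pm1$, $p$ not a power of $q$ and $q$ not a power of $p$. $\mathbb{Z}\rtimes\mathbb{Z}_2$ acts on $\mathbf{k}^\times$ by $(n,\varepsilon)\cdot\lambda=p^{2n}\lambda^{\varepsilon}$, $\varepsilon\in\{\pm1\}$. Orbits $I,J$ are always assumed not to contain $\pm1$. For $K=I$, $K=J$ or $K=I\cup J$, $\Gamma_K$ is the quiver with vertex set $K$ and one arrow $p^2i\to i$ for every $i\in K$; in particular there are no arrows between vertices of $I$ and vertices of $J$. ${}^\theta\mathbb{N}K$ is the set of formal sums $\nu=\sum_{i\in K}\nu_i i$ with finite support, $\nu_i\in\mathbb{Z}_{\ge0}$ and $\nu_i=\nu_{i^{-1}}$; $|\nu|=\sum_i\nu_i=2m$. ${}^\theta K^\nu=\{\mathbf{i}\in K^m\mid\sum_k i_k+\sum_k i_k^{-1}=\nu\}$ (formal sums). **Arrow notation.** $i\to j$ (equivalently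 $j\leftarrow i$): there is an arrow from $i$ to $j$ and none from $j$ to $i$; $i\leftrightarrow j$: arrows in both directions; $i\nleftrightarrow j$: $i\ne j$ and no arrows between them. **VV algebra.** For $\nu\in{}^\theta\mathbb{N}K$ with $|\nu|=2m$, $\mathfrak{W}_\nu$ (called the separated VV algebra if $K=I\cup J$) is the $\mathbf{k}$-algebra generated by $x_1,\dots,x_m$, $\sigma_1,\dots,\sigma_{m-1}$, $\pi$, and $\mathbf{e}(\mathbf{i})$ for $\mathbf{i}\in{}^\theta K^\nu$ with relations ($s_k$ swaps entries $k,k+1$): (1) $\mathbf{e}(\mathbf{i})\mathbf{e}(\mathbf{j})=\delta_{\mathbf{ij}}\mathbf{e}(\mathbf{i})$, $\sigma_k\mathbf{e}(\mathbf{i})=\mathbf{e}(s_k\mathbf{i})\sigma_k$, $x_l\mathbf{e}(\mathbf{i})=\mathbf{e}(\mathbf{i})x_l$, $\sum_{\mathbf{i}}\mathbf{e}(\mathbf{i})=1$. (2) The $x_l$ commute. (3) $\sigma_k^2\mathbf{e}(\mathbf{i})$ equals $\mathbf{e}(\mathbf{i})$ if $i_k\nleftrightarrow i_{k+1}$; $(x_{k+1}-x_k)\mathbf{e}(\mathbf{i})$ if $i_k\leftarrow i_{k+1}$; $(x_k-x_{k+1})\mathbf{e}(\mathbf{i})$ if $i_k\to i_{k+1}$; $(x_{k+1}-x_k)(x_k-x_{k+1})\mathbf{e}(\mathbf{i})$ if $i_k\leftrightarrow i_{k+1}$; $0$ if $i_k=i_{k+1}$. $\sigma_j\sigma_k=\sigma_k\sigma_j$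 for $|j-k|>1$. $(\sigma_{k+1}\sigma_k\sigma_{k+1}-\sigma_k\sigma_{k+1}\sigma_k)\mathbf{e}(\mathbf{i})$ equals, when $i_k=i_{k+2}$: $\mathbf{e}(\mathbf{i})$ if $i_k\to i_{k+1}$; $-\mathbf{e}(\mathbf{i})$ if $i_k\leftarrow i_{k+1}$; $(2x_{k+1}-x_{k+2}-x_k)\mathbf{e}(\mathbf{i})$ if $i_k\leftrightarrow i_{k+1}$; and $0$ in all other cases. (4) $(\sigma_kx_l-x_{s_k(l)}\sigma_k)\mathbf{e}(\mathbf{i})$ equals $-\mathbf{e}(\mathbf{i})$ if $l=k$, $i_k=i_{k+1}$; $\mathbf{e}(\mathbf{i})$ if $l=k+1$, $i_k=i_{k+1}$; $0$ otherwise. (5) $\pi\mathbf{e}(i_1,\dots,i_m)=\mathbf{e}(i_1^{-1},i_2,\dots,i_m)\pi$. (6) $\pi^2\mathbf{e}(\mathbf{i})$ equals $x_1\mathbf{e}(\mathbf{i})$ if $i_1=q$; $-x_1\mathbf{e}(\mathbf{i})$ if $i_1=q^{-1}$; $\mathbf{e}(\mathbf{i})$ otherwise. (7) $\pi x_1=-x_1\pi$; $\pi x_l=x_l\pi$ for $l>1$. (8) $(\sigma_1\pi)^2\mathbf{e}(\mathbf{i})-(\pi\sigma_1)^2\mathbf{e}(\mathbf{i})$ equals $\sigma_1\mathbf{e}(\mathbf{i})$ if $i_1^{-1}=i_2=q^{-1}$; $-\sigma_1\mathbf{e}(\mathbf{i})$ if $i_1^{-1}=i_2=q$; $0$ otherwise.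 $\pi\sigma_k=\sigma_k\pi$ for $k\ne1$. $\mathfrak{W}_0=\mathbf{k}$. *)

(* Defs.v *)
From HB Require Import structures.
From mathcomp Require Import all_boot all_fingroup all_algebra.
From mathcomp Require Import generic_quotient ring_quotient.
From mathcomp Require Import finmap multiset.
From mathcomp Require Import monalg.
From mathcomp Require Import boolp classical_sets.

Set Implicit Arguments.
Unset Strict Implicit.
Unset Printing Implicit Defensive.

Import GRing.Theory.

Local Open Scope ring_scope.
Local Open Scope quotient_scope.

(* Associative unital k-algebras, as rings with a central structure map.      *)
(* MathComp's algType excludes the zero ring, whereas an algebra given by     *)
(* generators and relations may a priori vanish.                              *)
Record kalg (k : fieldType) := KAlg {
  kalg_ring :> pzRingType;
  kalg_emb : {rmorphism k -> kalg_ring};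
  kalg_embC : forall (c : k) (x : kalg_ring), kalg_emb c * x = x * kalg_emb c
}.

Arguments kalg_emb {k} _.

Definition base_kalg (k : fieldType) : kalg k :=
  @KAlg k k idfun (fun c x => mulrC c x).

Section Presentation.
Variables (k : fieldType) (G : choiceType).

Definition free_alg := {malg k[{fmonom G}]}.
HB.instance Definition _ := GRing.Lalgebra.on free_alg.

Definition free_gen (g : G) : free_alg := << fmu g >>.

Lemma free_scalC (c : k) (u : free_alg) : c%:MP * u = u * c%:MP.
Proof.
rewrite mul_malgC malgZ_def malgM_def fgmulgU.
by apply/eq_bigr => m _; rewrite mulm1 mulrC.
Qed.

Variable rel : free_alg -> free_alg -> Prop.

Inductive rel_ideal : free_alg -> Prop :=
| rel_ideal_rel u v : rel u v -> rel_ideal (u - v)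
| rel_ideal0 : rel_ideal 0
| rel_idealD u v : rel_ideal u -> rel_ideal v -> rel_ideal (u + v)
| rel_idealM a u b : rel_ideal u -> rel_ideal (a * u * b).

Definition rel_idealb : {pred free_alg} := fun u => `[< rel_ideal u >].

Lemma rel_idealb_zmod_closed : zmod_closed rel_idealb.
Proof.
split; first exact/asboolP/rel_ideal0.
move=> u v /asboolP Iu /asboolP Iv; apply/asboolP/rel_idealD => //.
by rewrite -[v]mulr1 -mulN1r mulrA; apply: rel_idealM.
Qed.

HB.instance Definition _ :=
  GRing.isZmodClosed.Build free_alg rel_idealb rel_idealb_zmod_closed.

Definition presented := Quotient.quot (rel_idealb : zmodClosed free_alg).
HB.instance Definition _ := GRing.Zmodule.on presented.
HB.instance Definition _ := EqQuotient.on presented.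

Lemma presented_eqP (u v : free_alg) :
  \pi_presented u = \pi_presented v <-> rel_ideal (u - v).
Proof.
rewrite (rwP eqP) -[X in is_true X]/(u == v %[mod presented]).
by rewrite -Quotient.idealrBE; split=> /asboolP.
Qed.

Lemma presented_piD (u v : free_alg) :
  \pi_presented (u + v) = \pi_presented u + \pi_presented v.
Proof. by rewrite !piE. Qed.

Lemma presentedW (x : presented) : exists u, x = \pi_presented u.
Proof. by exists (repr x); rewrite reprK. Qed.

Definition presented1 : presented := \pi_presented 1.
Definition presentedM (x y : presented) : presented :=
  \pi_presented (repr x * repr y).

Lemma presented_piM (u v : free_alg) :
  \pi_presented (u * v) = presentedM (\pi_presented u) (\pi_presented v).
Proof.
apply/presented_eqP.
have Iu : rel_ideal (u - repr (\pi_presented u)).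
  by apply/presented_eqP; rewrite reprK.
have Iv : rel_ideal (v - repr (\pi_presented v)).
  by apply/presented_eqP; rewrite reprK.
set u' := repr _ in Iu *; set v' := repr _ in Iv *.
have -> : u * v - u' * v' = 1 * (u - u') * v + u' * (v - v') * 1.
  by rewrite mul1r mulr1 mulrBl mulrBr addrA subrK.
by apply: rel_idealD; apply: rel_idealM.
Qed.

Fact presentedMA : associative presentedM.
Proof.
move=> x y z.
have [[u ->] [v ->] [w ->]] := And3 (presentedW x) (presentedW y) (presentedW z).
by rewrite -!presented_piM mulrA.
Qed.
Fact presented1M : left_id presented1 presentedM.
Proof. by move=> x; have [u ->] := presentedW x; rewrite -presented_piM mul1r. Qed.
Fact presentedM1 : right_id presented1 presentedM.
Proof. by move=> x; have [u ->] := presentedW x; rewrite -presented_piM mulr1. Qed.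
Fact presentedMDl : left_distributive presentedM +%R.
Proof.
move=> x y z.
have [[u ->] [v ->] [w ->]] := And3 (presentedW x) (presentedW y) (presentedW z).
by rewrite -presented_piD -!presented_piM -presented_piD mulrDl.
Qed.
Fact presentedMDr : right_distributive presentedM +%R.
Proof.
move=> x y z.
have [[u ->] [v ->] [w ->]] := And3 (presentedW x) (presentedW y) (presentedW z).
by rewrite -presented_piD -!presented_piM -presented_piD mulrDr.
Qed.

HB.instance Definition _ := GRing.Zmodule_isPzRing.Build presented
  presentedMA presented1M presentedM1 presentedMDl presentedMDr.

Definition presented_pi : free_alg -> presented := \pi_presented.

Fact presented_pi_is_zmod_morphism : zmod_morphism presented_pi.
Proof. by move=> u v; rewrite /presented_pi !piE. Qed.
Fact presented_pi_is_monoid_morphism : monoid_morphism presented_pi.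
Proof. by split=> // u v; apply: presented_piM. Qed.

HB.instance Definition _ := GRing.isZmodMorphism.Build free_alg presented
  presented_pi presented_pi_is_zmod_morphism.
HB.instance Definition _ := GRing.isMonoidMorphism.Build free_alg presented
  presented_pi presented_pi_is_monoid_morphism.

Fact presented_embC (c : k) (x : presented) :
  presented_pi c%:MP * x = x * presented_pi c%:MP.
Proof.
have [u ->] := presentedW x; rewrite -[\pi_presented u]/(presented_pi u).
by rewrite -!rmorphM free_scalC.
Qed.

(* The k-algebra generated by G subject to the relations u = v for rel u v *)
Definition presented_kalg : kalg k :=
  @KAlg k presented (presented_pi \o @malgC {fmonom G} k) presented_embC.

End Presentation.

Section Tensor.
Variables (k : fieldType) (A B : kalg k).

(* A finite sequence of pairs (a, b) stands for the formal sum of the a (x) b; *)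
(* tens_eq is the congruence generated by biadditivity and k-balancedness, so  *)
(* that the quotient by tens_eq is the tensor product of A and B over k.       *)
Definition tens_sum := seq (A * B).

Inductive tens_eq : tens_sum -> tens_sum -> Prop :=
| tens_eq_refl s : tens_eq s s
| tens_eq_sym s t : tens_eq s t -> tens_eq t s
| tens_eq_trans t s u : tens_eq s t -> tens_eq t u -> tens_eq s u
| tens_eq_cat s s' t t' :
    tens_eq s s' -> tens_eq t t' -> tens_eq (s ++ t) (s' ++ t')
| tens_eq_catC s t : tens_eq (s ++ t) (t ++ s)
| tens_eq_0l b : tens_eq [:: (0, b)] [::]
| tens_eq_Dl a a' b : tens_eq [:: (a + a', b)] [:: (a, b); (a', b)]
| tens_eq_Dr a b b' : tens_eq [:: (a, b + b')] [:: (a, b); (a, b')]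
| tens_eq_Z (c : k) a b :
    tens_eq [:: (kalg_emb A c * a, b)] [:: (a, kalg_emb B c * b)].

Definition tens_eqb (s t : tens_sum) := `[< tens_eq s t >].

Fact tens_eqb_refl : reflexive tens_eqb.
Proof. by move=> s; apply/asboolP/tens_eq_refl. Qed.
Fact tens_eqb_sym : symmetric tens_eqb.
Proof. by move=> s t; apply/asboolP/asboolP; apply: tens_eq_sym. Qed.
Fact tens_eqb_trans : transitive tens_eqb.
Proof.
by move=> t s u /asboolP st /asboolP tu; apply/asboolP/(tens_eq_trans st).
Qed.

Canonical tens_equiv :=
  EquivRel tens_eqb tens_eqb_refl tens_eqb_sym tens_eqb_trans.

Definition tensor := {eq_quot tens_equiv}.
HB.instance Definition _ := Choice.on tensor.
HB.instance Definition _ := EqQuotient.on tensor.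

Lemma tensor_eqP (s t : tens_sum) :
  \pi_tensor s = \pi_tensor t <-> tens_eq s t.
Proof. by split=> [/eqmodP/asboolP|st]; last apply/eqmodP/asboolP. Qed.

Lemma tensorW (x : tensor) : exists s, x = \pi_tensor s.
Proof. by exists (repr x); rewrite reprK. Qed.

Lemma tens_eq_repr s : tens_eq (repr (\pi_tensor s)) s.
Proof. by apply/tensor_eqP; rewrite reprK. Qed.

Lemma tens_eq_perm s t : perm_eq s t -> tens_eq s t.
Proof.
elim: s t => [|u s IHs] t.
  by rewrite perm_sym => /perm_nilP->; apply: tens_eq_refl.
rewrite perm_sym => /perm_consP[i [v [iv pv]]].
rewrite -(cat_take_drop i t).
apply: tens_eq_trans (tens_eq_catC _ _).
move: iv; rewrite /rot => ->; rewrite -cat1s -[u :: v]cat1s.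
by apply: tens_eq_cat (tens_eq_refl _) _; apply: IHs; rewrite perm_sym.
Qed.

Definition tens_opp (s : tens_sum) : tens_sum := [seq (- u.1, u.2) | u <- s].
Definition tens_mul1 (u v : A * B) : A * B := (u.1 * v.1, u.2 * v.2).
Definition tens_mul (s t : tens_sum) : tens_sum :=
  [seq tens_mul1 u v | u <- s, v <- t].

Lemma tens_eq_opp s t : tens_eq s t -> tens_eq (tens_opp s) (tens_opp t).
Proof.
elim=> {s t} [s|s t _|t s u _ + _|s s' t t' _ + _|s t|b|a a' b|a b b'|c a b] /=.
- exact: tens_eq_refl.
- exact: tens_eq_sym.
- exact: tens_eq_trans.
- by rewrite /tens_opp !map_cat; apply: tens_eq_cat.
- by rewrite /tens_opp !map_cat; apply: tens_eq_catC.
- by rewrite oppr0; apply: tens_eq_0l.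
- by rewrite opprD; apply: tens_eq_Dl.
- exact: tens_eq_Dr.
- by rewrite -mulrN; apply: tens_eq_Z.
Qed.

Lemma tens_oppP s : tens_eq (tens_opp s ++ s) [::].
Proof.
elim: s => [|[a b] s IHs]; first exact: tens_eq_refl.
apply: (@tens_eq_trans ([:: (- a, b); (a, b)] ++ (tens_opp s ++ s))).
  apply: tens_eq_perm; rewrite /= perm_cons -[(a, b) :: s]cat1s perm_catCA.
  exact: perm_refl.
rewrite -[X in tens_eq _ X]cats0; apply: tens_eq_cat => //.
apply: (tens_eq_trans (tens_eq_sym (tens_eq_Dl _ _ _))).
by rewrite addNr; apply: tens_eq_0l.
Qed.

Lemma tens_eq_mull u s t :
  tens_eq s t -> tens_eq (map (tens_mul1 u) s) (map (tens_mul1 u) t).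
Proof.
case: u => x y.
elim=> {s t} [s|s t _|t s u _ + _|s s' t t' _ + _|s t|b|a a' b|a b b'|c a b] /=;
  rewrite /tens_mul1 /=.
- exact: tens_eq_refl.
- exact: tens_eq_sym.
- exact: tens_eq_trans.
- by rewrite !map_cat; apply: tens_eq_cat.
- by rewrite !map_cat; apply: tens_eq_catC.
- by rewrite mulr0; apply: tens_eq_0l.
- by rewrite mulrDr; apply: tens_eq_Dl.
- by rewrite mulrDr; apply: tens_eq_Dr.
- rewrite !mulrA -!kalg_embC -!mulrA; exact: tens_eq_Z.
Qed.

Lemma tens_eq_mulr u s t : tens_eq s t ->
  tens_eq (map (tens_mul1^~ u) s) (map (tens_mul1^~ u) t).
Proof.
case: u => x y.
elim=> {s t} [s|s t _|t s u _ + _|s s' t t' _ + _|s t|b|a a' b|a b b'|c a b] /=;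
  rewrite /tens_mul1 /=.
- exact: tens_eq_refl.
- exact: tens_eq_sym.
- exact: tens_eq_trans.
- by rewrite !map_cat; apply: tens_eq_cat.
- by rewrite !map_cat; apply: tens_eq_catC.
- by rewrite mul0r; apply: tens_eq_0l.
- by rewrite mulrDl; apply: tens_eq_Dl.
- by rewrite mulrDl; apply: tens_eq_Dr.
- rewrite -!mulrA; exact: tens_eq_Z.
Qed.

Lemma tens_mul_consr s u t :
  tens_eq (tens_mul s (u :: t)) (map (tens_mul1^~ u) s ++ tens_mul s t).
Proof. by apply: tens_eq_perm; apply: permEl; apply: (perm_allpairs_consr _ _ (fun=> u)). Qed.

Lemma tens_eq_mul s s' t t' :
  tens_eq s s' -> tens_eq t t' -> tens_eq (tens_mul s t) (tens_mul s' t').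
Proof.
move=> ss' tt'; apply: (@tens_eq_trans (tens_mul s t')).
  elim: (s) => [|u s0 IHs]; first exact: tens_eq_refl.
  by apply: tens_eq_cat => //; apply: tens_eq_mull.
elim: (t') => [|u t0 IHt]; first by rewrite /tens_mul !allpairs0r; apply: tens_eq_refl.
apply: tens_eq_trans (tens_mul_consr _ _ _) _.
apply: tens_eq_trans (tens_eq_sym (tens_mul_consr _ _ _)).
by apply: tens_eq_cat => //; apply: tens_eq_mulr.
Qed.

Definition pure_tensor (a : A) (b : B) : tensor := \pi_tensor [:: (a, b)].

Definition tensor0 : tensor := \pi_tensor [::].
Definition tensorD (x y : tensor) : tensor := \pi_tensor (repr x ++ repr y).
Definition tensorN (x : tensor) : tensor := \pi_tensor (tens_opp (repr x)).
Definition tensor1 : tensor := pure_tensor 1 1.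
Definition tensorM (x y : tensor) : tensor :=
  \pi_tensor (tens_mul (repr x) (repr y)).

Lemma tensor_piD s t :
  \pi_tensor (s ++ t) = tensorD (\pi_tensor s) (\pi_tensor t).
Proof.
by apply/tensor_eqP/tens_eq_sym/tens_eq_cat; apply: tens_eq_repr.
Qed.

Lemma tensor_piN s : \pi_tensor (tens_opp s) = tensorN (\pi_tensor s).
Proof. by apply/tensor_eqP/tens_eq_sym/tens_eq_opp/tens_eq_repr. Qed.

Lemma tensor_piM s t :
  \pi_tensor (tens_mul s t) = tensorM (\pi_tensor s) (\pi_tensor t).
Proof.
by apply/tensor_eqP/tens_eq_sym/tens_eq_mul; apply: tens_eq_repr.
Qed.

Fact tensorDA : associative tensorD.
Proof.
move=> x y z.
have [[s ->] [t ->] [u ->]] := And3 (tensorW x) (tensorW y) (tensorW z).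
by rewrite -!tensor_piD catA.
Qed.
Fact tensorDC : commutative tensorD.
Proof.
move=> x y; have [[s ->] [t ->]] := conj (tensorW x) (tensorW y).
by rewrite -!tensor_piD; apply/tensor_eqP/tens_eq_catC.
Qed.
Fact tensor0D : left_id tensor0 tensorD.
Proof. by move=> x; have [s ->] := tensorW x; rewrite -tensor_piD. Qed.
Fact tensorND : left_inverse tensor0 tensorN tensorD.
Proof.
move=> x; have [s ->] := tensorW x.
by rewrite -tensor_piN -tensor_piD; apply/tensor_eqP/tens_oppP.
Qed.

HB.instance Definition _ :=
  GRing.isZmodule.Build tensor tensorDA tensorDC tensor0D tensorND.

Lemma tensor_pi_cat s t :
  \pi_tensor (s ++ t) = \pi_tensor s + \pi_tensor t.
Proof. exact: tensor_piD. Qed.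

Fact tensorMA : associative tensorM.
Proof.
move=> x y z.
have [[s ->] [t ->] [u ->]] := And3 (tensorW x) (tensorW y) (tensorW z).
rewrite -!tensor_piM; congr (\pi_tensor _).
rewrite /tens_mul; elim: s => //= -[a b] s ->.
rewrite allpairs_cat; congr (_ ++ _).
elim: t => //= -[c d] t IHt; rewrite map_cat IHt; congr (_ ++ _).
by rewrite -map_comp; apply: eq_map => -[e f]; rewrite /tens_mul1 /= !mulrA.
Qed.
Fact tensor1M : left_id tensor1 tensorM.
Proof.
move=> x; have [s ->] := tensorW x; rewrite -tensor_piM; congr (\pi_tensor _).
rewrite /tens_mul /= cats0 -[RHS]map_id; apply: eq_map => -[a b].
by rewrite /tens_mul1 /= !mul1r.
Qed.
Fact tensorM1 : right_id tensor1 tensorM.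
Proof.
move=> x; have [s ->] := tensorW x; rewrite -tensor_piM; congr (\pi_tensor _).
rewrite /tens_mul allpairs1r -[RHS]map_id; apply: eq_map => -[a b].
by rewrite /tens_mul1 /= !mulr1.
Qed.
Fact tensorMDl : left_distributive tensorM +%R.
Proof.
move=> x y z.
have [[s ->] [t ->] [u ->]] := And3 (tensorW x) (tensorW y) (tensorW z).
rewrite -tensor_pi_cat -!tensor_piM -tensor_pi_cat.
by rewrite /tens_mul allpairs_cat.
Qed.
Fact tensorMDr : right_distributive tensorM +%R.
Proof.
move=> x y z.
have [[s ->] [t ->] [u ->]] := And3 (tensorW x) (tensorW y) (tensorW z).
rewrite -tensor_pi_cat -!tensor_piM -tensor_pi_cat.
by apply/tensor_eqP/tens_eq_perm; apply: permEl; apply: perm_allpairs_catr.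
Qed.

HB.instance Definition _ := GRing.Zmodule_isPzRing.Build tensor
  tensorMA tensor1M tensorM1 tensorMDl tensorMDr.

Lemma pure_tensorDl a a' b :
  pure_tensor (a + a') b = pure_tensor a b + pure_tensor a' b.
Proof.
rewrite -tensor_pi_cat; exact/tensor_eqP/tens_eq_Dl.
Qed.

Lemma pure_tensorDr a b b' :
  pure_tensor a (b + b') = pure_tensor a b + pure_tensor a b'.
Proof.
rewrite -tensor_pi_cat; exact/tensor_eqP/tens_eq_Dr.
Qed.

Lemma pure_tensorZ c a b :
  pure_tensor (kalg_emb A c * a) b = pure_tensor a (kalg_emb B c * b).
Proof. exact/tensor_eqP/tens_eq_Z. Qed.

Lemma pure_tensorM a b a' b' :
  pure_tensor a b * pure_tensor a' b' = pure_tensor (a * a') (b * b').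
Proof. by rewrite -[LHS]tensor_piM. Qed.

Lemma tensor_sum_pure s :
  \pi_tensor s = \sum_(u <- s) pure_tensor u.1 u.2.
Proof.
elim: s => [|[a b] s IHs]; first by rewrite big_nil.
by rewrite big_cons -IHs -cat1s tensor_pi_cat.
Qed.

Definition tensor_emb (c : k) : tensor := pure_tensor (kalg_emb A c) 1.

Fact tensor_emb_is_zmod_morphism : zmod_morphism tensor_emb.
Proof.
move=> c d; apply/eqP; rewrite eq_sym subr_eq /tensor_emb -pure_tensorDl.
by rewrite -rmorphD subrK.
Qed.
Fact tensor_emb_is_monoid_morphism : monoid_morphism tensor_emb.
Proof.
split=> [|c d]; first by rewrite /tensor_emb rmorph1.
by rewrite /tensor_emb pure_tensorM rmorphM mulr1.
Qed.

HB.instance Definition _ := GRing.isZmodMorphism.Build k tensor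
  tensor_emb tensor_emb_is_zmod_morphism.
HB.instance Definition _ := GRing.isMonoidMorphism.Build k tensor
  tensor_emb tensor_emb_is_monoid_morphism.

Fact tensor_embC (c : k) (x : tensor) : tensor_emb c * x = x * tensor_emb c.
Proof.
have [s ->] := tensorW x; rewrite tensor_sum_pure mulr_sumr mulr_suml.
by apply: eq_bigr => u _; rewrite !pure_tensorM kalg_embC mulr1 mul1r.
Qed.

Definition tensor_kalg : kalg k := @KAlg k tensor tensor_emb tensor_embC.

End Tensor.

Section Morita.
Variable k : fieldType.

(* k-linear functors from left A-modules to left B-modules; k acts on a left *)
(* A-module through kalg_emb A, and morphisms are compared pointwise.          *)
Record mod_functor (A B : kalg k) := ModFunctor {
  fobj :> lmodType A -> lmodType B;
  fmap : forall M N : lmodType A, {linear M -> N} -> {linear fobj M -> fobj N};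
  fmap_ext : forall (M N : lmodType A) (f g : {linear M -> N}),
    f =1 g -> fmap f =1 fmap g;
  fmap_id : forall M : lmodType A, fmap (idfun : {linear M -> M}) =1 id;
  fmap_comp : forall (M N P : lmodType A)
      (g : {linear N -> P}) (f : {linear M -> N}),
    fmap (g \o f) =1 fmap g \o fmap f;
  fmap_klinear : forall (M N : lmodType A) (c : k) (f g h : {linear M -> N}),
    (forall x, h x = kalg_emb A c *: f x + g x) ->
    forall y, fmap h y = kalg_emb B c *: fmap f y + fmap g y
}.

Arguments fmap {A B} _ {M N}.
Arguments fmap_id {A B} _ {M}.
Arguments fmap_comp {A B} _ {M N P}.

Definition id_functor (A : kalg k) : mod_functor A A :=
  @ModFunctor A A id (fun M N f => f)
    (fun _ _ _ _ fg => fg) (fun _ _ => erefl) (fun _ _ _ _ _ _ => erefl)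
    (fun _ _ _ _ _ _ hE => hE).

Section Comp.
Variables (A B C : kalg k) (G : mod_functor B C) (F : mod_functor A B).

Definition comp_fmap (M N : lmodType A) (f : {linear M -> N}) :
  {linear G (F M) -> G (F N)} := fmap G (fmap F f).

Fact comp_fmap_ext (M N : lmodType A) (f g : {linear M -> N}) :
  f =1 g -> comp_fmap f =1 comp_fmap g.
Proof. by move=> fg; apply/fmap_ext/fmap_ext. Qed.

Fact comp_fmap_id (M : lmodType A) :
  comp_fmap (idfun : {linear M -> M}) =1 id.
Proof.
move=> x; rewrite -[RHS](fmap_id G); apply: fmap_ext => y.
exact: fmap_id.
Qed.

Fact comp_fmap_comp (M N P : lmodType A)
    (g : {linear N -> P}) (f : {linear M -> N}) :
  comp_fmap (g \o f) =1 comp_fmap g \o comp_fmap f.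
Proof.
move=> x; rewrite -[RHS](fmap_comp G); apply: fmap_ext => y.
exact: fmap_comp.
Qed.

Fact comp_fmap_klinear (M N : lmodType A) (c : k) (f g h : {linear M -> N}) :
  (forall x, h x = kalg_emb A c *: f x + g x) ->
  forall y, comp_fmap h y = kalg_emb C c *: comp_fmap f y + comp_fmap g y.
Proof. by move=> hE; apply/fmap_klinear/fmap_klinear. Qed.

Definition comp_functor : mod_functor A C :=
  ModFunctor comp_fmap_ext comp_fmap_id comp_fmap_comp comp_fmap_klinear.

End Comp.

Definition nat_iso (A B : kalg k) (F G : mod_functor A B) : Prop :=
  exists eta : forall M : lmodType A, {linear F M -> G M},
    (forall M, bijective (eta M)) /\
    (forall (M N : lmodType A) (f : {linear M -> N}),
       eta N \o fmap F f =1 fmap G f \o eta M).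

Definition morita_equivalent (A B : kalg k) : Prop :=
  exists (F : mod_functor A B) (G : mod_functor B A),
    nat_iso (comp_functor G F) (id_functor A) /\
    nat_iso (comp_functor F G) (id_functor B).

End Morita.

Arguments fmap {k A B} _ {M N}.
Arguments fmap_id {k A B} _ {M}.
Arguments fmap_comp {k A B} _ {M N P}.

Section VV.
Variables (k : fieldType) (p q : k).

(* (n, e) acts by lambda |-> p ^ (2 n) lambda ^ (+-1), with e = true for -1. *)
Definition vv_act (g : int * bool) (lambda : k) : k :=
  p ^ (2 * g.1) * (if g.2 then lambda^-1 else lambda).

Definition vv_orbit (I : set k) : Prop :=
  exists2 lambda, lambda != 0 &
    forall a, I a <-> exists g, a = vv_act g lambda.

(* Elements of N K are finite multisets on k: nu a is the coefficient of a. *)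
Definition theta_NN (K : set k) (nu : {mset k}%mset) : Prop :=
  (forall a, nu a != 0%N -> K a) /\ (forall a, nu a = nu a^-1).

Definition arrow (K : set k) (a b : k) : bool :=
  [&& a \in K, b \in K & a == p ^+ 2 * b].
Definition arrow_to K a b := arrow K a b && ~~ arrow K b a.
Definition arrow_both K a b := arrow K a b && arrow K b a.

Definition theta_weight m (i : m.-tuple k) : {mset k}%mset :=
  seq_mset (i ++ [seq a^-1 | a <- i]).

Definition theta_seqs (K : set k) (nu : {mset k}%mset) m : {fset m.-tuple k} :=
  [fset i in [seq map_tuple val t | t : m.-tuple (finsupp nu)]
     | all (fun a => a \in K) i && (theta_weight i == nu)]%fset.

Lemma theta_seqsP K nu m (i : m.-tuple k) :
  reflect ((forall l, K (tnth i l)) /\ theta_weight i = nu)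
          (i \in theta_seqs K nu m).
Proof.
apply: (iffP idP).
  rewrite !inE /= => /and3P[_ /allP Ki /eqP wi]; split=> // l.
  by have := Ki _ (mem_tnth l i); rewrite inE.
case=> Ki wi; rewrite !inE /= wi eqxx andbT; apply/andP; split; last first.
  by apply/allP => _ /tnthP[l ->]; rewrite inE.
have si (l : 'I_m) : tnth i l \in finsupp nu.
  rewrite mem_finsupp -wi mset_seqE -lt0n -has_count has_pred1 mem_cat.
  by rewrite mem_tnth.
apply/mapP; exists [tuple [` si l]%fset | l < m]; first by rewrite mem_enum.
by apply: eq_from_tnth => l; rewrite tnth_map tnth_mktuple.
Qed.


Section Generators.
Variables (K : set k) (nu : {mset k}%mset) (n : nat).

(* The generators and relations for |nu| = 2 (n + 1); indices are shifted by  *)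
(* one: gen_x l, gen_sigma l are x_(l+1), sigma_(l+1), and sigma_(l+1) swaps  *)
(* the entries at the positions pos l and posS l.                             *)
Inductive vv_gen : predArgType :=
| gen_x of 'I_n.+1
| gen_sigma of 'I_n
| gen_pi
| gen_e of theta_seqs K nu n.+1.

Definition vv_gen_enc (g : vv_gen) :
    'I_n.+1 + 'I_n + unit + theta_seqs K nu n.+1 :=
  match g with
  | gen_x l => inl (inl (inl l))
  | gen_sigma l => inl (inl (inr l))
  | gen_pi => inl (inr tt)
  | gen_e i => inr i
  end.
Definition vv_gen_dec (s : 'I_n.+1 + 'I_n + unit + theta_seqs K nu n.+1) :=
  match s with
  | inl (inl (inl l)) => gen_x l
  | inl (inl (inr l)) => gen_sigma l
  | inl (inr _) => gen_pi
  | inr i => gen_e i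
  end.
Fact vv_gen_encK : cancel vv_gen_enc vv_gen_dec. Proof. by case. Qed.
HB.instance Definition _ := Choice.copy vv_gen (can_type vv_gen_encK).

Definition pos (l : 'I_n) : 'I_n.+1 := widen_ord (leqnSn n) l.
Definition posS (l : 'I_n) : 'I_n.+1 := lift ord0 l.

Definition swap_seq (l : 'I_n) (i : n.+1.-tuple k) : n.+1.-tuple k :=
  [tuple tnth i (tperm (pos l) (posS l) j) | j < n.+1].
Definition inv_seq (i : n.+1.-tuple k) : n.+1.-tuple k :=
  [tuple if j == ord0 then (tnth i j)^-1 else tnth i j | j < n.+1].

Lemma swap_seq_in l i :
  i \in theta_seqs K nu n.+1 -> swap_seq l i \in theta_seqs K nu n.+1.
Proof.
case/theta_seqsP=> Ki wi; apply/theta_seqsP; split=> [j|].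
  by rewrite tnth_mktuple; apply: Ki.
rewrite -wi; apply/eq_seq_msetP.
have ps : perm_eq (swap_seq l i) i.
  by apply/tuple_permP; exists (tperm (pos l) (posS l)).
by apply: perm_cat => //; apply: perm_map.
Qed.

Lemma inv_seq_in i : theta_NN K nu ->
  i \in theta_seqs K nu n.+1 -> inv_seq i \in theta_seqs K nu n.+1.
Proof.
case=> Knu snu /theta_seqsP[Ki wi].
suff wj : theta_weight (inv_seq i) = nu.
  apply/theta_seqsP; split=> // j; apply: Knu.
  rewrite -wj mset_seqE -lt0n -has_count has_pred1 mem_cat.
  by rewrite mem_tnth.
rewrite -[RHS]wi; apply/eq_seq_msetP.
case: (tupleP i) => a t; rewrite /inv_seq.
have -> : [tuple if j == ord0 then (tnth [tuple of a :: t] j)^-1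
      else tnth [tuple of a :: t] j | j < n.+1] = [tuple of a^-1 :: t].
  apply: eq_from_tnth => j; rewrite tnth_mktuple.
  by case: (unliftP ord0 j) => [j'|] ->; rewrite ?eqxx ?tnth0 // !tnthS.
apply/seq.permP => P; rewrite /= invrK !count_cat /=.
by rewrite addnCA [in RHS]addnCA; congr (_ + _)%N; rewrite addnCA.
Qed.

Local Notation F := (free_alg k vv_gen).
Local Notation Theta := (theta_seqs K nu n.+1).

Definition vv_x l : F := free_gen k (gen_x l).
Definition vv_sigma l : F := free_gen k (gen_sigma l).
Definition vv_pi : F := free_gen k gen_pi.
(* The value 0 outside Theta is never used: Theta is stable under swap_seq    *)
(* and inv_seq.                                                               *)
Definition vv_e (i : n.+1.-tuple k) : F :=
  if insub i is Some i' then free_gen k (gen_e i') else 0.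

Local Notation "''x_' l" := (vv_x l) (at level 8, l at level 2).
Local Notation "''s_' l" := (vv_sigma l) (at level 8, l at level 2).

Definition sigma_sq_rhs (l : 'I_n) (i : n.+1.-tuple k) : F :=
  let a := tnth i (pos l) in let b := tnth i (posS l) in
  let x := 'x_(pos l) in let y := 'x_(posS l) in
  if a == b then 0
  else if arrow_to K b a then y - x
  else if arrow_to K a b then x - y
  else if arrow_both K a b then (y - x) * (x - y)
  else 1.

(* l and l' are consecutive, so that pos l' is posS l. *)
Definition braid_rhs (l l' : 'I_n) (i : n.+1.-tuple k) : F :=
  let a := tnth i (pos l) in let b := tnth i (posS l) in
  let c := tnth i (posS l') in
  if a == c then
    if arrow_to K a b then 1
    else if arrow_to K b a then -1
    else if arrow_both K a b then
      2%:R * 'x_(posS l) - 'x_(posS l') - 'x_(pos l)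
    else 0
  else 0.

Definition sigma_x_rhs (l : 'I_n) (j : 'I_n.+1) (i : n.+1.-tuple k) : F :=
  if tnth i (pos l) == tnth i (posS l) then
    if j == pos l then -1 else if j == posS l then 1 else 0
  else 0.

Definition pi_sq_rhs (i : n.+1.-tuple k) : F :=
  if tnth i ord0 == q then 'x_ord0
  else if tnth i ord0 == q^-1 then - 'x_ord0
  else 1.

Definition sigma_pi_rhs (l : 'I_n) (i : n.+1.-tuple k) : F :=
  let a := tnth i (pos l) in let b := tnth i (posS l) in
  if (a^-1 == b) && (b == q^-1) then 's_l
  else if (a^-1 == b) && (b == q) then - 's_l
  else 0.

Inductive vv_rel : F -> F -> Prop :=
| vv_ee i j : i \in Theta -> j \in Theta ->
    vv_rel (vv_e i * vv_e j) (if i == j then vv_e i else 0)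
| vv_sigma_e (l : 'I_n) i : i \in Theta ->
    vv_rel ('s_l * vv_e i) (vv_e (swap_seq l i) * 's_l)
| vv_x_e (j : 'I_n.+1) i : i \in Theta ->
    vv_rel ('x_j * vv_e i) (vv_e i * 'x_j)
| vv_sum_e :
    vv_rel (\sum_(i <- Theta) vv_e i) 1
| vv_xx (j j' : 'I_n.+1) :
    vv_rel ('x_j * 'x_j') ('x_j' * 'x_j)
| vv_sigma_sq (l : 'I_n) i : i \in Theta ->
    vv_rel ('s_l ^+ 2 * vv_e i) (sigma_sq_rhs l i * vv_e i)
| vv_sigma_far (l l' : 'I_n) : (l.+1 < l')%N || (l'.+1 < l)%N ->
    vv_rel ('s_l * 's_l') ('s_l' * 's_l)
| vv_braid (l l' : 'I_n) i : l' = l.+1 :> nat -> i \in Theta ->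
    vv_rel (('s_l' * 's_l * 's_l' - 's_l * 's_l' * 's_l) * vv_e i)
           (braid_rhs l l' i * vv_e i)
| vv_sigma_x (l : 'I_n) (j : 'I_n.+1) i : i \in Theta ->
    vv_rel (('s_l * 'x_j - 'x_(tperm (pos l) (posS l) j) * 's_l) * vv_e i)
           (sigma_x_rhs l j i * vv_e i)
| vv_pi_e i : i \in Theta ->
    vv_rel (vv_pi * vv_e i) (vv_e (inv_seq i) * vv_pi)
| vv_pi_sq i : i \in Theta ->
    vv_rel (vv_pi ^+ 2 * vv_e i) (pi_sq_rhs i * vv_e i)
| vv_pi_x0 :
    vv_rel (vv_pi * 'x_ord0) (- 'x_ord0 * vv_pi)
| vv_pi_x (j : 'I_n.+1) : j != ord0 ->
    vv_rel (vv_pi * 'x_j) ('x_j * vv_pi)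
| vv_sigma_pi (l : 'I_n) i : l = 0%N :> nat -> i \in Theta ->
    vv_rel (('s_l * vv_pi) ^+ 2 * vv_e i - (vv_pi * 's_l) ^+ 2 * vv_e i)
           (sigma_pi_rhs l i * vv_e i)
| vv_pi_sigma (l : 'I_n) : l != 0%N :> nat ->
    vv_rel (vv_pi * 's_l) ('s_l * vv_pi).

End Generators.

Definition mset_half (nu : {mset k}%mset) : nat :=
  (\sum_(a <- finsupp nu) nu a)./2.

Definition VV (K : set k) (nu : {mset k}%mset) : kalg k :=
  if mset_half nu is n.+1 then presented_kalg (@vv_rel K nu n)
  else base_kalg k.

End VV.

(* Main.v *)
Require Import Defs.
From HB Require Import structures.
From mathcomp Require Import all_boot all_fingroup all_algebra finmap multiset.
From mathcomp Require Import generic_quotient monalg xfinmap.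
From mathcomp Require Import boolp classical_sets.

(** Let W be the VV algebra of nu over the union of I and J, and R the tensor
    product of the VV algebras of nu1 and nu2. Give the letters in I and in J
    two different colours. A word of weight nu has a colour word, in which
    the numbers of letters of each colour are fixed, and two parts, the words
    of weights nu1 and nu2 formed by its letters of each colour; these data
    determine the word. The idea is that the two colours do not interact: for
    letters of different colours the generator sigma satisfies
    sigma ^ 2 = 1 and the braid relation without correction, so that it
    merely permutes colour words. Hence W is isomorphic to the algebra of N x N
    matrices over R, where N > 0 is the number of colour words, and a ring is
    Morita equivalent to its matrix rings (morita_matrix).

    The isomorphism is constructed without a basis of W, as a pair of
    homomorphisms given on generators, whose composites are the identity
    because they fix generators.

    The homomorphism from W to matrices (W_to_matrix) sends x at the position l
    to a diagonal matrix: its entry at the colour word c is the generator x of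
    the factor of colour c_l, with index the number of earlier letters of this
    colour. The image of pi is diagonal as well, and sigma at l either acts in
    the same way, if the colours at l and l + 1 agree, or exchanges two colour
    words. The relations (matrix_axioms) hold because each is a relation of one
    factor, a commutation of the two factors, or an identity between
    permutations.

    In the other direction, products of exchanges of different colours form a
    system of matrix units in W (cunit), so that W is a matrix algebra over
    the commutant of the units, and an element of the commutant is determined
    by its restriction to any single colour word (units_commute_ext). The
    generators of the factor of one colour are defined by their restriction
    to the colour word in which this colour comes first. They satisfy the
    relations of that factor (part_axioms), since the restrictions are
    generators of W. That the two families commute (part_comm), and
    that the composites are the identity, requires the restrictions to other
    colour words; they are the expected generators of W, by induction along
    exchanges of adjacent colours (seen_x, seen_s, seen_p). Here a
    letter that crosses a pair of letters of the other colour uses the braid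
    relation, and the commutation of the two generators pi is the relation
    between pi and the first sigma. *)

Set Implicit Arguments.
Unset Strict Implicit.
Unset Printing Implicit Defensive.

Import GRing.Theory.
Local Open Scope ring_scope.

(** * Homomorphisms of algebras and universal properties *)

Record khom (k : fieldType) (A B : kalg k) := KHom {
  khom_fun :> {rmorphism A -> B};
  khom_emb : forall c, khom_fun (kalg_emb A c) = kalg_emb B c
}.

Section HomOperations.
Variables (k : fieldType) (A B C : kalg k).

Fact khom_id_emb c : (idfun : {rmorphism A -> A}) (kalg_emb A c) = kalg_emb A c.
Proof. by []. Qed.
Definition khom_id : khom A A := KHom khom_id_emb.

Variables (g : khom B C) (f : khom A B).
Fact khom_comp_emb c : (g \o f) (kalg_emb A c) = kalg_emb C c.
Proof. by rewrite /= !khom_emb. Qed.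
Definition khom_comp : khom A C := KHom khom_comp_emb.

End HomOperations.

Section Subalgebras.
Variables (k : fieldType) (A : kalg k).

Definition subalgebra (P : A -> Prop) : Prop :=
  [/\ forall c, P (kalg_emb A c), forall x y, P x -> P y -> P (x + y)
    & forall x y, P x -> P y -> P (x * y)].

(** Two homomorphisms that agree on generators are equal: with the induction
    principle of a presented algebra, this turns an identity between
    homomorphisms into a check on generators. *)
Lemma subalgebra_equalizer (C : kalg k) (f f' : khom A C) :
  subalgebra (fun x => f x = f' x).
Proof.
split=> [c|x y xE yE|x y xE yE]; first by rewrite !khom_emb.
  by rewrite !rmorphD xE yE.
by rewrite !rmorphM xE yE.
Qed.

Lemma subalgebra_commutant (C : kalg k) (f : khom A C) z :
  subalgebra (fun x => f x * z = z * f x).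
Proof.
split=> [c|x y xE yE|x y xE yE]; first by rewrite khom_emb kalg_embC.
  by rewrite rmorphD mulrDl mulrDr xE yE.
by rewrite rmorphM -mulrA yE !mulrA xE.
Qed.

Lemma subalgebra_sum P (I : Type) (r : seq I) (F : I -> A) :
  subalgebra P -> (forall i, P (F i)) -> P (\sum_(i <- r) F i).
Proof.
case=> Pc PD _ PF; apply: big_ind => //.
by rewrite -(rmorph0 (kalg_emb A)).
Qed.

Lemma subalgebra_prod P (I : Type) (r : seq I) (F : I -> A) :
  subalgebra P -> (forall i, P (F i)) -> P (\prod_(i <- r) F i).
Proof.
case=> Pc _ PM PF; apply: big_ind => //.
by rewrite -(rmorph1 (kalg_emb A)).
Qed.

End Subalgebras.

Section FreeEvaluation.
Variables (k : fieldType) (G : choiceType) (C : kalg k) (g : G -> C).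

Definition word_eval (w : {fmonom G}) : C := \prod_(a <- w) g a.

Definition free_eval (u : free_alg k G) : C :=
  \sum_(w <- msupp u) kalg_emb C u@_w * word_eval w.

Lemma free_evalEw (d : {fset {fmonom G}}) u : (msupp u `<=` d)%fset ->
  free_eval u = \sum_(w <- d) kalg_emb C u@_w * word_eval w.
Proof.
move=> le; rewrite [LHS](big_fset_incl _ le) => //= x xd /mcoeff_outdom ->.
by rewrite rmorph0 mul0r.
Qed.

Lemma free_evalU c w : free_eval << c *g w >> = kalg_emb C c * word_eval w.
Proof. by rewrite (free_evalEw (@msuppU_le _ _ _ _)) big_seq_fset1 mcoeffUU. Qed.

Fact free_eval_is_zmod_morphism : zmod_morphism free_eval.
Proof.
move=> u v; pose d := (msupp (u - v) `|` (msupp u `|` msupp v))%fset.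
rewrite 3?(@free_evalEw d) /d; first last.
- exact: fsubsetUl.
- by rewrite fsetUCA; exact: fsubsetUl.
- by rewrite fsetUA; exact: fsubsetUr.
by rewrite -sumrB; apply/eq_bigr=> w _; rewrite mcoeffB rmorphB mulrBl.
Qed.

HB.instance Definition _ := GRing.isZmodMorphism.Build (free_alg k G) C
  free_eval free_eval_is_zmod_morphism.

Fact free_eval_is_monoid_morphism : monoid_morphism free_eval.
Proof.
split=> [|u v].
  by rewrite [1]/(<< 1 *g _ >>) free_evalU rmorph1 mul1r /word_eval fm1 big_nil.
rewrite malgME raddf_sum mulr_suml /=; apply: eq_bigr=> i _.
rewrite raddf_sum mulr_sumr /=; apply: eq_bigr=> j _.
rewrite free_evalU rmorphM /word_eval fmM big_cat /=.
by rewrite -!mulrA; congr (_ * _); rewrite !mulrA kalg_embC.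
Qed.

HB.instance Definition _ := GRing.isMonoidMorphism.Build (free_alg k G) C
  free_eval free_eval_is_monoid_morphism.

Lemma free_eval_gen a : free_eval (free_gen k a) = g a.
Proof. by rewrite free_evalU rmorph1 mul1r /word_eval fmU big_seq1. Qed.

Lemma free_eval_const c : free_eval c%:MP = kalg_emb C c.
Proof. by rewrite free_evalU /word_eval fm1 big_nil mulr1. Qed.

End FreeEvaluation.

Section PresentedUniversal.
Variables (k : fieldType) (G : choiceType).
Variable rel : free_alg k G -> free_alg k G -> Prop.
Local Notation P := (presented_kalg rel).

Definition presented_gen (a : G) : P := presented_pi rel (free_gen k a).

Lemma presented_rel u v :
  rel u v -> presented_pi rel u = presented_pi rel v.
Proof. by move=> uv; apply/presented_eqP; apply: rel_ideal_rel. Qed.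

Section Descent.
Variables (C : kalg k) (g : G -> C).
Hypothesis g_rel : forall u v, rel u v -> free_eval g u = free_eval g v.

Lemma free_eval_ideal u : rel_ideal rel u -> free_eval g u = 0.
Proof.
elim=> {u} [u v /g_rel uv||u v _ u0 _ v0|a u b _ u0].
- by rewrite raddfB /= uv subrr.
- exact: raddf0.
- by rewrite raddfD /= u0 v0 addr0.
- by rewrite !rmorphM /= u0 mulr0 mul0r.
Qed.

Definition presented_eval (x : P) : C := free_eval g (repr x).

Lemma presented_eval_pi u : presented_eval (presented_pi rel u) = free_eval g u.
Proof.
apply/eqP; rewrite -subr_eq0 -raddfB /=; apply/eqP/free_eval_ideal.
by apply/presented_eqP; rewrite reprK.
Qed.

Fact presented_eval_is_zmod_morphism : zmod_morphism presented_eval.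
Proof.
move=> x y; have [[u ->] [v ->]] := conj (presentedW x) (presentedW y).
by rewrite -(raddfB (presented_pi rel)) !presented_eval_pi raddfB.
Qed.
Fact presented_eval_is_monoid_morphism : monoid_morphism presented_eval.
Proof.
split=> [|x y]; first by rewrite -(rmorph1 (presented_pi rel)) presented_eval_pi rmorph1.
have [[u ->] [v ->]] := conj (presentedW x) (presentedW y).
by rewrite -(rmorphM (presented_pi rel)) !presented_eval_pi rmorphM.
Qed.

HB.instance Definition _ := GRing.isZmodMorphism.Build P C
  presented_eval presented_eval_is_zmod_morphism.
HB.instance Definition _ := GRing.isMonoidMorphism.Build P C
  presented_eval presented_eval_is_monoid_morphism.

(** The universal property of generators and relations: the evaluation of
    noncommutative polynomials kills the ideal of the relations as soon as it
    respects each relation. *)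
Lemma presented_lift : exists f : khom P C, forall a, f (presented_gen a) = g a.
Proof.
have eC c : presented_eval (kalg_emb P c) = kalg_emb C c.
  by rewrite /= presented_eval_pi free_eval_const.
by exists (KHom (khom_fun := presented_eval) eC) => a /=;
  rewrite presented_eval_pi free_eval_gen.
Qed.

End Descent.

(** The quotient map is itself an evaluation, at the classes of the
    generators; hence every element of a presented algebra is a sum of
    products of scalars and generators. *)
Lemma free_eval_presented u : free_eval presented_gen u = presented_pi rel u.
Proof.
rewrite [in RHS](monalgE u) raddf_sum /free_eval; apply: eq_bigr => w _ /=.
have -> : << u@_w *g w >> = (u@_w)%:MP * << w >> :> free_alg k G.
  by rewrite malgM_def fgmulUU mulr1 mul1m.
rewrite rmorphM /=; congr (_ * _); rewrite /word_eval.
case: w => s; elim: s => [|a s IHs] /=.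
  rewrite big_nil -(rmorph1 (presented_pi rel)); congr (presented_pi _ << _ >>).
  by rewrite -fmoneE.
rewrite big_cons IHs -rmorphM /=; congr presented_pi.
by rewrite /free_gen malgM_def fgmulUU mulr1 fmuE /mmul /= fmmulE.
Qed.

Lemma presented_ind (Q : P -> Prop) : subalgebra Q ->
  (forall a, Q (presented_gen a)) -> forall x, Q x.
Proof.
move=> Qalg Qgen x; have [u ->] := presentedW x.
rewrite -[X in Q X]/(presented_pi rel u) -free_eval_presented /free_eval.
apply: subalgebra_sum => // w; have [Qc _ QM] := Qalg.
by apply: QM => //; apply: subalgebra_prod.
Qed.

End PresentedUniversal.

Section TensorUniversal.
Variables (k : fieldType) (A B : kalg k).
Local Notation T := (tensor_kalg A B).

Definition tensor_inl (a : A) : T := pure_tensor a 1.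
Definition tensor_inr (b : B) : T := pure_tensor 1 b.

Fact tensor_inl_is_zmod_morphism : zmod_morphism tensor_inl.
Proof.
move=> x y; apply/eqP; rewrite eq_sym subr_eq /tensor_inl -pure_tensorDl.
by rewrite subrK.
Qed.
Fact tensor_inl_is_monoid_morphism : monoid_morphism tensor_inl.
Proof. by split=> // x y; rewrite /tensor_inl [RHS]pure_tensorM mulr1. Qed.
HB.instance Definition _ := GRing.isZmodMorphism.Build A T
  tensor_inl tensor_inl_is_zmod_morphism.
HB.instance Definition _ := GRing.isMonoidMorphism.Build A T
  tensor_inl tensor_inl_is_monoid_morphism.
Fact tensor_inl_emb c : tensor_inl (kalg_emb A c) = kalg_emb T c.
Proof. by []. Qed.
Definition tensor_inl_khom : khom A T := KHom tensor_inl_emb.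

Fact tensor_inr_is_zmod_morphism : zmod_morphism tensor_inr.
Proof.
move=> x y; apply/eqP; rewrite eq_sym subr_eq /tensor_inr -pure_tensorDr.
by rewrite subrK.
Qed.
Fact tensor_inr_is_monoid_morphism : monoid_morphism tensor_inr.
Proof. by split=> // x y; rewrite /tensor_inr [RHS]pure_tensorM mulr1. Qed.
HB.instance Definition _ := GRing.isZmodMorphism.Build B T
  tensor_inr tensor_inr_is_zmod_morphism.
HB.instance Definition _ := GRing.isMonoidMorphism.Build B T
  tensor_inr tensor_inr_is_monoid_morphism.
Fact tensor_inr_emb c : tensor_inr (kalg_emb B c) = kalg_emb T c.
Proof.
rewrite /tensor_inr -[kalg_emb B c]mulr1 -pure_tensorZ mulr1 //.
Qed.
Definition tensor_inr_khom : khom B T := KHom tensor_inr_emb.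

Lemma tensor_inlr a b : tensor_inl a * tensor_inr b = pure_tensor a b.
Proof. by rewrite [LHS]pure_tensorM mulr1 mul1r. Qed.

Lemma tensor_inC a b : tensor_inr b * tensor_inl a = tensor_inl a * tensor_inr b.
Proof. by rewrite tensor_inlr [LHS]pure_tensorM mulr1 mul1r. Qed.

Lemma tensor_ind (Q : T -> Prop) : subalgebra Q ->
    (forall a, Q (tensor_inl a)) -> (forall b, Q (tensor_inr b)) ->
  forall x, Q x.
Proof.
move=> Qalg Ql Qr x; have [s ->] := tensorW x; rewrite tensor_sum_pure.
apply: (subalgebra_sum (A := T)) => // u; rewrite -tensor_inlr.
by have [_ _ QM] := Qalg; apply: QM.
Qed.

Section Lift.
Variables (C : kalg k) (f : khom A C) (g : khom B C).
Hypothesis fgC : forall a b, g b * f a = f a * g b.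

Definition tens_sum_eval (s : tens_sum A B) : C := \sum_(u <- s) f u.1 * g u.2.

Lemma tens_sum_evalP s t : tens_eq s t -> tens_sum_eval s = tens_sum_eval t.
Proof.
rewrite /tens_sum_eval.
elim=> {s t} [s|s t _|t s u _ + _|s s' t t' _ + _|s t|b|a a' b|a b b'|c a b] //.
- by move=> -> ->.
- by rewrite !big_cat /= => -> ->.
- by rewrite !big_cat /= addrC.
- by rewrite big_seq1 big_nil /= rmorph0 mul0r.
- by rewrite !big_cons !big_nil /= rmorphD mulrDl !addr0.
- by rewrite !big_cons !big_nil /= rmorphD mulrDr !addr0.
- rewrite !big_seq1 /= !rmorphM !khom_emb mulrA.
  by rewrite (kalg_embC c (f a)).
Qed.

Definition tensor_eval (x : T) : C := tens_sum_eval (repr (x : tensor A B)).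

Lemma tensor_eval_pi s : tensor_eval (\pi_(tensor A B) s)%qT = tens_sum_eval s.
Proof. exact/tens_sum_evalP/tens_eq_repr. Qed.

Lemma tensor_eval_pure a b : tensor_eval (pure_tensor a b) = f a * g b.
Proof. by rewrite tensor_eval_pi /tens_sum_eval big_seq1. Qed.

Lemma tensor_evalD x y : tensor_eval (x + y) = tensor_eval x + tensor_eval y.
Proof.
have [[s ->] [t ->]] := conj (tensorW x) (tensorW y).
by rewrite -tensor_pi_cat !tensor_eval_pi /tens_sum_eval big_cat.
Qed.

Lemma tensor_eval0 : tensor_eval 0 = 0.
Proof. by rewrite [LHS]tensor_eval_pi /tens_sum_eval big_nil. Qed.

Lemma tensor_eval_sum (I : Type) (r : seq I) (F : I -> T) :
  tensor_eval (\sum_(i <- r) F i) = \sum_(i <- r) tensor_eval (F i).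
Proof. exact: (big_morph _ tensor_evalD tensor_eval0). Qed.

Fact tensor_eval_is_zmod_morphism : zmod_morphism tensor_eval.
Proof.
by move=> x y; apply/eqP; rewrite eq_sym subr_eq -tensor_evalD subrK.
Qed.
Fact tensor_eval_is_monoid_morphism : monoid_morphism tensor_eval.
Proof.
split=> [|x y]; first by rewrite [LHS]tensor_eval_pure !rmorph1 mulr1.
have [[s ->] [t ->]] := conj (tensorW x) (tensorW y).
rewrite !tensor_sum_pure mulr_suml !tensor_eval_sum mulr_suml.
apply: eq_bigr => u _; rewrite mulr_sumr tensor_eval_sum mulr_sumr.
apply: eq_bigr => v _; rewrite pure_tensorM !tensor_eval_pure !rmorphM.
by rewrite -!mulrA; congr (_ * _); rewrite !mulrA fgC.
Qed.
HB.instance Definition _ := GRing.isZmodMorphism.Build T C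
  tensor_eval tensor_eval_is_zmod_morphism.
HB.instance Definition _ := GRing.isMonoidMorphism.Build T C
  tensor_eval tensor_eval_is_monoid_morphism.

(** The universal property of the tensor product of algebras: the images of
    the two factors have to commute because the factors do. *)
Lemma tensor_lift : exists h : khom T C,
  (forall a, h (tensor_inl a) = f a) /\ (forall b, h (tensor_inr b) = g b).
Proof.
have eC c : tensor_eval (kalg_emb T c) = kalg_emb C c.
  by rewrite [LHS]tensor_eval_pure khom_emb rmorph1 mulr1.
exists (KHom (khom_fun := tensor_eval) eC); split=> [a|b] /=;
  by rewrite tensor_eval_pure rmorph1 ?mulr1 ?mul1r.
Qed.

End Lift.
End TensorUniversal.

(** * Matrix algebras *)

Section MatrixAlgebra.
Variables (k : fieldType) (R : kalg k) (n : nat).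

Definition mx_emb (c : k) : 'M[R]_n := (kalg_emb R c)%:M.
Fact mx_emb_is_zmod_morphism : zmod_morphism mx_emb.
Proof. by move=> c d; rewrite /mx_emb !rmorphB. Qed.
Fact mx_emb_is_monoid_morphism : monoid_morphism mx_emb.
Proof. by split=> [|c d]; rewrite /mx_emb ?rmorph1 // rmorphM scalar_mxM. Qed.
HB.instance Definition _ := GRing.isZmodMorphism.Build k 'M[R]_n
  mx_emb mx_emb_is_zmod_morphism.
HB.instance Definition _ := GRing.isMonoidMorphism.Build k 'M[R]_n
  mx_emb mx_emb_is_monoid_morphism.
Fact mx_embC (c : k) (M : 'M[R]_n) : mx_emb c * M = M * mx_emb c.
Proof.
apply/matrixP => i j; rewrite [in LHS]/GRing.mul /= mul_scalar_mx mxE kalg_embC !mxE (bigD1 j) //=.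
rewrite big1 => [|l /negPf lj]; last by rewrite !mxE lj mulr0.
by rewrite mxE eqxx addr0.
Qed.
Definition mx_kalg : kalg k := KAlg mx_embC.

Lemma mx_scalar_embE c : kalg_emb mx_kalg c = (kalg_emb R c)%:M.
Proof. by []. Qed.

Lemma mul_mx_scalarE (M : 'M[R]_n) (r : R) i j : (M *m r%:M) i j = M i j * r.
Proof.
rewrite !mxE (bigD1 j) //= big1 => [|l /negPf lj].
  by rewrite mxE eqxx addr0.
by rewrite !mxE lj mulr0.
Qed.

End MatrixAlgebra.

Section ScalarMatrices.
Variables (k : fieldType) (R : kalg k) (n : nat).

Definition mx_scalar_fun (r : R) : mx_kalg R n := r%:M.
Fact mx_scalar_is_zmod_morphism : zmod_morphism mx_scalar_fun.
Proof. by move=> r s; rewrite /mx_scalar_fun raddfB. Qed.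
Fact mx_scalar_is_monoid_morphism : monoid_morphism mx_scalar_fun.
Proof. by split=> // r s; rewrite /mx_scalar_fun scalar_mxM. Qed.
HB.instance Definition _ := GRing.isZmodMorphism.Build R (mx_kalg R n)
  mx_scalar_fun mx_scalar_is_zmod_morphism.
HB.instance Definition _ := GRing.isMonoidMorphism.Build R (mx_kalg R n)
  mx_scalar_fun mx_scalar_is_monoid_morphism.
Fact mx_scalar_emb c : mx_scalar_fun (kalg_emb R c) = kalg_emb (mx_kalg R n) c.
Proof. by []. Qed.
Definition mx_scalar : khom R (mx_kalg R n) := KHom mx_scalar_emb.

End ScalarMatrices.

Section MatrixUnits.
Variables (k : fieldType) (R W : kalg k) (n : nat).
Variables (f : khom R W) (E : 'I_n -> 'I_n -> W).
Hypothesis E_mul : forall i j l m,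
  E i j * E l m = if j == l then E i m else 0.
Hypothesis E_sum : \sum_i E i i = 1.
Hypothesis fE : forall r i j, f r * E i j = E i j * f r.

(** A homomorphism out of a matrix algebra amounts to a family of matrix units
    and a homomorphism from the scalars that commutes with them. *)
Definition mx_eval (M : mx_kalg R n) : W :=
  \sum_i \sum_j f ((M : 'M[R]_n) i j) * E i j.

Fact mx_eval_is_zmod_morphism : zmod_morphism mx_eval.
Proof.
move=> M N; rewrite /mx_eval -sumrB; apply: eq_bigr => i _.
by rewrite -sumrB; apply: eq_bigr => j _; rewrite !mxE raddfB mulrBl.
Qed.
Lemma mx_eval_scalar r : mx_eval r%:M = f r.
Proof.
rewrite /mx_eval -[RHS]mulr1 -E_sum mulr_sumr; apply: eq_bigr => i _.
rewrite (bigD1 i) //= big1 => [|j /negPf ji]; first by rewrite mxE eqxx addr0.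
by rewrite mxE eq_sym ji rmorph0 mul0r.
Qed.
Fact mx_eval_is_monoid_morphism : monoid_morphism mx_eval.
Proof.
split=> [|M N]; first by rewrite [LHS]mx_eval_scalar rmorph1.
have mulE i j : (M * N : 'M[R]_n) i j = \sum_l (M : 'M[R]_n) i l * (N : 'M[R]_n) l j.
  by rewrite -[LHS]/(((M : 'M[R]_n) *m N) i j) mxE.
rewrite /mx_eval mulr_suml; apply: eq_bigr => i _; rewrite mulr_suml.
under eq_bigr => j _ do rewrite mulE rmorph_sum mulr_suml.
rewrite exchange_big /=; apply: eq_bigr => l _.
rewrite [RHS]mulr_sumr [RHS](bigD1 l) //= [X in _ = _ + X]big1 => [|l' /negPf ll]; last first.
  rewrite mulr_sumr big1 // => j _.
  by rewrite mulrA -(mulrA (f _)) -fE mulrA -mulrA E_mul eq_sym ll mulr0.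
rewrite addr0 mulr_sumr; apply: eq_bigr => j _.
by rewrite rmorphM mulrA -(mulrA (f _) (E _ _)) -fE mulrA -(mulrA _ (E i l)) E_mul eqxx.
Qed.
HB.instance Definition _ := GRing.isZmodMorphism.Build (mx_kalg R n) W
  mx_eval mx_eval_is_zmod_morphism.
HB.instance Definition _ := GRing.isMonoidMorphism.Build (mx_kalg R n) W
  mx_eval mx_eval_is_monoid_morphism.

Fact mx_eval_emb c : mx_eval (kalg_emb (mx_kalg R n) c) = kalg_emb W c.
Proof. by rewrite [LHS]mx_eval_scalar khom_emb. Qed.
Definition mx_units_hom : khom (mx_kalg R n) W := KHom mx_eval_emb.

End MatrixUnits.

Section MatrixMorita.
Variables (k : fieldType) (W R : kalg k) (n : nat) (i0 : 'I_n).
Variables (f : khom W (mx_kalg R n)) (g : khom (mx_kalg R n) W).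
Hypotheses (fK : cancel f g) (gK : cancel g f).

Definition mx_unit (i j : 'I_n) : W := g (delta_mx i j).
Definition mx_scal (r : R) : W := g r%:M.

Lemma mx_unitM i j l m :
  mx_unit i j * mx_unit l m = if j == l then mx_unit i m else 0.
Proof.
rewrite -rmorphM /= /mx_unit -[_ * _]/(_ *m _) mul_delta_mx_cond.
by case: eqP => _ /=; rewrite ?mulr1n ?mulr0n ?rmorph0.
Qed.

Lemma mx_unit_sum : \sum_i mx_unit i i = 1.
Proof. by rewrite -(rmorph1 g) [X in g X]mx1_sum_delta raddf_sum. Qed.

Lemma mx_scal_unitC r i j : mx_scal r * mx_unit i j = mx_unit i j * mx_scal r.
Proof.
rewrite /mx_scal /mx_unit -!rmorphM /=; congr (khom_fun g _).
rewrite -![_ * _]/(_ *m _); apply/matrixP => a b.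
rewrite mul_scalar_mx mul_mx_scalarE !mxE.
by case: (_ && _); rewrite ?mulr1 ?mul1r ?mulr0 ?mul0r.
Qed.

Fact mx_scal_is_zmod_morphism : zmod_morphism mx_scal.
Proof. by move=> r s; rewrite /mx_scal !raddfB. Qed.
Fact mx_scal_is_monoid_morphism : monoid_morphism mx_scal.
Proof.
by split=> [|r s]; rewrite /mx_scal ?rmorph1 // scalar_mxM -rmorphM.
Qed.
HB.instance Definition _ := GRing.isZmodMorphism.Build R W
  mx_scal mx_scal_is_zmod_morphism.
HB.instance Definition _ := GRing.isMonoidMorphism.Build R W
  mx_scal mx_scal_is_monoid_morphism.

Lemma mx_scal_emb c : mx_scal (kalg_emb R c) = kalg_emb W c.
Proof. by rewrite /mx_scal -mx_scalar_embE khom_emb. Qed.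

Definition mx_coef (w : W) : 'M[R]_n := f w.

Lemma mx_coefM w w' : mx_coef (w * w') = mx_coef w *m mx_coef w'.
Proof. exact: rmorphM. Qed.
Lemma mx_coefD w w' : mx_coef (w + w') = mx_coef w + mx_coef w'.
Proof. exact: rmorphD. Qed.
Lemma mx_coef1 : mx_coef 1 = 1%:M.
Proof. exact: rmorph1. Qed.
Lemma mx_coefK M : mx_coef (g M) = M.
Proof. exact: gK. Qed.

Lemma mx_coefE w : w = \sum_i \sum_j mx_scal (mx_coef w i j) * mx_unit i j.
Proof.
rewrite -[LHS]fK -[f w]/(mx_coef w) [X in g X]matrix_sum_delta raddf_sum.
apply: eq_bigr => i _.
rewrite raddf_sum; apply: eq_bigr => j _ /=; rewrite -mul_scalar_mx.
by rewrite -[_ *m _]/(_ * _) rmorphM.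
Qed.

(** The action of w on the column i0 of matrix units, which is what turns a
    W-module into its columns of elements of the corner. *)
Lemma mx_coef_unit w j :
  w * mx_unit j i0 = \sum_i mx_unit i i0 * mx_scal (mx_coef w i j).
Proof.
rewrite [in LHS](mx_coefE w) mulr_suml; apply: eq_bigr => a _.
rewrite mulr_suml (bigD1 j) //= big1 => [|b /negPf bj].
  by rewrite addr0 -mulrA mx_unitM eqxx mx_scal_unitC.
by rewrite -mulrA mx_unitM bj mulr0.
Qed.

(** * The corner functor *)

Section Corner.
Variable M : lmodType W.

Definition corner_pred : {pred M} := fun x => mx_unit i0 i0 *: x == x.

Lemma corner_predE x : (x \in corner_pred) = (mx_unit i0 i0 *: x == x).
Proof. by []. Qed.

Fact corner_zmod_closed : zmod_closed corner_pred.
Proof.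
split=> [|x y]; first by rewrite corner_predE scaler0.
by rewrite !corner_predE => /eqP xE /eqP yE; rewrite scalerBr xE yE.
Qed.
HB.instance Definition _ :=
  GRing.isZmodClosed.Build M corner_pred corner_zmod_closed.

(** The corner of a W-module M is the image of the idempotent matrix unit at
    (i0, i0); it is stable under the scalar matrices, which commute with the
    unit. *)
Record corner : predArgType :=
  Corner { corner_val : M; _ : corner_val \in corner_pred }.
HB.instance Definition _ := [isSub for corner_val].
HB.instance Definition _ := [Choice of corner by <:].
HB.instance Definition _ := [SubChoice_isSubZmodule of corner by <:].

Lemma corner_fixed (x : corner) : mx_unit i0 i0 *: val x = val x.
Proof. by apply/eqP; have := valP x; rewrite corner_predE. Qed.

Fact corner_scale_subproof r (x : corner) : mx_scal r *: val x \in corner_pred.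
Proof. by rewrite corner_predE scalerA -mx_scal_unitC -scalerA corner_fixed. Qed.
Definition corner_scale r x := Corner (corner_scale_subproof r x).

Fact corner_scalerA r s x :
  corner_scale r (corner_scale s x) = corner_scale (r * s) x.
Proof. by apply: val_inj; rewrite /= scalerA -rmorphM. Qed.
Fact corner_scale1r : left_id 1 corner_scale.
Proof. by move=> x; apply: val_inj; rewrite /= rmorph1 scale1r. Qed.
Fact corner_scalerDr : right_distributive corner_scale +%R.
Proof. by move=> r x y; apply: val_inj; rewrite /= scalerDr. Qed.
Fact corner_scalerDl x : {morph corner_scale^~ x : r s / r + s}.
Proof. by move=> r s; apply: val_inj; rewrite /= rmorphD scalerDl. Qed.
HB.instance Definition _ := GRing.Zmodule_isLmodule.Build R corner
  corner_scalerA corner_scale1r corner_scalerDr corner_scalerDl.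

Fact corner_proj_subproof i x : mx_unit i0 i *: x \in corner_pred.
Proof. by rewrite corner_predE scalerA mx_unitM eqxx. Qed.
Definition corner_proj i x := Corner (corner_proj_subproof i x).

End Corner.

Section CornerMap.
Variables (M N : lmodType W) (h : {linear M -> N}).

Fact corner_map_subproof (x : corner M) : h (val x) \in @corner_pred N.
Proof. by rewrite corner_predE -linearZ corner_fixed. Qed.
Definition corner_map (x : corner M) : corner N := Corner (corner_map_subproof x).
Fact corner_map_linear : linear corner_map.
Proof. by move=> r x y; apply: val_inj; rewrite /= linearP. Qed.
HB.instance Definition _ := GRing.isLinear.Build R (corner M) (corner N) _
  corner_map corner_map_linear.
End CornerMap.

Definition corner_fobj (M : lmodType W) : lmodType R := corner M.
Definition corner_fmap (M N : lmodType W) (h : {linear M -> N}) :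
  {linear corner_fobj M -> corner_fobj N} := corner_map h.

Definition corner_functor : mod_functor W R.
Proof.
exists corner_fobj corner_fmap => //.
- by move=> M N h h' hh' x; apply: val_inj; apply: hh'.
- by move=> M x; apply: val_inj.
- by move=> M N P h h' x; apply: val_inj.
- move=> M N c h h' h'' hE y; apply: val_inj => /=.
  by rewrite hE mx_scal_emb.
Defined.

(** * The column functor *)

Section Columns.
Variable N : lmodType R.

Definition columns := {ffun 'I_n -> N}.
HB.instance Definition _ := GRing.Zmodule.on columns.

Definition columns_scale (w : W) (v : columns) : columns :=
  [ffun i => \sum_j mx_coef w i j *: v j].

Fact columns_scalerA w w' v :
  columns_scale w (columns_scale w' v) = columns_scale (w * w') v.
Proof.
apply/ffunP => i; rewrite !ffunE mx_coefM.
under eq_bigr => j _ do rewrite ffunE scaler_sumr.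
rewrite exchange_big /=; apply: eq_bigr => j _; rewrite mxE scaler_suml.
by apply: eq_bigr => l _; rewrite scalerA.
Qed.
Fact columns_scale1r : left_id 1 columns_scale.
Proof.
move=> v; apply/ffunP => i; rewrite ffunE mx_coef1 (bigD1 i) //= big1.
  by rewrite mxE eqxx scale1r addr0.
by move=> j /negPf ji; rewrite mxE eq_sym ji scale0r.
Qed.
Fact columns_scalerDr : right_distributive columns_scale +%R.
Proof.
move=> w v v'; apply/ffunP => i; rewrite !ffunE -big_split.
by apply: eq_bigr => j _; rewrite ffunE scalerDr.
Qed.
Fact columns_scalerDl v : {morph columns_scale^~ v : w w' / w + w'}.
Proof.
move=> w w'; apply/ffunP => i; rewrite !ffunE -big_split.
by apply: eq_bigr => j _; rewrite mx_coefD mxE scalerDl.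
Qed.
HB.instance Definition _ := GRing.Zmodule_isLmodule.Build W columns
  columns_scalerA columns_scale1r columns_scalerDr columns_scalerDl.

Lemma columns_scaleE w (v : columns) i : (w *: v) i = \sum_j mx_coef w i j *: v j.
Proof. by rewrite ffunE. Qed.

Lemma columns_scale_unit a b (v : columns) i :
  (mx_unit a b *: v) i = if i == a then v b else 0.
Proof.
rewrite columns_scaleE mx_coefK (bigD1 b) //= big1 => [|j /negPf jb].
  by rewrite mxE eqxx andbT addr0; case: eqP => _; rewrite ?scale1r ?scale0r.
by rewrite mxE jb andbF scale0r.
Qed.

Lemma columns_scale_scal r (v : columns) i : (mx_scal r *: v) i = r *: v i.
Proof.
rewrite columns_scaleE mx_coefK (bigD1 i) //= big1 => [|j /negPf ji].
  by rewrite mxE eqxx addr0.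
by rewrite mxE eq_sym ji scale0r.
Qed.

End Columns.

Section ColumnsMap.
Variables (M N : lmodType R) (h : {linear M -> N}).
Definition columns_map (v : columns M) : columns N := [ffun i => h (v i)].
Fact columns_map_linear : linear columns_map.
Proof.
move=> w u v; apply/ffunP => i.
rewrite !ffunE linearD linear_sum; congr (_ + _).
by apply: eq_bigr => j _; rewrite ffunE linearZ.
Qed.
HB.instance Definition _ := GRing.isLinear.Build W (columns M) (columns N) _
  columns_map columns_map_linear.
End ColumnsMap.

Definition columns_fobj (M : lmodType R) : lmodType W := columns M.
Definition columns_fmap (M N : lmodType R) (h : {linear M -> N}) :
  {linear columns_fobj M -> columns_fobj N} := columns_map h.

Definition columns_functor : mod_functor R W.
Proof.
exists columns_fobj columns_fmap => //.
- by move=> M N h h' hh' x; apply/ffunP => i; rewrite !ffunE.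
- by move=> M x; apply/ffunP => i; rewrite !ffunE.
- by move=> M N P h h' x; apply/ffunP => i; rewrite !ffunE.
- move=> M N c h h' h'' hE y; apply/ffunP => i.
  by rewrite [in RHS]ffunE -mx_scal_emb columns_scale_scal !ffunE.
Defined.

(** * The two composites *)

Section Assemble.
Variable M : lmodType W.

(** A W-module is a direct sum of n copies of its corner: the unit at (j, i0)
    maps the corner isomorphically to the j-th copy. *)
Definition assemble (v : columns (corner M)) : M :=
  \sum_j mx_unit j i0 *: val (v j).

Fact assemble_linear : linear assemble.
Proof.
move=> w u v; rewrite /assemble scaler_sumr.
under eq_bigr => j _ do rewrite [X in val X]ffunE [X in _ *: X]raddfD scalerDr.
rewrite big_split; congr (_ + _).
under [in RHS]eq_bigr => j _ do rewrite scalerA mx_coef_unit scaler_suml.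
rewrite [in RHS]exchange_big; apply: eq_bigr => i _.
rewrite columns_scaleE [X in _ *: X]raddf_sum scaler_sumr; apply: eq_bigr => j _.
by rewrite scalerA.
Qed.
HB.instance Definition _ := GRing.isLinear.Build W (columns (corner M)) M _
  assemble assemble_linear.

Lemma assemble_bij : bijective assemble.
Proof.
exists (fun x => [ffun j => corner_proj j x]) => [v|x].
  apply/ffunP => i; rewrite ffunE; apply: val_inj; rewrite /= /assemble.
  rewrite scaler_sumr (bigD1 i) //= big1 => [|j /negPf ji].
    by rewrite scalerA mx_unitM eqxx addr0 corner_fixed.
  by rewrite scalerA mx_unitM eq_sym ji scale0r.
rewrite /assemble -[RHS]scale1r -mx_unit_sum scaler_suml.
by apply: eq_bigr => j _; rewrite ffunE /= scalerA mx_unitM eqxx.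
Qed.
End Assemble.

Section CornerColumns.
Variable N : lmodType R.

(** The unit at (i0, i0) retains the coordinate i0 of a column. *)
Definition corner_columns (v : corner (columns N)) : N := val v i0.
Fact corner_columns_linear : linear corner_columns.
Proof.
move=> r u v; rewrite /corner_columns.
have -> : val (r *: u + v) = mx_scal r *: val u + val v by [].
by rewrite [LHS]ffunE columns_scale_scal.
Qed.
HB.instance Definition _ := GRing.isLinear.Build R (corner (columns N)) N _
  corner_columns corner_columns_linear.

Lemma corner_columns_bij : bijective corner_columns.
Proof.
have vE (v : corner (columns N)) i : val v i = if i == i0 then val v i0 else 0.
  by rewrite -{1}(corner_fixed v) columns_scale_unit.
pose e (x : N) : columns N := [ffun i => if i == i0 then x else 0].
have eP x : e x \in @corner_pred (columns N).
  rewrite corner_predE; apply/eqP/ffunP => i; rewrite columns_scale_unit !ffunE eqxx.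
  by [].
exists (fun x => Corner (eP x)) => [v|x].
  by apply/val_inj/ffunP => i; rewrite ffunE [RHS]vE.
by rewrite /corner_columns ffunE eqxx.
Qed.
End CornerColumns.

(** Modules over n x n matrices over R are columns of n elements of R-modules.
    The index i0 ensures that n is positive: for n = 0 the matrix algebra is
    the zero ring. *)
Lemma morita_matrix : morita_equivalent W R.
Proof.
exists corner_functor, columns_functor; split.
  exists (fun M => @assemble M : {linear columns_fobj (corner_fobj M) -> M}); split=> [M|M N h v].
    exact: assemble_bij.
  rewrite /= /assemble linear_sum; apply: eq_bigr => j _.
  by rewrite ffunE linearZ.
exists (fun N =>
    @corner_columns N : {linear corner_fobj (columns_fobj N) -> N}); split=> [N|M N h v].
  exact: corner_columns_bij.
by rewrite /= /corner_columns ffunE.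
Qed.

End MatrixMorita.

(** * VV algebras in terms of words *)

Section WordRelations.
Variables (k : fieldType) (p q : k).
Implicit Types (K : set k) (nu : {mset k}%mset) (u v w : k) (a b c : seq k).

Definition word_weight a : {mset k}%mset := seq_mset (a ++ [seq u^-1 | u <- a]).

(** The words of weight nu as plain sequences, so that a word can be split and
    recombined without casts between tuple types. *)
Definition vv_words K nu m : seq (seq k) := [seq val t | t <- theta_seqs K nu m].

Lemma vv_words_uniq K nu m : uniq (vv_words K nu m).
Proof. by rewrite map_inj_uniq ?fset_uniq //; apply: val_inj. Qed.

Lemma vv_wordsP K nu m a :
  reflect [/\ size a = m, {in a, forall u, K u} & word_weight a = nu]
          (a \in vv_words K nu m).
Proof.
apply: (iffP mapP) => [[t /theta_seqsP[Kt wt] ->]|[sa Ka wa]].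
  by split; rewrite ?size_tuple // => u /tnthP[l ->].
have/eqP sa' := sa; exists (Tuple sa') => //; apply/theta_seqsP; split=> // l.
by apply: Ka; apply: mem_tnth.
Qed.

Lemma vv_words_tuple K nu m (t : m.-tuple k) :
  (val t \in vv_words K nu m) = (t \in theta_seqs K nu m).
Proof. by rewrite mem_map //; apply: val_inj. Qed.

Lemma word_weight_perm a b : perm_eq a b -> word_weight a = word_weight b.
Proof.
by move=> ab; apply/eq_seq_msetP/perm_cat => //; apply: perm_map.
Qed.

Lemma vv_words_perm K nu m a b :
  perm_eq a b -> (a \in vv_words K nu m) = (b \in vv_words K nu m).
Proof.
move=> ab; apply/vv_wordsP/vv_wordsP => -[<- Ka <-];
  split=> [|u|]; rewrite ?(perm_size ab) ?(word_weight_perm ab) //.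
  by rewrite -(perm_mem ab); apply: Ka.
by rewrite (perm_mem ab); apply: Ka.
Qed.

Lemma perm_swap (T : eqType) (x y : T) s t :
  perm_eq (s ++ x :: y :: t) (s ++ y :: x :: t).
Proof. by rewrite perm_cat2l -![_ :: _ :: t]cat1s -[_ :: t]cat1s perm_catCA. Qed.

(** The right-hand sides depend on the letters of a word and are evaluated at
    arbitrary ring elements: the same relations are used in the VV algebras,
    in the commutant inside the separated algebra, and for matrices. *)
Section RightHandSides.
Variables (K : set k) (C : pzRingType).

Definition sq_rhs u v (x y : C) : C :=
  if u == v then 0
  else if arrow_to p K v u then y - x
  else if arrow_to p K u v then x - y
  else if arrow_both p K u v then (y - x) * (x - y)
  else 1.

Definition br_rhs u v w (x y z : C) : C :=
  if u == w then
    if arrow_to p K u v then 1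
    else if arrow_to p K v u then -1
    else if arrow_both p K u v then 2%:R * y - z - x
    else 0
  else 0.

Definition psq_rhs u (x : C) : C :=
  if u == q then x else if u == q^-1 then - x else 1.

Definition sp_rhs u v (s : C) : C :=
  if (u^-1 == v) && (v == q^-1) then s
  else if (u^-1 == v) && (v == q) then - s
  else 0.

End RightHandSides.

(** The right-hand sides are built by ring operations, so they preserve every
    relation Q between two rings that is compatible with those; Q will be the
    graph of a homomorphism, the restriction of an element to a block, and the
    action of a matrix on a column. *)
Section RelatedRhs.
Variables (K : set k) (A C : pzRingType) (Q : A -> C -> Prop).
Hypotheses (Q0 : Q 0 0) (Q1 : Q 1 1) (QN : forall x y, Q x y -> Q (- x) (- y)).
Hypothesis QD : forall x y x' y', Q x y -> Q x' y' -> Q (x + x') (y + y').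
Hypothesis QM : forall x y x' y', Q x y -> Q x' y' -> Q (x * x') (y * y').

Lemma sq_rhs_related u v x x' y y' : Q x y -> Q x' y' ->
  Q (sq_rhs K u v x x') (sq_rhs K u v y y').
Proof.
move=> Qx Qx'; have Qxx' := QD Qx (QN Qx'); have Qx'x := QD Qx' (QN Qx).
by rewrite /sq_rhs; do 4?[case: ifP => _]; try exact: QM.
Qed.

Lemma br_rhs_related u v w x x' x'' y y' y'' : Q x y -> Q x' y' -> Q x'' y'' ->
  Q (br_rhs K u v w x x' x'') (br_rhs K u v w y y' y'').
Proof.
move=> Qx Qx' Qx''; rewrite /br_rhs; do 4?[case: ifP => _] => //; first exact: QN.
apply: QD (QN Qx); apply: QD (QN Qx''); apply: QM Qx'.
by rewrite -[2]/(1 + 1); apply: QD.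
Qed.

Lemma psq_rhs_related u x y : Q x y -> Q (psq_rhs u x) (psq_rhs u y).
Proof.
by move=> Qx; rewrite /psq_rhs; do 2?[case: ifP => _]; try exact: QN.
Qed.

Lemma sp_rhs_related u v x y : Q x y -> Q (sp_rhs u v x) (sp_rhs u v y).
Proof.
by move=> Qx; rewrite /sp_rhs; do 2?[case: ifP => _]; try exact: QN.
Qed.

End RelatedRhs.

Section RhsMorphism.
Variables (K : set k) (A C : pzRingType) (f : {rmorphism A -> C}).
Let Q x y := f x = y.
Let Q0 : Q 0 0. Proof. exact: rmorph0. Qed.
Let Q1 : Q 1 1. Proof. exact: rmorph1. Qed.
Let QN x y : Q x y -> Q (- x) (- y). Proof. by move=> <-; apply: rmorphN. Qed.
Let QD x y x' y' : Q x y -> Q x' y' -> Q (x + x') (y + y').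
Proof. by move=> <- <-; apply: rmorphD. Qed.
Let QM x y x' y' : Q x y -> Q x' y' -> Q (x * x') (y * y').
Proof. by move=> <- <-; apply: rmorphM. Qed.

Lemma sq_rhs_morph u v x y :
  f (sq_rhs K u v x y) = sq_rhs K u v (f x) (f y).
Proof. exact: (sq_rhs_related K Q0 Q1 QN QD QM). Qed.

Lemma br_rhs_morph u v w x y z :
  f (br_rhs K u v w x y z) = br_rhs K u v w (f x) (f y) (f z).
Proof. exact: (br_rhs_related K Q0 Q1 QN QD QM). Qed.

Lemma psq_rhs_morph u x : f (psq_rhs u x) = psq_rhs u (f x).
Proof. exact: (psq_rhs_related Q1 QN). Qed.

Lemma sp_rhs_morph u v s : f (sp_rhs u v s) = sp_rhs u v (f s).
Proof. exact: (sp_rhs_related Q0 QN). Qed.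

End RhsMorphism.

(** Candidates for the generators. The indices and the words range over all
    natural numbers and all sequences: the axioms below say nothing about the
    indices outside the range, and force the idempotents of other sequences to
    vanish. *)
Record vv_data (C : Type) := VVData {
  dx : nat -> C; ds : nat -> C; dp : C; de : seq k -> C }.

(** The defining relations, where positions are given by splitting a word: for
    a word a ++ u :: v :: b, the generator that exchanges u and v has index
    size a. Each relation carries an idempotent on the right, which is
    harmless because the idempotents of all words add up to 1, and it makes
    the relations trivially true for the words that do not occur. *)
Record vv_axioms K nu m (C : pzRingType) (D : vv_data C) : Prop := VVAxioms {
  de_out a : a \notin vv_words K nu m -> de D a = 0;
  de_de a b : de D a * de D b = if a == b then de D a else 0;
  de_sum : \sum_(a <- vv_words K nu m) de D a = 1;
  ds_de a u v b :
    ds D (size a) * de D (a ++ u :: v :: b) =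
    de D (a ++ v :: u :: b) * ds D (size a);
  dx_de l a : (l < size a)%N -> dx D l * de D a = de D a * dx D l;
  dx_dx l l' a : (l < size a)%N -> (l' < size a)%N ->
    dx D l * dx D l' * de D a = dx D l' * dx D l * de D a;
  ds_ds a u v b (l := size a) :
    ds D l * ds D l * de D (a ++ u :: v :: b) =
    sq_rhs K u v (dx D l) (dx D l.+1) * de D (a ++ u :: v :: b);
  ds_far a u v b u' v' c (l := size a) (l' := (size a + (size b).+2)%N)
      (i := a ++ u :: v :: b ++ u' :: v' :: c) :
    ds D l * ds D l' * de D i = ds D l' * ds D l * de D i;
  ds_braid a u v w b (l := size a) (i := a ++ u :: v :: w :: b) :
    ds D l.+1 * ds D l * ds D l.+1 * de D i =
    ds D l * ds D l.+1 * ds D l * de D i +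
    br_rhs K u v w (dx D l) (dx D l.+1) (dx D l.+2) * de D i;
  ds_dxl a u v b (l := size a) (i := a ++ u :: v :: b) :
    ds D l * dx D l * de D i =
    dx D l.+1 * ds D l * de D i - (if u == v then de D i else 0);
  ds_dxr a u v b (l := size a) (i := a ++ u :: v :: b) :
    ds D l * dx D l.+1 * de D i =
    dx D l * ds D l * de D i + (if u == v then de D i else 0);
  ds_dx a u v b j (l := size a) (i := a ++ u :: v :: b) :
    (j < size i)%N -> j != l -> j != l.+1 ->
    ds D l * dx D j * de D i = dx D j * ds D l * de D i;
  dp_de u b : dp D * de D (u :: b) = de D (u^-1 :: b) * dp D;
  dp_dp u b : dp D * dp D * de D (u :: b) = psq_rhs u (dx D 0) * de D (u :: b);
  dp_dx0 u b : dp D * dx D 0 * de D (u :: b) = - (dx D 0 * dp D * de D (u :: b));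
  dp_dx j u b : (j < size b)%N ->
    dp D * dx D j.+1 * de D (u :: b) = dx D j.+1 * dp D * de D (u :: b);
  ds_dp u v b (i := u :: v :: b) :
    ds D 0 * dp D * ds D 0 * dp D * de D i =
    dp D * ds D 0 * dp D * ds D 0 * de D i + sp_rhs u v (ds D 0) * de D i;
  dp_ds a w u v b (l := (size a).+1) (i := w :: a ++ u :: v :: b) :
    dp D * ds D l * de D i = ds D l * dp D * de D i
}.

Section Presented.
Variables (K : set k) (nu : {mset k}%mset) (n : nat).
Hypothesis nuK : theta_NN K nu.
Local Notation words := (vv_words K nu n.+1).
Local Notation Theta := (theta_seqs K nu n.+1).
Implicit Types (i : n.+1.-tuple k) (l : 'I_n).

Lemma tuple_split i l :
  {ab | tval i = ab.1 ++ tnth i (pos l) :: tnth i (posS l) :: ab.2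
      & size ab.1 = l}.
Proof.
have ln : (l < n.+1)%N by apply: leq_trans (ltn_ord l) _.
have ln' : (l.+1 < n.+1)%N by rewrite ltnS.
exists (take l i, drop l.+2 i) => /=; last by rewrite size_takel ?size_tuple // ltnW.
rewrite !(tnth_nth 0) /= /bump /= add1n -!drop_nth ?size_tuple //.
by rewrite cat_take_drop.
Qed.

Lemma tuple_at i a u v b : tval i = a ++ u :: v :: b ->
  exists l, [/\ l = size a :> nat, tnth i (pos l) = u & tnth i (posS l) = v].
Proof.
move=> iE; have an : (size a < n)%N.
  by have := size_tuple i; rewrite iE size_cat /= !addnS => -[<-]; rewrite ltnS leq_addr.
exists (Ordinal an); split=> //; rewrite (tnth_nth 0) iE nth_cat /= ?ltnn ?subnn //.
by rewrite /bump /= add1n ltnNge leqnSn subSnn.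
Qed.

Lemma swap_seqE i l a u v b : tval i = a ++ u :: v :: b -> size a = l ->
  tval (swap_seq l i) = a ++ v :: u :: b.
Proof.
move=> iE sa.
have si : size (a ++ v :: u :: b) = n.+1.
  by rewrite -(size_tuple i) iE !size_cat.
apply: (@eq_from_nth _ 0); first by rewrite size_tuple si.
rewrite size_tuple => j jn; rewrite -[j]/(nat_of_ord (Ordinal jn)) -tnth_nth.
rewrite tnth_mktuple (tnth_nth 0) iE.
case: tpermP => [->|->|]; rewrite /= ?/bump /= ?add1n -?sa.
- by rewrite !nth_cat ltnn subnn (ltnNge (size a).+1) leqnSn subSnn.
- by rewrite !nth_cat ltnn subnn (ltnNge (size a).+1) leqnSn subSnn.
move=> /eqP; rewrite -val_eqE /= => jl /eqP; rewrite -val_eqE /= /bump add1n => jl'.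
rewrite !nth_cat; case: ltnP => // aj; case E: (j - _)%N => [|[|m]] //.
  by case/negP: jl; rewrite -sa eqn_leq aj andbT -subn_eq0 E.
by case/negP: jl'; rewrite -sa -(subnK aj) E.
Qed.

Lemma inv_seqE i u b : tval i = u :: b -> tval (inv_seq i) = u^-1 :: b.
Proof.
move=> iE; have sb : size (u :: b) = n.+1 by rewrite -iE size_tuple.
apply: (@eq_from_nth _ 0); first by rewrite size_tuple -sb.
rewrite size_tuple => j jn; rewrite -[j]/(nat_of_ord (Ordinal jn)) -tnth_nth.
by rewrite tnth_mktuple (tnth_nth 0) iE; case: j jn => [|j].
Qed.

Section Evaluation.
Variables (C : kalg k) (D : vv_data C).
Hypothesis de_outE : forall a, a \notin words -> de D a = 0.

Definition data_gen (g : vv_gen K nu n) : C :=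
  match g with
  | gen_x l => dx D l
  | gen_sigma l => ds D l
  | gen_pi => dp D
  | gen_e i => de D (tval (val i))
  end.
Local Notation ev := (free_eval data_gen).

Lemma ev_x (l : 'I_n.+1) : ev (vv_x K nu l) = dx D l. Proof. exact: free_eval_gen. Qed.
Lemma ev_s l : ev (vv_sigma K nu l) = ds D l. Proof. exact: free_eval_gen. Qed.
Lemma ev_p : ev (vv_pi K nu n) = dp D. Proof. exact: free_eval_gen. Qed.
Lemma ev_e i : ev (vv_e K nu i) = de D (tval i).
Proof.
rewrite /vv_e; case: insubP => [i' _ <-|ni]; first by rewrite free_eval_gen.
by rewrite raddf0 de_outE // vv_words_tuple.
Qed.

Local Notation F := (free_alg k (vv_gen K nu n)).
Lemma ev_eq (x y : F) (a b : C) : ev x = a -> ev y = b -> a = b -> ev x = ev y.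
Proof. by move=> -> ->. Qed.
Lemma ev_M (x y : F) (a b : C) : ev x = a -> ev y = b -> ev (x * y) = a * b.
Proof. by move=> <- <-; apply: rmorphM. Qed.
Lemma ev_B (x y : F) (a b : C) : ev x = a -> ev y = b -> ev (x - y) = a - b.
Proof. by move=> <- <-; apply: rmorphB. Qed.
Lemma ev_N (x : F) (a : C) : ev x = a -> ev (- x) = - a.
Proof. by move=> <-; apply: rmorphN. Qed.
Lemma ev_1 : ev (1 : F) = 1. Proof. exact: rmorph1. Qed.
Lemma ev_0 : ev (0 : F) = 0. Proof. exact: rmorph0. Qed.

Lemma ev_sq_rhs l i : ev (sigma_sq_rhs p K nu l i) =
  sq_rhs K (tnth i (pos l)) (tnth i (posS l)) (dx D l) (dx D l.+1).
Proof. by rewrite [LHS]sq_rhs_morph /= ev_x ev_x. Qed.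

Lemma ev_braid_rhs l l' i : l' = l.+1 :> nat -> ev (braid_rhs p K nu l l' i) =
  br_rhs K (tnth i (pos l)) (tnth i (posS l)) (tnth i (posS l'))
    (dx D l) (dx D l.+1) (dx D l.+2).
Proof.
move=> l'E; rewrite [LHS]br_rhs_morph /= ev_x ev_x ev_x.
by rewrite /= /bump /= !add1n l'E.
Qed.

Lemma ev_pi_sq_rhs i :
  ev (pi_sq_rhs q K nu i) = psq_rhs (tnth i ord0) (dx D 0).
Proof. by rewrite [LHS]psq_rhs_morph /= ev_x. Qed.

Lemma ev_sigma_pi_rhs l i : ev (sigma_pi_rhs q K nu l i) =
  sp_rhs (tnth i (pos l)) (tnth i (posS l)) (ds D l).
Proof. by rewrite [LHS]sp_rhs_morph /= ev_s. Qed.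

Lemma words_sum (V : nmodType) (h : seq k -> V) :
  \sum_(a <- words) h a = \sum_(i <- Theta) h (tval i).
Proof. by rewrite /vv_words big_map. Qed.

(** One half of the translation between the relations for tuples of fixed
    length and those for words. *)
Lemma vv_axioms_rel : vv_axioms K nu n.+1 D ->
  forall x y, vv_rel p q x y -> ev x = ev y.
Proof.
case=> _ hee hsum hse hxe hxx hss hfar hbraid hxl hxr hx hpe hpp hpx0 hpx hsp hps.
have deM1 (z z' : C) :
    (forall i, i \in Theta -> z * de D (tval i) = z' * de D (tval i)) -> z = z'.
  move=> zz'; rewrite -[z]mulr1 -[z']mulr1 -hsum words_sum !mulr_sumr.
  by rewrite big_seq [RHS]big_seq; apply: eq_bigr => i; apply: zz'.
have hd i : {b | tval i = tnth i ord0 :: b & size b = n}.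
  exists (behead i); last by rewrite size_behead size_tuple.
  by case/tupleP: i => u b; rewrite (tnth_nth 0).
have far (l l' : 'I_n) : (l.+1 < l')%N -> ds D l * ds D l' = ds D l' * ds D l.
  move=> ll'; apply: deM1 => i _.
  have [[a b]/= iE sa] := tuple_split i l.
  have [[a' b']/= iE' sa'] := tuple_split i l'.
  have : a' = a ++ [:: tnth i (pos l), tnth i (posS l) & drop l.+2 a'].
    have ll2 : (l < l')%N by apply: ltnW.
    have ta : take l a' = a.
      rewrite -[RHS](take_size_cat (tnth i (pos l) :: tnth i (posS l) :: b) sa).
      by rewrite -iE iE' take_cat sa' ll2.
    rewrite -{1}(cat_take_drop l a') ta (drop_nth 0) ?(drop_nth 0 (n := l.+1)) ?sa' //.
    by rewrite !(tnth_nth 0) /= /bump add1n iE' !nth_cat sa' ll2 ll'.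
  move=> a'E.
  have := hfar a (tnth i (pos l)) (tnth i (posS l)) (drop l.+2 a')
    (tnth i (pos l')) (tnth i (posS l')) b'.
  have -> : (size a + (size (drop l.+2 a')).+2)%N = l'.
    by rewrite -[in RHS]sa' [in RHS]a'E size_cat.
  rewrite sa; have -> // : a ++ [:: tnth i (pos l), tnth i (posS l) & drop l.+2 a' ++
     [:: tnth i (pos l'), tnth i (posS l') & b']] = tval i.
  by rewrite [RHS]iE' [in RHS]a'E -catA.
move=> _ _ [].
- move=> i j _ _; rewrite (ev_M (ev_e i) (ev_e j)) hee.
  by rewrite (inj_eq val_inj); case: eqP => _; [rewrite ev_e|rewrite ev_0].
- move=> l i _; apply: (ev_eq (ev_M (ev_s l) (ev_e i))
    (ev_M (ev_e (swap_seq l i)) (ev_s l))).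
  have [[a b]/= iE sa] := tuple_split i l.
  by rewrite (swap_seqE iE sa) iE -sa; apply: hse.
- move=> j i _; apply: (ev_eq (ev_M (ev_x j) (ev_e i)) (ev_M (ev_e i) (ev_x j))).
  by rewrite hxe // size_tuple.
- rewrite raddf_sum ev_1 -hsum words_sum.
  by apply: eq_bigr => i _; rewrite /= ev_e.
- move=> j j'; apply: (ev_eq (ev_M (ev_x j) (ev_x j')) (ev_M (ev_x j') (ev_x j)));
  apply: deM1 => i _.
  by apply: hxx; rewrite size_tuple.
- move=> l i _; apply: (ev_eq (ev_M (ev_M (ev_s l) (ev_s l)) (ev_e i))
    (ev_M (ev_sq_rhs l i) (ev_e i))).
  by have [[a b]/= iE sa] := tuple_split i l; rewrite iE -sa; apply: hss.
- move=> l l' ll'; apply: (ev_eq (ev_M (ev_s l) (ev_s l')) (ev_M (ev_s l') (ev_s l))).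
  by case/orP: ll' => /far.
- move=> l l' i l'E _; have sl := ev_s l; have sl' := ev_s l'.
  apply: (ev_eq (ev_M (ev_B (ev_M (ev_M sl' sl) sl') (ev_M (ev_M sl sl') sl)) (ev_e i))
    (ev_M (ev_braid_rhs i l'E) (ev_e i))).
  have [[a b]/= iE sa] := tuple_split i l.
  have [[a' b']/= iE' sa'] := tuple_split i l'.
  rewrite l'E mulrBl; apply/eqP; rewrite subr_eq addrC; apply/eqP.
  have bE : b = tnth i (posS l') :: b'.
    have := congr1 (drop l'.+1) iE'; rewrite iE l'E -sa.
    rewrite drop_cat ltnNge (leqW (leqnSn _)) /= !subSn ?leqW // subnn /= drop0 => ->.
    by rewrite sa -l'E -cat_rcons drop_size_cat // size_rcons sa' .
  by rewrite iE bE -sa; apply: hbraid.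
- move=> l j i _; set j' := tperm _ _ _.
  apply: (ev_eq (ev_M (ev_B (ev_M (ev_s l) (ev_x j)) (ev_M (ev_x j') (ev_s l))) (ev_e i))
    (ev_M (erefl _) (ev_e i))).
  rewrite /j' /sigma_x_rhs {j'}.
  have [[a b]/= iE sa] := tuple_split i l.
  rewrite mulrBl; apply/eqP; rewrite subr_eq addrC; apply/eqP.
  case: tpermP => [->|->|].
  + rewrite eqxx /= /bump add1n -sa iE hxl -iE sa.
    case: eqP => _; first by rewrite (ev_N ev_1) mulN1r.
    by rewrite ev_0 mul0r subr0 addr0.
  + rewrite eqxx /= /bump add1n.
    have -> : (posS l == pos l) = false.
      by rewrite -val_eqE /= /bump add1n -[X in _ == X]addn0 -addn1 eqn_add2l.
    rewrite -sa iE hxr -iE sa.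
    case: eqP => _; first by rewrite ev_1 mul1r.
    by rewrite ev_0 mul0r.
  move=> /eqP jl /eqP jl'; rewrite (negPf jl) (negPf jl').
  rewrite if_same ev_0 mul0r addr0 iE -sa hx -?iE ?size_tuple // sa //.
- move=> i _; apply: (ev_eq (ev_M ev_p (ev_e i)) (ev_M (ev_e (inv_seq i)) ev_p));
  have [b iE _] := hd i.
  by rewrite (inv_seqE iE) iE hpe.
- move=> i _; apply: (ev_eq (ev_M (ev_M ev_p ev_p) (ev_e i)) (ev_M (ev_pi_sq_rhs i) (ev_e i))).
  by have [b iE _] := hd i; rewrite iE hpp.
- apply: (ev_eq (ev_M ev_p (ev_x ord0)) (ev_M (ev_N (ev_x ord0)) ev_p));
  apply: deM1 => i _.
  by have [b iE _] := hd i; rewrite iE hpx0 mulNr mulNr.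
- move=> j j0; apply: (ev_eq (ev_M ev_p (ev_x j)) (ev_M (ev_x j) ev_p));
  apply: deM1 => i _.
  have [b iE sb] := hd i; rewrite iE.
  have [j' ->] : exists j', j = lift ord0 j' by case: (unliftP ord0 j) j0 => [j' ->|->]; first by exists j'.
  by rewrite /= /bump add1n hpx // sb.
- move=> l i l0 _; have sp := ev_M (ev_s l) ev_p; have ps := ev_M ev_p (ev_s l).
  apply: (ev_eq (ev_B (ev_M (ev_M sp sp) (ev_e i)) (ev_M (ev_M ps ps) (ev_e i)))
    (ev_M (ev_sigma_pi_rhs l i) (ev_e i))); rewrite !mulrA.
  have [[a b]/= iE sa] := tuple_split i l.
  apply/eqP; rewrite subr_eq addrC; apply/eqP.
  rewrite l0 in sa *; move: iE; rewrite (size0nil sa) /= => iE.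
  by rewrite iE; apply: hsp.
- move=> l l0; apply: (ev_eq (ev_M ev_p (ev_s l)) (ev_M (ev_s l) ev_p));
  apply: deM1 => i _.
  have [[a b]/= iE sa] := tuple_split i l.
  by case: a iE sa l0 => [|w a] iE; rewrite iE => <- // _; apply: hps.
Qed.

Lemma tuple_at_head i u b : tval i = u :: b -> tnth i ord0 = u.
Proof. by move=> iE; rewrite (tnth_nth 0) iE. Qed.

Lemma rel_vv_axioms : (forall x y, vv_rel p q x y -> ev x = ev y) ->
  vv_axioms K nu n.+1 D.
Proof.
move=> H.
have Heq x y (a b : C) : vv_rel p q x y -> ev x = a -> ev y = b -> a = b.
  by move=> /H xy <- <-.
have ind a (z z' : C) : (forall i, i \in Theta -> tval i = a -> z * de D a = z' * de D a) ->
    z * de D a = z' * de D a.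
  move=> zz'; have [/mapP[i iT aE]|/de_outE ->] := boolP (a \in words); last by rewrite !mulr0.
  exact: zz' iT (esym aE).
have inP (i : n.+1.-tuple k) : i \in Theta -> tval i \in words by rewrite vv_words_tuple.
have hsx (l : 'I_n) (j : 'I_n.+1) i : i \in Theta ->
    ds D l * dx D j * de D i = dx D (tperm (pos l) (posS l) j) * ds D l * de D i +
      ev (sigma_x_rhs K nu l j i) * de D i.
  move=> iT; set j' := tperm _ _ _.
  apply/eqP; rewrite addrC -subr_eq -mulrBl; apply/eqP.
  exact: Heq (vv_sigma_x p q l j iT)
    (ev_M (ev_B (ev_M (ev_s l) (ev_x j)) (ev_M (ev_x j') (ev_s l))) (ev_e i))
    (ev_M (erefl _) (ev_e i)).
split=> //.
- move=> a b; have [/mapP[i iT aE]|/de_outE ->] := boolP (a \in words); last by rewrite mul0r if_same.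
  have [/mapP[j jT bE]|nb] := boolP (b \in words).
    rewrite aE bE (inj_eq val_inj).
    apply: (Heq _ _ _ _ (vv_ee _ _ iT jT) (ev_M (ev_e i) (ev_e j))).
    by case: eqP => _; [exact: ev_e|exact: ev_0].
  rewrite (de_outE nb) mulr0; case: eqP => // ab.
  by rewrite -ab aE inP in nb.
- rewrite words_sum; apply: (Heq _ _ _ _ (vv_sum_e p q K nu n)); last exact: ev_1.
  by rewrite raddf_sum; apply: eq_bigr => i _; rewrite /= ev_e.
- move=> a u v b; have [/mapP[i iT /esym iE]|na] := boolP (a ++ u :: v :: b \in words); last first.
    by rewrite !de_outE ?mulr0 ?mul0r // (vv_words_perm _ _ _ (perm_swap v u a b)).
  have [l [la lu lv]] := tuple_at iE.
  rewrite -(swap_seqE iE (esym la)) -iE -la.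
  exact: Heq (vv_sigma_e p q l iT) (ev_M (ev_s l) (ev_e i)) (ev_M (ev_e (swap_seq l i)) (ev_s l)).
- move=> l a la; have [/mapP[i iT aE]|/de_outE ->] := boolP (a \in words); last by rewrite !(mulr0, mul0r).
  rewrite aE size_tuple in la *; pose j := Ordinal la.
  exact: Heq (vv_x_e p q j iT) (ev_M (ev_x j) (ev_e i)) (ev_M (ev_e i) (ev_x j)).
- move=> l l' a la la'; apply: ind => i iT iE; congr (_ * _).
  rewrite -iE size_tuple in la la'; pose j := Ordinal la; pose j' := Ordinal la'.
  exact: Heq (vv_xx p q K nu j j') (ev_M (ev_x j) (ev_x j')) (ev_M (ev_x j') (ev_x j)).
- move=> a u v b /=; apply: ind => i iT iE; have [l [lE lu lv]] := tuple_at iE.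
  rewrite -iE -lE -lu -lv.
  exact: Heq (vv_sigma_sq p q l iT) (ev_M (ev_M (ev_s l) (ev_s l)) (ev_e i))
    (ev_M (ev_sq_rhs l i) (ev_e i)).
- move=> a u v b u' v' c /=; apply: ind => i iT iE; congr (_ * _).
  have [l [lE _ _]] := tuple_at iE; rewrite -lE.
  have [l' [l'E _ _]] : exists l' : 'I_n, [/\ l' = (l + (size b).+2)%N :> nat,
     tnth i (pos l') = u' & tnth i (posS l') = v'].
    have := @tuple_at i (a ++ [:: u, v & b]) u' v' c.
    by rewrite size_cat /= -catA lE; apply.
  rewrite -l'E; have ll' : (l.+1 < l')%N || (l'.+1 < l)%N.
    by rewrite l'E !addnS !ltnS leq_addr.
  exact: Heq (vv_sigma_far p q K nu ll') (ev_M (ev_s l) (ev_s l')) (ev_M (ev_s l') (ev_s l)).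
- move=> a u v w b /=; rewrite addrC; apply/eqP; rewrite -subr_eq -mulrBl; apply/eqP.
  apply: ind => i iT iE; have [l [lE lu lv]] := tuple_at iE.
  have [l' [l'E _ lw]] : exists l' : 'I_n, [/\ l' = l.+1 :> nat,
     tnth i (pos l') = v & tnth i (posS l') = w].
    have := @tuple_at i (rcons a u) v w b.
    by rewrite size_rcons cat_rcons lE; apply.
  rewrite -iE -lE -lu -lv -lw.
  have sl := ev_s l; have sl' := ev_s l'; rewrite l'E in sl'.
  exact: Heq (vv_braid p q l'E iT)
    (ev_M (ev_B (ev_M (ev_M sl' sl) sl') (ev_M (ev_M sl sl') sl)) (ev_e i))
    (ev_M (ev_braid_rhs i l'E) (ev_e i)).
- move=> a u v b /=; have [/mapP[i iT /esym iE]|/de_outE->] := boolP (a ++ u :: v :: b \in words); last first.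
    by rewrite !mulr0 if_same subr0.
  have [l [lE lu lv]] := tuple_at iE; have := hsx l (pos l) i iT.
  rewrite tpermL /sigma_x_rhs eqxx lu lv -iE -lE /= /bump /= add1n => ->.
  by case: eqP => _; rewrite ?(ev_N ev_1) ?ev_0 ?mulN1r ?mul0r ?subr0 ?addr0.
- move=> a u v b /=; have [/mapP[i iT /esym iE]|/de_outE->] := boolP (a ++ u :: v :: b \in words); last first.
    by rewrite !mulr0 if_same addr0.
  have [l [lE lu lv]] := tuple_at iE; have := hsx l (posS l) i iT.
  have -> : sigma_x_rhs K nu l (posS l) i = if u == v then 1 else 0.
    rewrite /sigma_x_rhs lu lv eqxx; have -> // : (posS l == pos l) = false.
    by rewrite -val_eqE /= /bump add1n -[X in _ == X]addn0 -addn1 eqn_add2l.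
  rewrite tpermR -iE -lE /= /bump /= add1n => ->.
  by case: eqP => _; rewrite ?ev_1 ?ev_0 ?mul1r ?mul0r.
- move=> a u v b j /=; have [/mapP[i iT /esym iE]|/de_outE->] := boolP (a ++ u :: v :: b \in words); last first.
    by rewrite !mulr0.
  have [l [lE lu lv]] := tuple_at iE; rewrite -iE -lE size_tuple => jn jl jl'.
  pose j' := Ordinal jn.
  have jl1 : pos l != j' by rewrite eq_sym.
  have jl2 : posS l != j' by rewrite eq_sym -val_eqE /= /bump add1n.
  have := hsx l j' i iT; rewrite tpermD // /sigma_x_rhs.
  rewrite (eq_sym j' (pos l)) (negPf jl1) (eq_sym j') (negPf jl2) if_same ev_0 mul0r addr0.
  by [].
- move=> u b; have [/mapP[i iT /esym iE]|na] := boolP (u :: b \in words).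
    rewrite -(inv_seqE iE) -iE.
    exact: Heq (vv_pi_e p q iT) (ev_M ev_p (ev_e i)) (ev_M (ev_e (inv_seq i)) ev_p).
  have [/mapP[i iT /esym iE]|nb] := boolP (u^-1 :: b \in words).
    have := inv_seq_in nuK iT; rewrite -vv_words_tuple [val _](inv_seqE iE) invrK.
    by rewrite (negPf na).
  by rewrite !de_outE // mulr0 mul0r.
- move=> u b; apply: ind => i iT iE; rewrite -iE -(tuple_at_head iE).
  exact: Heq (vv_pi_sq p q iT) (ev_M (ev_M ev_p ev_p) (ev_e i)) (ev_M (ev_pi_sq_rhs i) (ev_e i)).
- move=> u b; rewrite -!mulNr; apply: ind => i iT iE; congr (_ * _).
  exact: Heq (vv_pi_x0 p q K nu n) (ev_M ev_p (ev_x ord0)) (ev_M (ev_N (ev_x ord0)) ev_p).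
- move=> j u b jb; apply: ind => i iT iE; congr (_ * _).
  have jn : (j.+1 < n.+1)%N by rewrite -(size_tuple i) iE.
  pose j' := Ordinal jn; have j0 : j' != ord0 by [].
  exact: Heq (vv_pi_x p q K nu j0) (ev_M ev_p (ev_x j')) (ev_M (ev_x j') ev_p).
- move=> u v b /=; apply/eqP; rewrite addrC -subr_eq -mulrBl; apply/eqP.
  apply: ind => i iT iE; have [l [lE lu lv]] := @tuple_at i [::] u v b iE.
  have sp := ev_M (ev_s l) ev_p; have ps := ev_M ev_p (ev_s l).
  rewrite -iE -lu -lv mulrBl.
  have := Heq _ _ _ _ (vv_sigma_pi p q lE iT)
   (ev_B (ev_M (ev_M sp sp) (ev_e i)) (ev_M (ev_M ps ps) (ev_e i)))
    (ev_M (ev_sigma_pi_rhs l i) (ev_e i)).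
  by rewrite !mulrA lE.
- move=> a w u v b /=; apply: ind => i iT iE; congr (_ * _).
  have [l [lE _ _]] := @tuple_at i (w :: a) u v b iE.
  have l0 : l != 0%N :> nat by rewrite lE.
  have := Heq _ _ _ _ (vv_pi_sigma p q K nu l0) (ev_M ev_p (ev_s l)) (ev_M (ev_s l) ev_p).
  by rewrite lE.
Qed.
End Evaluation.
End Presented.

Definition data_map m (C C' : Type) (D : vv_data C) (D' : vv_data C')
    (f : C -> C') : Prop :=
  [/\ forall l, (l < m)%N -> f (dx D l) = dx D' l,
      forall l, (l.+1 < m)%N -> f (ds D l) = ds D' l,
      (0 < m)%N -> f (dp D) = dp D'
    & forall a, f (de D a) = de D' a].

Definition data_all m (C : Type) (D : vv_data C) (Q : C -> Prop) : Prop :=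
  [/\ forall l, (l < m)%N -> Q (dx D l),
      forall l, (l.+1 < m)%N -> Q (ds D l),
      (0 < m)%N -> Q (dp D)
    & forall a, Q (de D a)].

(** Generation and universal property, the only facts about VV algebras that
    the proof uses. *)
Record vv_presents K nu m (A : kalg k) (D : vv_data A) : Prop := VVPresents {
  presents_axioms : vv_axioms K nu m D;
  presents_lift (C : kalg k) (D' : vv_data C) : vv_axioms K nu m D' ->
    exists f : khom A C, data_map m D D' f;
  presents_ind (Q : A -> Prop) : subalgebra Q -> data_all m D Q ->
    forall x, Q x
}.

Lemma presented_presents K nu n : theta_NN K nu ->
  exists D : vv_data (presented_kalg (@vv_rel k p q K nu n)),
    vv_presents K nu n.+1 D.
Proof.
move=> nuK; set R := @vv_rel k p q K nu n.
pose gen g := presented_gen R g.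
pose D := VVData
  (fun l => if insub l is Some j then gen (gen_x K nu j) else 0)
  (fun l => if insub l is Some j then gen (gen_sigma K nu j) else 0)
  (gen (gen_pi K nu n))
  (fun a => if insub a is Some t then
     presented_pi R (vv_e K nu (t : n.+1.-tuple k)) else 0).
have Dout a : a \notin vv_words K nu n.+1 -> de D a = 0.
  rewrite /=; case: insubP => //= t _ <-; rewrite vv_words_tuple /vv_e => tn.
  by rewrite insubN // raddf0.
have Dgen g : data_gen D g = gen g.
  case: g => [l|l||i] //=; rewrite ?valK //.
  by rewrite /vv_e valK.
have Dev : free_eval (data_gen D) =1 presented_pi R.
  by move=> u; rewrite (funext Dgen) free_eval_presented.
have Dax : vv_axioms K nu n.+1 D.
  apply: (rel_vv_axioms nuK Dout) => x y xy.
  exact: etrans (Dev x) (etrans (presented_rel xy) (esym (Dev y))).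
exists D; split=> // [C D' D'ax|Q Qalg [Qx Qs Qp Qe]].
  have [f fgen] := presented_lift (vv_axioms_rel (de_out D'ax) D'ax).
  exists f; split=> [l ln|l ln|_|a] /=.
  - by rewrite insubT fgen.
  - by rewrite insubT fgen.
  - exact: fgen.
  - case: insubP => /= [t _ <-|na]; last first.
      rewrite raddf0 (de_out D'ax) //.
      by apply: contra na => /vv_wordsP[/eqP].
    rewrite /vv_e; case: insubP => /= [i _ <-|ni]; first exact: fgen.
    by rewrite !raddf0 (de_out D'ax) // vv_words_tuple.
apply: presented_ind => // g; rewrite -[presented_gen _ _]/(gen g) -Dgen.
case: g => [l|l||i].
- exact: Qx.
- by apply: Qs; rewrite ltnS.
- exact: Qp.
- exact: Qe.
Qed.

(** In weight zero the only word is empty, its idempotent is 1, and all other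
    generators are out of range. *)
Lemma base_presents K nu : nu = mset0 ->
  exists D : vv_data (base_kalg k), vv_presents K nu 0 D.
Proof.
move=> nu0; exists (VVData (fun=> 0) (fun=> 0) 0 (fun a => (a == [::])%:R)).
have word0 a : (a \in vv_words K nu 0) = (a == [::]).
  apply/vv_wordsP/eqP => [[/size0nil ->] //|->]; split=> //.
  by rewrite nu0; apply/msetP => u; rewrite mset_seqE mset0E.
have words0 : vv_words K nu 0 = [:: [::]].
  apply: perm_small_eq => //; apply: uniq_perm; rewrite ?vv_words_uniq // => a.
  by rewrite word0 inE.
split.
- split=> /=; intros; rewrite ?(mul0r, mulr0, subr0, addr0, oppr0) //;
    try by case: a => [|? ?]; rewrite /= ?(mulr0, if_same, subr0, addr0).
  + by rewrite -[LHS]/((a == [::])%:R) -word0 (negPf H).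
  + by rewrite -natrM mulnb; case: (eqVneq a b) => [<-|]; [rewrite andbb|case: a b => [|? ?] [|? ?]].
  + by rewrite words0 big_seq1.
- move=> C D' D'ax; have eC (c : k) : kalg_emb C c = kalg_emb C c by [].
  exists (@KHom k (base_kalg k) C (kalg_emb C) eC); split=> // a /=.
  rewrite rmorph_nat; case: eqP => [->|/eqP]; last first.
    by rewrite -word0 => /(de_out D'ax) ->.
  by have := de_sum D'ax; rewrite words0 big_seq1 => ->.
- by move=> Q [Qc _ _] _ c; apply: Qc.
Qed.

(** The algebra for a weight of size at most 1 is the ground field, which is
    correct only for the weight zero; the second hypothesis excludes the
    others. *)
Lemma VV_presents K nu : theta_NN K nu -> (mset_half nu = 0%N -> nu = mset0) ->
  exists D : vv_data (VV p q K nu), vv_presents K nu (mset_half nu) D.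
Proof.
move=> nuK nu0; rewrite /VV; case E: (mset_half nu) => [|n].
  exact: base_presents (nu0 E).
exact: presented_presents.
Qed.

End WordRelations.

(** * Orbits and weights *)

Section Orbits.
Variables (k : fieldType) (p : k) (I : set k).
Hypotheses (p0 : p != 0) (Iorb : vv_orbit p I).

Lemma orbit_mulp2 u : I u -> I (p ^+ 2 * u).
Proof.
case: Iorb => l _ lI; rewrite !lI => -[[n e] ->]; exists (n + 1, e).
rewrite /vv_act /= mulrA; congr (_ * _).
by rewrite mulrDr mulr1 expfzDr // mulrC.
Qed.

Lemma orbit_divp2 u : I (p ^+ 2 * u) -> I u.
Proof.
case: Iorb => l _ lI; rewrite !lI => -[[n e] uE]; exists (n - 1, e).
apply: (@mulfI _ (p ^+ 2)); first by rewrite expf_neq0.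
rewrite uE /vv_act /= mulrA; congr (_ * _).
by rewrite mulrBr mulr1 expfzDr // -invr_expz mulrCA mulfV ?mulr1 ?expf_neq0.
Qed.

Lemma orbit_neq0 u : I u -> u != 0.
Proof.
case: Iorb => l l0 lI; rewrite lI => -[[n e] ->].
by rewrite /vv_act mulf_neq0 ?expfz_neq0 //=; case: e; rewrite ?invr_eq0.
Qed.

Lemma orbit_inv u : I u -> I u^-1.
Proof.
case: Iorb => l l0 lI; rewrite !lI => -[[n e] ->]; exists (- n, ~~ e).
rewrite /vv_act /= invfM mulrN; congr (_ * _); last by case: e; rewrite ?invrK.
by rewrite invr_expz.
Qed.

Lemma orbit_invE u : I u^-1 <-> I u.
Proof. by split=> [/orbit_inv|/orbit_inv //]; rewrite invrK. Qed.

(** A fixed point of the inversion is a square root of 1, hence 1 or -1. *)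
Lemma orbit_neq_inv u : ~ I 1 -> ~ I (-1) -> I u -> u != u^-1.
Proof.
move=> I1 IN1 Iu; apply/eqP => uV; have u0 := orbit_neq0 Iu.
have : u ^+ 2 == 1 by rewrite expr2 {2}uV divff.
by rewrite sqrf_eq1 => /orP[] /eqP uE; [apply: I1|apply: IN1]; rewrite -uE.
Qed.

End Orbits.

Section Weights.
Variable k : fieldType.
Implicit Types (a b : seq k) (nu : {mset k}%mset) (u : k).

Lemma word_weightE a u :
  word_weight a u = (count_mem u a + count_mem u^-1 a)%N.
Proof.
rewrite mset_seqE count_cat count_map; congr (_ + _)%N.
by apply: eq_count => v /=; rewrite (can2_eq (@invrK _) (@invrK _)).
Qed.

Lemma word_weight_cat a b :
  word_weight (a ++ b) = (word_weight a `+` word_weight b)%mset.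
Proof.
apply/msetP => u; rewrite msetE2 !word_weightE !count_cat.
by rewrite addnACA.
Qed.

Lemma mset_half_weight a : mset_half (word_weight a) = size a.
Proof.
have -> : mset_half (word_weight a) = (size (word_weight a))./2.
  by rewrite size_mset.
rewrite (perm_size (perm_eq_seq_mset _)) size_cat size_map addnn.
exact: doubleK.
Qed.

(** A symmetric multiset without fixed points of the inversion splits into
    pairs of mutually inverse letters, so it is the weight of a word. In
    particular its size is even, and halving the sizes is additive. *)
Lemma weight_exists nu : (forall u, nu u = nu u^-1) ->
  (forall u, nu u != 0%N -> u != u^-1) -> exists a, nu = word_weight a.
Proof.
have [n] := ubnP (size nu); elim: n nu => // n IHn nu nun nuV nu_neqV.
case E: (nu : seq k) => [|u s].
  by exists [::]; rewrite -[LHS]seq_mset_id E.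
have u0 : nu u != 0%N by rewrite -[nu]seq_mset_id E mset_seqE /= eqxx.
have unu : u \in nu by rewrite in_mset lt0n.
have uV := nu_neqV u u0.
pose nu' := ((nu `\ u) `\ u^-1)%mset.
have nu'E v : nu' v = (nu v - (v == u) - (v == u^-1))%N by rewrite !msetB1E.
have nu'V : forall v, nu' v = nu' v^-1.
  move=> v; rewrite !nu'E -nuV subnAC; congr (_ - _ - _)%N.
    by rewrite (can2_eq (@invrK _) (@invrK _)).
  by rewrite (inj_eq invr_inj).
have uV' : u^-1 \in (nu `\ u)%mset.
  by rewrite in_msetB1 eq_sym (negPf uV) /= in_mset -nuV lt0n.
have nuE : nu = (u +` (u^-1 +` nu'))%mset by rewrite !msetB1K.
have [||a aE] := IHn nu' _ nu'V.
- rewrite -ltnS; apply: leq_ltn_trans nun.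
  rewrite [in X in (_ < X)%N]nuE -[in X in (_ < X)%N](seq_mset_id nu') -!mset_cons.
  by rewrite (perm_size (perm_eq_seq_mset _)) /= ltnS.
- move=> v; rewrite nu'E => v0; apply: nu_neqV.
  by apply: contraNneq v0 => ->; rewrite !sub0n.
exists (u :: a); rewrite nuE aE; apply/msetP => v.
rewrite !mset1DE !word_weightE /= (eq_sym u v) (eq_sym u v^-1).
rewrite (can2_eq (@invrK _) (@invrK _)) addnA [RHS]addnACA.
by rewrite !addnA.
Qed.

End Weights.

(** * Colour words *)

Section Colours.
Local Open Scope nat_scope.
Implicit Types (b u v : bool) (a c d : seq bool) (l : nat).

Local Notation cnt b c := (count_mem b c).

Lemma negb_eqF b : (~~ b == b) = false.
Proof. by case: b. Qed.

Lemma count_colours b c : size c = (cnt b c + cnt (~~ b) c)%N.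
Proof.
rewrite -(count_predC (pred1 b)); congr (_ + _)%N; apply: eq_count => u /=.
by case: u b => -[].
Qed.

Lemma colour_split b c :
  c = nseq (cnt b c) b ++ nseq (cnt (~~ b) c) (~~ b) \/
  exists a d, c = a ++ ~~ b :: b :: d.
Proof.
elim: c => [|u c [IHc|[a [d ->]]]]; [by left| |by right; exists (u :: a), d].
have [->|ub] := eqVneq u b.
  by left; rewrite /= eqxx; case: (b) IHc => /= {1}->.
have -> : u = ~~ b by case: u b ub {IHc} => -[].
case E: (cnt b c) => [|m]; last first.
  by right; exists [::], (behead c); rewrite IHc E.
left; rewrite /= E eqxx; rewrite negb_eqF.
by rewrite /= {1}IHc E.
Qed.

(** The measure for inductions on colour words: exchanging two adjacent
    letters that are in the wrong order lowers it. *)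
Fixpoint inversions b c : nat :=
  if c is u :: c' then (inversions b c' + (u != b) * cnt b c')%N else 0.

Lemma inversions_swap b a d :
  inversions b (a ++ ~~ b :: b :: d) = (inversions b (a ++ b :: ~~ b :: d)).+1.
Proof.
elim: a => [|u a IHa] /=.
  rewrite !eqxx; rewrite negb_eqF.
  by rewrite /= !(mul0n, mul1n, addn0, add0n, add1n, addnS).
by rewrite IHa addSn !count_cat /= eqxx; case: b {IHa}.
Qed.

(** Positions of adjacent exchanges that lead from the word with false first
    to c, the last position of the list being exchanged first. Only exchanges
    of different letters occur. *)
Fixpoint sorting_word c : seq nat :=
  if c is u :: c' then
    map S (sorting_word c') ++ (if u then iota 0 (cnt false c') else [::])
  else [::].

(** The exchange at the position size a can be moved to the front of the list,
    since the positions before it are at distance at least 2. This is the only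
    property of the list that matters: it makes the product of the exchanges
    multiplicative along a single exchange. *)
Lemma sorting_word_swap a d (n := size (a ++ true :: false :: d)) :
  exists w1 w2, [/\ sorting_word (a ++ true :: false :: d) = w1 ++ size a :: w2,
    sorting_word (a ++ false :: true :: d) = w1 ++ w2
  & all (fun l => (size a).+1 < l) w1].
Proof.
rewrite {}/n; elim: a => [|u a [w1 [w2 [E1 E2 w1P]]]] /=.
  exists (map S (map S (sorting_word d))), (iota 1 (cnt false d)); split.
  - by rewrite cats0 add0n.
  - by rewrite cats0 map_cat -(iotaDl 1).
  - by rewrite -map_comp all_map; apply/allP.
rewrite E1 E2; exists (map S w1), (map S w2 ++ (if u then iota 0 (cnt false (a ++ true :: false :: d)) else [::])).
split; first by rewrite map_cat /= -catA.
  by rewrite map_cat /= -catA !count_cat.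
by rewrite all_map; apply: sub_all w1P => l.
Qed.

Lemma sorting_word_bound c : all (fun l => l.+1 < size c) (sorting_word c).
Proof.
elim: c => //= u c IHc; rewrite all_cat all_map; apply/andP; split.
  by apply: sub_all IHc => l.
case: u => //; apply/allP => l; rewrite mem_iota add0n => /andP[_ lc].
by rewrite ltnS (leq_trans lc) ?count_size.
Qed.

Lemma sorting_word_sorted m1 m2 :
  sorting_word (nseq m1 false ++ nseq m2 true) = [::].
Proof.
elim: m1 => [|m1 IH] /=; last by rewrite IH.
by elim: m2 => //= m2 ->; rewrite count_nseq mul0n.
Qed.

Section Counted.
Variable m : bool -> nat.

Definition sorted_colours b := nseq (m b) b ++ nseq (m (~~ b)) (~~ b).
Definition colours := permutations (sorted_colours false).

Lemma coloursP c : reflect (forall b, cnt b c = m b) (c \in colours).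
Proof.
rewrite mem_permutations.
have cs b : cnt b (sorted_colours false) = m b.
  by rewrite count_cat !count_nseq; case: b => /=; rewrite ?mul0n ?mul1n ?addn0.
apply: (iffP idP) => [/seq.permP cc b|cc]; first by rewrite cc cs.
apply/allP => b _ /=; by rewrite cc cs.
Qed.

Lemma colours_uniq : uniq colours. Proof. exact: permutations_uniq. Qed.

Lemma sorted_colours_in b : sorted_colours b \in colours.
Proof.
apply/coloursP => u; rewrite count_cat !count_nseq.
by case: b u => -[] /=; rewrite ?mul0n ?mul1n ?addn0.
Qed.

Lemma colours_perm c c' : perm_eq c c' -> (c \in colours) = (c' \in colours).
Proof. by rewrite !mem_permutations => /permPl->. Qed.

Lemma colours_swap a u v d :
  (a ++ u :: v :: d \in colours) = (a ++ v :: u :: d \in colours).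
Proof.
by apply: colours_perm; rewrite perm_cat2l -(cat1s u) -(cat1s v) -(cat1s u d) perm_catCA.
Qed.

Lemma colours_size c : c \in colours -> size c = (m false + m true)%N.
Proof. by move=> /coloursP cc; rewrite (count_colours false) !cc. Qed.

Lemma colours_sorted b c : c \in colours ->
  c = sorted_colours b \/ exists a d, c = a ++ ~~ b :: b :: d.
Proof. by move=> /coloursP cc; rewrite /sorted_colours -!cc; apply: colour_split. Qed.

Lemma colours_ind b (P : seq bool -> Prop) :
  (forall c, c \in colours -> (forall c', c' \in colours ->
     inversions b c' < inversions b c -> P c') -> P c) ->
  forall c, c \in colours -> P c.
Proof.
move=> IH c; have [n] := ubnP (inversions b c); elim: n c => // n IHn c cn cL.
by apply: IH => // c' c'L c'c; apply: IHn => //; apply: leq_trans c'c _.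
Qed.

End Counted.
End Colours.

(** * Matrix units in the separated algebra *)

Section ColouredWords.
Variables (k : fieldType) (col : k -> bool).
Implicit Types (i : seq k) (b : bool).

Definition colour_part b i := [seq u <- i | col u == b].

Lemma colour_part_cat b i j :
  colour_part b (i ++ j) = colour_part b i ++ colour_part b j.
Proof. exact: filter_cat. Qed.

Lemma size_colour_part b i : size (colour_part b i) = count_mem b (map col i).
Proof. by rewrite size_filter count_map. Qed.

Lemma colour_word_split i a u v d : map col i = a ++ u :: v :: d ->
  exists a' u' v' d', [/\ i = a' ++ u' :: v' :: d', map col a' = a,
    col u' = u, col v' = v & map col d' = d].
Proof.
move=> iE; have := congr1 (drop (size a)) iE; have := congr1 (take (size a)) iE.
rewrite -map_take -map_drop take_size_cat // drop_size_cat // => aE.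
case E: (drop _ i) => [|u' [|v' d']] //= -[<- <- <-].
by exists (take (size a) i), u', v', d'; rewrite -E cat_take_drop.
Qed.

Lemma colour_word_head i u d : map col i = u :: d ->
  exists u' d', [/\ i = u' :: d', col u' = u & map col d' = d].
Proof. by case: i => //= u' d' [<- <-]; exists u', d'. Qed.

Lemma colour_word_cat i a d : map col i = a ++ d ->
  exists a' d', [/\ i = a' ++ d', map col a' = a & map col d' = d].
Proof.
move=> iE; exists (take (size a) i), (drop (size a) i).
by rewrite cat_take_drop map_take map_drop iE take_size_cat ?drop_size_cat.
Qed.

Lemma colour_part_swap b i u v j : ~~ ((col u == b) && (col v == b)) ->
  colour_part b (i ++ u :: v :: j) = colour_part b (i ++ v :: u :: j).
Proof.
rewrite !colour_part_cat /colour_part /=.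
by case: (col u == b); case: (col v == b).
Qed.

Lemma colour_part_all b i : all (fun u => col u == b) i -> colour_part b i = i.
Proof. by move/all_filterP. Qed.

Lemma colour_part_none b i : map col i = nseq (size i) (~~ b) -> colour_part b i = [::].
Proof.
rewrite /colour_part; elim: i => //= u i IHi [-> /IHi ->].
by rewrite negb_eqF.
Qed.

(** A word is a shuffle of its two parts along its colour word. *)
Lemma colour_parts_inj i j : map col i = map col j ->
  colour_part false i = colour_part false j ->
  colour_part true i = colour_part true j -> i = j.
Proof.
rewrite /colour_part; elim: i j => [|u i IHi] [|v j] //= [uv /IHi IH]; rewrite uv.
by case: (col v) => /= [E1 [-> E2]|[-> E1] E2]; rewrite IH.
Qed.

End ColouredWords.

Lemma split_at1 (T : Type) (i : seq T) l : (l < size i)%N ->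
  exists a u d, i = a ++ u :: d /\ size a = l.
Proof.
move=> li; case E: (drop l i) => [|u d].
  by have := size_drop l i; rewrite E => /esym/eqP; rewrite subn_eq0 leqNgt li.
by exists (take l i), u, d; rewrite -E cat_take_drop size_takel // ltnW.
Qed.

Lemma split_at (T : Type) (i : seq T) l : (l.+1 < size i)%N ->
  exists a u v b, i = a ++ u :: v :: b /\ size a = l.
Proof.
move=> li; have ll : (l < size i)%N by apply: ltnW.
case E: (drop l i) => [|u [|v d]].
- by have := size_drop l i; rewrite E => /esym/eqP; rewrite subn_eq0 leqNgt ll.
- have := size_drop l i; rewrite E /= => /eqP; rewrite eq_sym -(eqn_add2r l).
  by rewrite subnK ?(ltnW ll) // add1n gtn_eqF.
by exists (take l i), u, v, d; rewrite -E cat_take_drop size_takel // ltnW.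
Qed.

Lemma cat_cases (T : Type) (a1 s1 a2 s2 : seq T) : a1 ++ s1 = a2 ++ s2 ->
  (exists t, a2 = a1 ++ t /\ s1 = t ++ s2) \/ (exists t, a1 = a2 ++ t /\ s2 = t ++ s1).
Proof.
elim: a1 a2 => [|y a1 IH] [|y' a2] /= E.
- by left; exists [::].
- by left; exists (y' :: a2).
- by right; exists (y :: a1).
by case: E => -> /IH[[t [-> ->]]|[t [-> ->]]]; [left|right]; exists t.
Qed.

(** In the word with b first, the position of a letter b is its rank among the
    letters b. *)
Lemma prefix_of_sorted b a d i j :
  a ++ b :: d = nseq i b ++ nseq j (~~ b) -> size a = count_mem b a /\ (size a < i)%N.
Proof.
elim: i a => [|i IHi] [|u a] //=.
- by case: j => //= j [/esym/eqP]; rewrite negb_eqF.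
- move=> E; have : b \in nseq j (~~ b) by rewrite -E in_cons mem_cat mem_head !orbT.
  by rewrite mem_nseq andbC -(inj_eq negb_inj) negbK negb_eqF.
by case=> -> /IHi[<- ai]; rewrite eqxx.
Qed.

(** All that is used of the two orbits: letters of the two colours are neither
    connected by arrows nor inverse to each other, and a word has the total
    weight exactly when its two parts have their own weights. *)
Record separation (k : fieldType) (p : k) (KK : set k) (nn : {mset k}%mset)
    (K : bool -> set k) (nu : bool -> {mset k}%mset) (m : bool -> nat)
    (col : k -> bool) : Prop := Separation {
  sep_words i : (i \in vv_words KK nn (m false + m true)) =
    (colour_part col false i \in vv_words (K false) (nu false) (m false)) &&
    (colour_part col true i \in vv_words (K true) (nu true) (m true));
  sep_col b i : i \in vv_words (K b) (nu b) (m b) -> all (fun u => col u == b) i;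
  sep_inv u : col u^-1 = col u;
  sep_arrow b u v : col u = b -> col v = b -> arrow p KK u v = arrow p (K b) u v;
  sep_no_arrow u v : col u != col v -> arrow p KK u v = false
}.

Section Separated.
Variables (k : fieldType) (p q : k) (KK : set k) (nn : {mset k}%mset).
Variables (K : bool -> set k) (nu : bool -> {mset k}%mset) (m : bool -> nat).
Variable col : k -> bool.
Hypothesis sep : separation p KK nn K nu m col.
Local Notation n := (m false + m true)%N.
Local Notation words := (vv_words KK nn n).
Local Notation wordsb b := (vv_words (K b) (nu b) (m b)).
Local Notation part := (colour_part col).
Local Notation colw := (map col).
Local Notation colours := (colours m).
Local Notation cs := (sorted_colours m).
Local Notation cnt b c := (count_mem b c).
Implicit Types (i j w : seq k) (a c d : seq bool) (b : bool).

Lemma word_part b i : i \in words -> part b i \in wordsb b.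
Proof. by rewrite (sep_words sep) => /andP[]; case: b. Qed.

Lemma word_colours i : i \in words -> colw i \in colours.
Proof.
move=> iw; apply/coloursP => b; rewrite -size_colour_part.
by have /vv_wordsP[] := word_part b iw.
Qed.

Lemma word_size i : i \in words -> size i = n.
Proof. by case/vv_wordsP. Qed.

(** For letters of different colours the exchange is an involution, without
    correction. *)
Lemma sq_rhs_diff (C : pzRingType) u v (x y : C) :
  col u != col v -> sq_rhs p KK u v x y = 1.
Proof.
move=> uv; rewrite /sq_rhs /arrow_to /arrow_both.
rewrite (sep_no_arrow sep uv) (sep_no_arrow sep (_ : col v != col u)) ?(eq_sym (col v)) //=.
by have [uv'|//] := eqVneq u v; rewrite uv' eqxx in uv.
Qed.

Lemma sq_rhs_same (C : pzRingType) b u v (x y : C) :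
  col u = b -> col v = b -> sq_rhs p KK u v x y = sq_rhs p (K b) u v x y.
Proof.
by move=> ub vb; rewrite /sq_rhs /arrow_to /arrow_both !(sep_arrow sep ub vb) !(sep_arrow sep vb ub).
Qed.

Lemma br_rhs_diff (C : pzRingType) (u v w : k) (x y z : C) :
  (col u != col v) || (col v != col w) -> br_rhs p KK u v w x y z = 0.
Proof.
move=> uvw; rewrite /br_rhs /arrow_to /arrow_both; case: eqP => // uw.
have uv : col u != col v by move: uvw; rewrite -uw (eq_sym (col v)) orbb.
by rewrite (sep_no_arrow sep uv) (sep_no_arrow sep (_ : col v != col u)) ?(eq_sym (col v)).
Qed.

Lemma br_rhs_same (C : pzRingType) b (u v w : k) (x y z : C) :
  col u = b -> col v = b ->
  br_rhs p KK u v w x y z = br_rhs p (K b) u v w x y z.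
Proof.
by move=> ub vb; rewrite /br_rhs /arrow_to /arrow_both !(sep_arrow sep ub vb) !(sep_arrow sep vb ub).
Qed.

Lemma sp_rhs_diff (C : pzRingType) u v (s : C) :
  col u != col v -> sp_rhs q u v s = 0.
Proof.
move=> uv; have uv' : (u^-1 == v) = false.
  by apply: contraNF uv => /eqP <-; rewrite (sep_inv sep).
by rewrite /sp_rhs uv'.
Qed.

Section MatrixUnits.
Variables (W : pzRingType) (D : vv_data k W).
Hypothesis ax : vv_axioms p q KK nn n D.
Local Notation x := (dx D).
Local Notation s := (ds D).
Local Notation pi := (dp D).
Local Notation e := (de D).

(** The idempotents add up to 1, so an identity may be checked word by word. *)
Lemma word_ext (z z' : W) : (forall i, i \in words -> z * e i = z' * e i) -> z = z'.
Proof.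
move=> zz'; rewrite -[z]mulr1 -[z']mulr1 -(de_sum ax) !mulr_sumr.
by rewrite big_seq [RHS]big_seq; apply: eq_bigr => i; apply: zz'.
Qed.

(** These idempotents cut W into blocks indexed by pairs of colour words; all
    blocks turn out to be isomorphic to the tensor product. *)
Definition cidem c : W := \sum_(i <- words | colw i == c) e i.

Lemma sum_e_mul (P : pred (seq k)) i :
  (\sum_(j <- words | P j) e j) * e i = if P i then e i else 0.
Proof.
have [iw|nw] := boolP (i \in words); last by rewrite (de_out ax nw) mulr0 if_same.
rewrite mulr_suml big_mkcond (bigD1_seq i) ?vv_words_uniq //=.
rewrite big1 => [|j /negPf ji]; last by rewrite (de_de ax) ji; case: ifP.
by rewrite (de_de ax) eqxx addr0; case: ifP.
Qed.

Lemma one_e c i : cidem c * e i = if colw i == c then e i else 0.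
Proof. exact: sum_e_mul. Qed.

Lemma one_one c d : cidem c * cidem d = if c == d then cidem c else 0.
Proof.
apply: word_ext => i _; rewrite -mulrA one_e.
have [<-|id] := eqVneq (colw i) d.
  by rewrite one_e eq_sym; case: ifP => // ci; rewrite ?one_e ?mul0r // (eqP ci) eqxx.
by rewrite mulr0; case: eqP => [->|_]; rewrite ?mul0r // one_e (negPf id).
Qed.

Lemma one_ext c (z z' : W) :
  (forall i, i \in words -> colw i = c -> z * e i = z' * e i) -> z * cidem c = z' * cidem c.
Proof.
move=> zz'; apply: word_ext => i iw; rewrite -!mulrA one_e.
by case: eqP => [/(zz' i iw)//|_]; rewrite !mulr0.
Qed.

Lemma one_out c : c \notin colours -> cidem c = 0.
Proof.
move=> nc; rewrite /cidem big_seq_cond big1 // => i /andP[/word_colours iL /eqP ic].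
by rewrite -ic iL in nc.
Qed.

Lemma sum_one : \sum_(c <- colours) cidem c = 1.
Proof.
apply: word_ext => i iw; rewrite mul1r mulr_suml (bigD1_seq (colw i)) ?colours_uniq ?word_colours //=.
rewrite big1 => [|c /negPf ci]; first by rewrite one_e eqxx addr0.
by rewrite one_e eq_sym ci.
Qed.

(** From here on relations are restricted to the words of one colour word. If
    the letters involved have different colours, the correction terms vanish,
    and the exchanges of colours satisfy the relations of a symmetric group. *)

Lemma s_one a u v d :
  s (size a) * cidem (a ++ u :: v :: d) = cidem (a ++ v :: u :: d) * s (size a).
Proof.
have [cL|cL] := boolP (a ++ u :: v :: d \in colours); last first.
  by rewrite !one_out ?mulr0 ?mul0r // -colours_swap.
apply: word_ext => i iw; rewrite -!mulrA one_e.
have [|a' [u' [v' [d' [-> sa]]]]] := @split_at _ i (size a).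
  by rewrite word_size // -(colours_size cL) size_cat /= !addnS ltnS leq_addr.
rewrite -sa (ds_de ax) [RHS]mulrA one_e !map_cat /=.
have -> : (colw a' ++ col v' :: col u' :: colw d' == a ++ v :: u :: d) =
          (colw a' ++ col u' :: col v' :: colw d' == a ++ u :: v :: d).
  by rewrite !eqseq_cat ?size_map // !eqseq_cons; congr (_ && _); rewrite andbCA.
by case: ifP => _; rewrite ?mulr0 ?mul0r // (ds_de ax).
Qed.

Lemma s_far l l' : (l.+1 < l')%N -> (l'.+1 < n)%N -> s l * s l' = s l' * s l.
Proof.
move=> ll' l'n; apply: word_ext => i iw.
have [|a' [u' [v' [c [iE sa']]]]] := @split_at _ i l'; first by rewrite word_size.
have [|a [u [v [b [a'E sa]]]]] := @split_at _ a' l; first by rewrite sa'.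
have := ds_far ax a u v b u' v' c.
have -> : (size a + (size b).+2)%N = l' by rewrite -sa' a'E size_cat.
by rewrite sa iE a'E -catA.
Qed.

Lemma ss_one a u d (c := a ++ u :: ~~ u :: d) : s (size a) * s (size a) * cidem c = cidem c.
Proof.
rewrite -[RHS]mul1r; apply: one_ext => i iw /colour_word_split[a' [u' [v' [d' [-> <- <- vu _]]]]].
by rewrite size_map (ds_ds ax) sq_rhs_diff ?mul1r // vu; case: (col u').
Qed.

Definition swap_pos (l j : nat) := if j == l then l.+1 else if j == l.+1 then l else j.

Lemma sx_one a u d (j : nat) (c := a ++ u :: ~~ u :: d) : (j < n)%N ->
  s (size a) * x j * cidem c = x (swap_pos (size a) j) * s (size a) * cidem c.
Proof.
move=> jn; apply: one_ext => i iw /colour_word_split[a' [u' [v' [d' [iE <- <- vu _]]]]].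
have uv : (u' == v') = false.
  by apply/eqP => uv; move: vu; rewrite uv; case: (col v').
have si : size (a' ++ u' :: v' :: d') = n by rewrite -iE word_size.
rewrite iE size_map /swap_pos; case: eqVneq => [->|jl]; first by rewrite (ds_dxl ax) uv subr0.
case: eqVneq => [->|jl']; first by rewrite (ds_dxr ax) uv addr0.
by rewrite (ds_dx ax) // si.
Qed.

Lemma braid_one a u v (w : bool) d (c := a ++ u :: v :: w :: d) (l := size a) :
    (u != v) || (v != w) ->
  s l.+1 * s l * s l.+1 * cidem c = s l * s l.+1 * s l * cidem c.
Proof.
move=> uvw; apply: one_ext => i iw /colour_word_split[a' [u' [v' [d' [iE aE uE vE /colour_word_head [w' [e' [dE wE _]]]]]]]].
rewrite iE dE /l -aE size_map (ds_braid ax) br_rhs_diff ?mul0r ?addr0 //.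
by rewrite uE vE wE.
Qed.

Lemma x_e l i : (l < n)%N -> x l * e i = e i * x l.
Proof.
move=> ln; have [iw|nw] := boolP (i \in words); last by rewrite (de_out ax nw) mulr0 mul0r.
by rewrite (dx_de ax) // word_size.
Qed.

Lemma x_one l c : (l < n)%N -> x l * cidem c = cidem c * x l.
Proof.
by move=> ln; rewrite mulr_sumr mulr_suml; apply: eq_bigr => i _; apply: x_e.
Qed.

Lemma x_x l l' : (l < n)%N -> (l' < n)%N -> x l * x l' = x l' * x l.
Proof.
by move=> ln l'n; apply: word_ext => i iw; rewrite (dx_dx ax) ?word_size.
Qed.

Lemma p_one u d : pi * cidem (u :: d) = cidem (u :: d) * pi.
Proof.
have [cL|cL] := boolP (u :: d \in colours); last by rewrite one_out // mulr0 mul0r.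
apply: word_ext => i iw; rewrite -!mulrA one_e.
case: i iw => [/word_size|v i iw]; first by rewrite -(colours_size cL).
rewrite (dp_de ax) [RHS]mulrA one_e /= (sep_inv sep).
by case: ifP => _; rewrite ?mulr0 ?mul0r // (dp_de ax).
Qed.

Lemma p_s l : (0 < l)%N -> (l.+1 < n)%N -> pi * s l = s l * pi.
Proof.
move=> l0 ln; apply: word_ext => i iw.
have [|a [u [v [b [-> sa]]]]] := @split_at _ i l; first by rewrite word_size.
by case: a sa l0 => [<- //|w a <- _]; apply: (dp_ds ax).
Qed.

Lemma p_x l : (0 < l)%N -> (l < n)%N -> pi * x l = x l * pi.
Proof.
case: l => // l _ ln; apply: word_ext => -[/word_size|u i /word_size iw].
  by move: ln => /[swap] <-.
by rewrite (dp_dx ax) // -ltnS [X in (_ < X)%N]iw.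
Qed.

Lemma psps_one u d (c := u :: ~~ u :: d) :
  s 0 * pi * s 0 * pi * cidem c = pi * s 0 * pi * s 0 * cidem c.
Proof.
apply: one_ext => i iw /(@colour_word_split _ _ _ [::])[a' [u' [v' [d' [-> aE uE vE _]]]]].
case: a' aE => // _; rewrite /= (ds_dp ax) sp_rhs_diff ?mul0r ?addr0 // uE vE.
by case: (u).
Qed.

(** Products of exchanges along a list of positions; those along the sorting
    list of c carry the block of the sorted colour word to the block of c. *)
Definition word_mul (w : seq nat) : W := \prod_(l <- w) s l.

Lemma word_mul_cat (w1 w2 : seq nat) : word_mul (w1 ++ w2) = word_mul w1 * word_mul w2.
Proof. exact: big_cat. Qed.

Definition sort_to c := word_mul (sorting_word c).
Definition sort_from c := word_mul (rev (sorting_word c)).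
Local Notation c0 := (cs false).

Lemma s_word_mul l (w : seq nat) : all (fun l' => l.+1 < l')%N w -> all (fun l' => l'.+1 < n)%N w ->
  s l * word_mul w = word_mul w * s l.
Proof.
rewrite /word_mul; elim: w => [|l' w IHw] /=; first by rewrite big_nil mulr1 mul1r.
move=> /andP[ll' wl] /andP[l'n wn].
by rewrite big_cons mulrA s_far // -!mulrA IHw.
Qed.

(** Products along the sorting lists change by one factor under one exchange
    of colours, so facts about them follow by induction along such exchanges
    (colours_step). *)
Lemma sort_swap a d : a ++ true :: false :: d \in colours ->
  sort_to (a ++ true :: false :: d) = s (size a) * sort_to (a ++ false :: true :: d) /\
  sort_from (a ++ true :: false :: d) = sort_from (a ++ false :: true :: d) * s (size a).
Proof.
move=> cL; have := sorting_word_bound (a ++ true :: false :: d).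
have [w1 [w2 [E1 E2 w1a]]] := sorting_word_swap a d.
rewrite /sort_to /sort_from E1 E2 (colours_size cL) all_cat => /andP[w1n _].
rewrite !rev_cat rev_cons -cats1 !word_mul_cat /word_mul big_cons big_seq1 -!/(word_mul _).
have r1 := s_word_mul w1a w1n.
have r2 : s (size a) * word_mul (rev w1) = word_mul (rev w1) * s (size a).
  by rewrite s_word_mul ?all_rev.
by rewrite !mulrA r1 -!mulrA r2.
Qed.

Lemma sort_to_sorted : sort_to c0 = 1 /\ sort_from c0 = 1.
Proof.
by rewrite /sort_to /sort_from /sorted_colours sorting_word_sorted /word_mul !big_nil.
Qed.

Lemma colours_step (P : seq bool -> Prop) : P c0 ->
  (forall a d, a ++ true :: false :: d \in colours ->
    P (a ++ false :: true :: d) -> P (a ++ true :: false :: d)) ->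
  forall c, c \in colours -> P c.
Proof.
move=> P0 PS; apply: (@colours_ind m false) => c cL IHc.
have [->//|[a [d cE]]] := colours_sorted false cL.
rewrite cE; apply: PS; first by rewrite -cE.
by apply: IHc; rewrite ?cE ?inversions_swap // -colours_swap -cE.
Qed.

Lemma one_sort_to c : c \in colours -> cidem c * sort_to c = sort_to c * cidem c0.
Proof.
move: c; apply: colours_step => [|a d cL IHc]; first by case: sort_to_sorted => -> _; rewrite mulr1 mul1r.
by have [-> _] := sort_swap cL; rewrite mulrA -s_one -!mulrA IHc.
Qed.

Lemma one_sort_from c : c \in colours -> sort_from c * cidem c = cidem c0 * sort_from c.
Proof.
move: c; apply: colours_step => [|a d cL IHc]; first by case: sort_to_sorted => _ ->; rewrite mulr1 mul1r.
by have [_ ->] := sort_swap cL; rewrite -mulrA s_one mulrA IHc mulrA.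
Qed.

Lemma sort_fromK c : c \in colours -> sort_from c * sort_to c * cidem c0 = cidem c0.
Proof.
move: c; apply: colours_step => [|a d cL IHc]; first by case: sort_to_sorted => -> ->; rewrite !mul1r.
have c'L : a ++ false :: true :: d \in colours by rewrite -colours_swap.
have [-> ->] := sort_swap cL.
rewrite -!mulrA -(one_sort_to c'L) (mulrA (s _)) (mulrA (s _ * s _)) (ss_one a false d).
by rewrite (one_sort_to c'L) mulrA.
Qed.

Lemma sort_toK c : c \in colours -> sort_to c * sort_from c * cidem c = cidem c.
Proof.
move: c; apply: colours_step => [|a d cL IHc]; first by case: sort_to_sorted => -> ->; rewrite !mul1r.
have [-> ->] := sort_swap cL.
set c := a ++ false :: true :: d in IHc *.
transitivity (s (size a) * (sort_to c * sort_from c * cidem c) * s (size a)).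
  by rewrite -!mulrA s_one.
by rewrite IHc -mulrA -s_one mulrA (ss_one a true d).
Qed.

(** The matrix unit at (c, d), through the colour word with false first. *)
Definition cunit c d : W := locked (sort_to c * cidem c0 * sort_from d).
Lemma cunitE c d : cunit c d = sort_to c * cidem c0 * sort_from d.
Proof. by rewrite /cunit -lock. Qed.

Lemma one_cunit c d : c \in colours -> cidem c * cunit c d = cunit c d.
Proof.
by move=> cL; rewrite !cunitE !mulrA one_sort_to // -[_ * cidem c0 * cidem c0]mulrA one_one eqxx.
Qed.

Lemma cunit_one c d : d \in colours -> cunit c d * cidem d = cunit c d.
Proof.
by move=> dL; rewrite !cunitE -!mulrA one_sort_from // (mulrA (cidem c0)) one_one eqxx.
Qed.

Lemma cunitM c d f : c \in colours -> d \in colours -> f \in colours ->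
  cunit c d * cunit d f = cunit c f.
Proof.
move=> cL dL fL; rewrite !cunitE !mulrA; congr (_ * _).
rewrite -!mulrA (mulrA (sort_from d)) sort_fromK // one_one eqxx.
by [].
Qed.

Lemma cunitM0 c d d' f : d \in colours -> d' \in colours -> d != d' ->
  cunit c d * cunit d' f = 0.
Proof.
move=> dL d'L /negPf dd'; rewrite -(cunit_one c dL) -(one_cunit f d'L).
by rewrite mulrA -(mulrA (cunit c d)) one_one dd' mulr0 mul0r.
Qed.

Lemma cunit_id c : c \in colours -> cunit c c = cidem c.
Proof.
by move=> cL; rewrite !cunitE -mulrA -one_sort_from // mulrA sort_toK.
Qed.

(** The exchange of two different colours is a matrix unit, in both
    directions, because it is an involution there. *)
Lemma cunit_step a u d (c := a ++ u :: ~~ u :: d) (c' := a ++ ~~ u :: u :: d) :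
  c \in colours -> cunit c c' = s (size a) * cidem c'.
Proof.
move=> cL; have c'L : c' \in colours by rewrite /c' -colours_swap.
have E f : cunit c f = s (size a) * cunit c' f; last by rewrite E cunit_id.
case: u @c @c' cL c'L => c c' cL c'L.
  by rewrite !cunitE (sort_swap cL).1 !mulrA.
have -> : cunit c' f = s (size a) * cunit c f.
  by rewrite !cunitE (sort_swap c'L).1 !mulrA.
by rewrite -(one_cunit f cL) !mulrA (ss_one a false d).
Qed.

(** The commutant of the matrix units; W is a matrix algebra over it, and the
    tensor product will be mapped into it. *)
Definition units_commute (z : W) : Prop :=
  forall c d, c \in colours -> d \in colours -> z * cunit c d = cunit c d * z.

Lemma units_commute_one z c : units_commute z -> c \in colours -> z * cidem c = cidem c * z.
Proof. by move=> zc cL; rewrite -cunit_id // zc. Qed.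

Lemma units_commuteD z z' : units_commute z -> units_commute z' -> units_commute (z + z').
Proof. by move=> zc zc' c d cL dL; rewrite mulrDl mulrDr zc ?zc'. Qed.
Lemma units_commuteN z : units_commute z -> units_commute (- z).
Proof. by move=> zc c d cL dL; rewrite mulNr mulrN zc. Qed.
Lemma units_commuteM z z' : units_commute z -> units_commute z' -> units_commute (z * z').
Proof. by move=> zc zc' c d cL dL; rewrite -mulrA zc' // mulrA zc // mulrA. Qed.
Lemma units_commute1 : units_commute 1.
Proof. by move=> c d _ _; rewrite mul1r mulr1. Qed.
Lemma units_commute0 : units_commute 0.
Proof. by move=> c d _ _; rewrite mul0r mulr0. Qed.

(** An element of the commutant is determined by its restriction to one
    diagonal block, as the units transport it to all others. *)
Lemma units_commute_ext c z z' : c \in colours -> units_commute z -> units_commute z' ->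
  z * cidem c = z' * cidem c -> z = z'.
Proof.
move=> cL zc zc' zz'; rewrite -[z]mulr1 -[z']mulr1 -sum_one !mulr_sumr.
rewrite big_seq [RHS]big_seq; apply: eq_bigr => d dL.
rewrite -cunit_id // -(cunitM dL cL dL). rewrite !mulrA zc // zc' //.
by rewrite -!mulrA -(one_cunit d cL) !(mulrA z) !(mulrA z') zz'.
Qed.

(** The units are products of elementary exchanges. *)
Lemma units_commute_gen z : (forall c, c \in colours -> z * cidem c = cidem c * z) ->
  (forall a u d, a ++ u :: ~~ u :: d \in colours ->
    z * (s (size a) * cidem (a ++ u :: ~~ u :: d)) =
    s (size a) * cidem (a ++ u :: ~~ u :: d) * z) ->
  units_commute z.
Proof.
move=> z1 zs.
have zU c : c \in colours -> z * (sort_to c * cidem c0) = sort_to c * cidem c0 * z.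
  move: c; apply: colours_step => [|a d cL IHc].
    by case: sort_to_sorted => -> _; rewrite mul1r z1 // sorted_colours_in.
  have c'L : a ++ false :: true :: d \in colours by rewrite -colours_swap.
  have -> : sort_to (a ++ true :: false :: d) * cidem c0 =
      s (size a) * cidem (a ++ false :: true :: d) * (sort_to (a ++ false :: true :: d) * cidem c0).
    by rewrite (sort_swap cL).1 -!mulrA -one_sort_to // (mulrA (cidem _)) one_one eqxx.
  exact: commrM (zs a false d c'L) IHc.
have zV c : c \in colours -> z * (cidem c0 * sort_from c) = cidem c0 * sort_from c * z.
  move: c; apply: colours_step => [|a d cL IHc].
    by case: sort_to_sorted => _ ->; rewrite mulr1 z1 // sorted_colours_in.
  have c'L : a ++ false :: true :: d \in colours by rewrite -colours_swap.
  have -> : cidem c0 * sort_from (a ++ true :: false :: d) =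
      cidem c0 * sort_from (a ++ false :: true :: d) * (s (size a) * cidem (a ++ true :: false :: d)).
    rewrite (sort_swap cL).2 s_one [RHS]mulrA -[in RHS](mulrA (cidem c0)) one_sort_from //.
    by rewrite !mulrA one_one eqxx.
  exact: commrM IHc (zs a true d cL).
move=> c d cL dL.
have -> : cunit c d = sort_to c * cidem c0 * (cidem c0 * sort_from d).
  by rewrite cunitE -!mulrA (mulrA (cidem c0) (cidem c0)) one_one eqxx.
exact: commrM (zU c cL) (zV d dL).
Qed.

(** The inverse of the restriction to the block of d: an element of that block
    is repeated along the diagonal. *)
Definition amplify d (z : W) : W := \sum_(c <- colours) cunit c d * z * cunit d c.

Lemma amplify_commute d z : d \in colours -> units_commute (amplify d z).
Proof.
move=> dL c c' cL c'L; rewrite /amplify mulr_suml mulr_sumr.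
rewrite (bigD1_seq c) ?colours_uniq //= big1_seq ?addr0; last first.
  by move=> f /andP[fc fL]; rewrite -mulrA cunitM0 ?mulr0.
rewrite (bigD1_seq c') ?colours_uniq //= big1_seq ?addr0; last first.
  by move=> f /andP[fc fL]; rewrite !mulrA cunitM0 ?mul0r // eq_sym.
by rewrite -!mulrA cunitM // !mulrA cunitM.
Qed.

Lemma amplify_one d z : d \in colours -> z * cidem d = cidem d * z ->
  amplify d z * cidem d = z * cidem d.
Proof.
move=> dL zd; rewrite /amplify mulr_suml.
rewrite (bigD1_seq d) ?colours_uniq //= big1_seq ?addr0; last first.
  by move=> f /andP[fc fL]; rewrite -cunit_id // -mulrA cunitM0 ?mulr0.
by rewrite cunit_id // zd -!mulrA !one_one eqxx -?mulrA zd mulrA one_one eqxx.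
Qed.

(** Elements of the commutant are compared by their restriction to a block;
    since the restriction is multiplicative, a relation between them can be
    checked at whichever colour word shows it best. *)
Definition seen_at c (z z0 : W) : Prop := units_commute z /\ z * cidem c = z0 * cidem c.

Lemma seen_atM c z z' z0 z0' : c \in colours -> seen_at c z z0 -> seen_at c z' z0' ->
  seen_at c (z * z') (z0 * z0').
Proof.
move=> cL [zc z1] [zc' z1']; split; first exact: units_commuteM.
by rewrite -mulrA units_commute_one // mulrA z1 -mulrA -units_commute_one // z1' mulrA.
Qed.
Lemma seen_atD c z z' z0 z0' : seen_at c z z0 -> seen_at c z' z0' ->
  seen_at c (z + z') (z0 + z0').
Proof.
move=> [zc z1] [zc' z1']; split; first exact: units_commuteD.
by rewrite !mulrDl z1 z1'.
Qed.
Lemma seen_atN c z z0 : seen_at c z z0 -> seen_at c (- z) (- z0).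
Proof. by move=> [zc z1]; split; [exact: units_commuteN|rewrite !mulNr z1]. Qed.
Lemma seen_at1 c : seen_at c 1 1. Proof. by split=> //; exact: units_commute1. Qed.
Lemma seen_at0 c : seen_at c 0 0. Proof. by split=> //; exact: units_commute0. Qed.

Lemma seen_at_inj c z z' z0 z0' : c \in colours -> seen_at c z z0 -> seen_at c z' z0' ->
  z0 * cidem c = z0' * cidem c -> z = z'.
Proof.
by move=> cL [zc z1] [zc' z1'] E; apply: (units_commute_ext cL) => //; rewrite z1 z1'.
Qed.

(** Adjacent blocks are identified by conjugation with the exchange, which is
    an involution. *)
Lemma seen_at_move a b d (c := a ++ ~~ b :: b :: d) (c' := a ++ b :: ~~ b :: d) z g g' :
  c \in colours -> seen_at c' z g' ->
  s (size a) * g' * s (size a) * cidem c = g * cidem c -> seen_at c z g.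
Proof.
move=> cL [zc z1] E; split=> //; rewrite -E.
have c'L : c' \in colours by rewrite /c' -colours_swap.
have E1 : cunit c c' = s (size a) * cidem c'.
  by have := @cunit_step a (~~ b) d; rewrite negbK; apply.
rewrite -[in LHS]cunit_id // -[in LHS](cunitM cL c'L cL) mulrA zc // E1.
by rewrite -(mulrA (s _)) -units_commute_one // z1 -!mulrA one_cunit // (cunit_step c'L).
Qed.

Lemma amplify_seen d z : d \in colours -> z * cidem d = cidem d * z ->
  seen_at d (amplify d z) z.
Proof. by move=> dL zd; split; [exact: amplify_commute|exact: amplify_one]. Qed.

(** The generators of the algebra of colour b, inside W: at the colour word
    where b comes first they are the first generators of W, and the matrix
    units carry them to the other blocks. *)
Definition part_data b : vv_data k W := VVData
  (fun r => amplify (cs b) (x r)) (fun r => amplify (cs b) (s r))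
  (amplify (cs b) pi) (fun w => \sum_(i <- words | part b i == w) e i).
Local Notation X b := (dx (part_data b)).
Local Notation S b := (ds (part_data b)).
Local Notation P b := (dp (part_data b)).
Local Notation E b := (de (part_data b)).

Lemma sxs_one a u d (j : nat) (c := a ++ u :: ~~ u :: d) : (j < n)%N ->
  s (size a) * x j * s (size a) * cidem c = x (swap_pos (size a) j) * cidem c.
Proof.
move=> jn; rewrite -mulrA s_one mulrA.
have := @sx_one a (~~ u) d j jn; rewrite negbK => ->.
by rewrite -!mulrA -s_one (mulrA (s _)) ss_one.
Qed.

Lemma sss_one a u d l (c := a ++ u :: ~~ u :: d) :
  s (size a) * s l = s l * s (size a) ->
  s (size a) * s l * s (size a) * cidem c = s l * cidem c.
Proof. by move=> ->; rewrite -!mulrA (mulrA (s (size a))) ss_one. Qed.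

(** A pair of letters of one colour moves past a letter of the other colour by
    the braid relation, which has no correction term here. *)
Lemma sbraids_one a u d (l := size a) (c := a ++ u :: ~~ u :: ~~ u :: d) :
  s l * (s l.+1 * s l * s l.+1) * s l * cidem c = s l.+1 * cidem c.
Proof.
have sr e f : s l.+1 * cidem (a ++ e :: f :: ~~ u :: d) = cidem (a ++ e :: ~~ u :: f :: d) * s l.+1.
  by have := s_one (a ++ [:: e]) f (~~ u) d; rewrite size_cat addn1 -!catA.
have ss f : s l.+1 * s l.+1 * cidem (a ++ ~~ u :: f :: ~~ f :: d) = cidem (a ++ ~~ u :: f :: ~~ f :: d).
  by have := ss_one (a ++ [:: ~~ u]) f d; rewrite size_cat addn1 -!catA.
set A := s l; set B := s l.+1; pose o' := cidem (a ++ ~~ u :: u :: ~~ u :: d).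
have braid : B * A * B * cidem c = A * B * A * cidem c.
  by apply: braid_one; case: (u).
have ao : A * cidem c = o' * A by apply: s_one.
have bo : B * cidem c = cidem c * B by apply: sr.
transitivity (A * B * (B * A * B * cidem c)); first by rewrite braid !mulrA.
transitivity (A * (B * B * o') * (A * B)).
  by rewrite -!mulrA bo (mulrA A (cidem c)) ao -!mulrA.
by rewrite ss -mulrA (mulrA o') -ao mulrA mulrA ss_one bo.
Qed.

Lemma sps_one a u d (c := a ++ u :: ~~ u :: d) : c \in colours -> (0 < size a)%N ->
  s (size a) * pi * s (size a) * cidem c = pi * cidem c.
Proof.
move=> cL a0; rewrite -p_s //; last first.
  by rewrite -(colours_size cL) size_cat /= !addnS ltnS leq_addr.
by rewrite -!mulrA (mulrA (s (size a))) ss_one.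
Qed.

(** The generator x of rank r of the colour b is seen at each colour word as
    the generator of W at the position of the r-th letter b. The proof goes
    from the sorted colour word by adjacent exchanges, by induction on the
    number of inversions; the position of the letter changes by the exchange. *)
Lemma seen_x b a d : a ++ b :: d \in colours ->
  seen_at (a ++ b :: d) (X b (cnt b a)) (x (size a)).
Proof.
move cE: (a ++ b :: d) => c cL; move: c cL a d cE.
apply: (@colours_ind m b) => c cL IHc a d cE.
have an : (size a < n)%N by rewrite -(colours_size cL) -cE size_cat /= addnS ltnS leq_addr.
have [cs_c|[a1 [d1 c1E]]] := colours_sorted b cL.
  have [sa am] := prefix_of_sorted (etrans cE cs_c).
  rewrite -sa cs_c; apply: amplify_seen; first exact: sorted_colours_in.
  exact: x_one.
have step a' d' : a1 ++ b :: ~~ b :: d1 = a' ++ b :: d' -> cnt b a' = cnt b a ->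
    swap_pos (size a1) (size a') = size a -> seen_at c (X b (cnt b a)) (x (size a)).
  move=> c'E <- ta; rewrite c1E.
  have c'L : a1 ++ b :: ~~ b :: d1 \in colours by rewrite -colours_swap -c1E.
  apply: (seen_at_move (g' := x (size a'))); first by rewrite -c1E.
    by apply: (IHc _ c'L _ a' d' (esym c'E)); rewrite c1E inversions_swap.
  have := @sxs_one a1 (~~ b) d1 (size a'); rewrite negbK ta; apply.
  by rewrite -(colours_size c'L) c'E size_cat /= addnS ltnS leq_addr.
have := etrans cE c1E => /cat_cases[[t [a1E dE]]|[t [aE dE]]].
  case: t a1E dE => [|u t] a1E /= [uE dE].
    by move/esym/eqP: uE; rewrite negb_eqF.
  apply: (step a (t ++ b :: ~~ b :: d1)); rewrite ?a1E ?uE -?catA //.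
  rewrite /swap_pos size_cat /= addnS ltn_eqF ?ltnS ?leq_addr //.
  by rewrite ltn_eqF // ltnS leqW ?leq_addr.
case: t aE dE => [|u [|v t]] aE /=.
- by case=> /eqP; rewrite negb_eqF.
- case=> uE dE; apply: (step a1 (~~ b :: d1)) => //.
    by rewrite aE -uE count_cat /= negb_eqF !addn0.
  by rewrite /swap_pos eqxx aE size_cat addn1.
case=> uE vE dE; apply: (step (a1 ++ b :: ~~ b :: t) d).
- by rewrite dE -catA.
- by rewrite aE -uE -vE !count_cat /= negb_eqF eqxx.
rewrite /swap_pos aE !size_cat /= !addnS !gtn_eqF ?ltnS ?leqW ?leq_addr //.
Qed.

(** The analogue for two neighbours of colour b. When the exchanged letter
    stands immediately before the pair, it has to pass both of its letters:
    this takes two exchanges and the braid relation (sbraids_one). *)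
Lemma seen_s b a d : a ++ b :: b :: d \in colours ->
  seen_at (a ++ b :: b :: d) (S b (cnt b a)) (s (size a)).
Proof.
move cE: (a ++ b :: b :: d) => c cL; move: c cL a d cE.
apply: (@colours_ind m b) => c cL IHc a d cE.
have an : ((size a).+1 < n)%N.
  by rewrite -(colours_size cL) -cE size_cat /= !addnS !ltnS leq_addr.
have [cs_c|[a1 [d1 c1E]]] := colours_sorted b cL.
  have [sa am] := prefix_of_sorted (etrans cE cs_c).
  rewrite -sa cs_c; apply: amplify_seen; first exact: sorted_colours_in.
  by rewrite -cs_c -cE s_one.
have c'L : a1 ++ b :: ~~ b :: d1 \in colours by rewrite -colours_swap -c1E.
have step a' d' : a1 ++ b :: ~~ b :: d1 = a' ++ b :: b :: d' -> cnt b a' = cnt b a ->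
    s (size a1) * s (size a') * s (size a1) * cidem c = s (size a) * cidem c ->
    seen_at c (S b (cnt b a)) (s (size a)).
  move=> c'E <- ta; rewrite c1E.
  apply: (seen_at_move (g' := s (size a'))); first by rewrite -c1E.
    by apply: (IHc _ c'L _ a' d' (esym c'E)); rewrite c1E inversions_swap.
  by rewrite -c1E.
have a1n : ((size a1).+1 < n)%N.
  by rewrite -(colours_size cL) c1E size_cat /= !addnS !ltnS leq_addr.
have far : s (size a1) * s (size a) = s (size a) * s (size a1) ->
    s (size a1) * s (size a) * s (size a1) * cidem c = s (size a) * cidem c.
  by have := @sss_one a1 (~~ b) d1 (size a); rewrite negbK -c1E.
have := etrans cE c1E => /cat_cases[[t [a1E dE]]|[t [aE dE]]].
  case: t a1E dE => [|u [|v t]] a1E /=.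
  - by case=> /esym/eqP; rewrite negb_eqF.
  - by case=> _ /esym/eqP; rewrite negb_eqF.
  case=> uE vE dE; apply: (step a (t ++ b :: ~~ b :: d1)) => //.
    by rewrite a1E -uE -vE -catA.
  apply: far; symmetry; apply: s_far => //.
  by rewrite a1E size_cat /= !addnS !ltnS leq_addr.
case: t aE dE => [|u [|v t]] aE /=.
- by case=> /eqP; rewrite negb_eqF.
- case=> uE dE; have {}c1E : c = a1 ++ ~~ b :: b :: b :: d by rewrite c1E dE.
  have {}aE : a = a1 ++ [:: ~~ b] by rewrite aE uE.
  have c1L : a1 ++ b :: ~~ b :: b :: d \in colours by rewrite -dE.
  have c2L : a1 ++ b :: b :: ~~ b :: d \in colours.
    have := colours_swap m (a1 ++ [:: b]) b (~~ b) d; rewrite -!catA /= => ->.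
    by rewrite c1L.
  have -> : cnt b a = cnt b a1 by rewrite aE count_cat /= negb_eqF !addn0.
  have sa : size a = (size a1).+1 by rewrite aE size_cat addn1.
  have inv1 : (inversions b (a1 ++ b :: ~~ b :: b :: d) < inversions b c)%N.
    by rewrite c1E inversions_swap.
  have inv2 : (inversions b (a1 ++ b :: b :: ~~ b :: d) < inversions b c)%N.
    apply: ltn_trans inv1; have := inversions_swap b (a1 ++ [:: b]) d.
    by rewrite -!catA /= => ->.
  have seen2 := IHc _ c2L inv2 a1 (~~ b :: d) erefl.
  have seen1 : seen_at (a1 ++ b :: ~~ b :: b :: d) (S b (cnt b a1))
      (s (size a1).+1 * s (size a1) * s (size a1).+1).
    have := @seen_at_move (a1 ++ [:: b]) b d (S b (cnt b a1)) (s (size a1).+1 * s (size a1) * s (size a1).+1) (s (size a1)).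
    by rewrite size_cat addn1 -!catA /=; apply.
  rewrite c1E sa; apply: (seen_at_move _ seen1); first by rewrite -c1E.
  by have := @sbraids_one a1 (~~ b) d; rewrite negbK.
case=> uE vE dE; apply: (step (a1 ++ b :: ~~ b :: t) d).
- by rewrite dE -catA.
- by rewrite aE -uE -vE !count_cat /= negb_eqF eqxx.
have -> : size (a1 ++ b :: ~~ b :: t) = size a by rewrite aE !size_cat.
by apply: far; apply: s_far => //; rewrite aE size_cat /= !addnS !ltnS leq_addr.
Qed.

(** The generator pi acts on the first letter. The first letter b can stay in
    its place while the remaining letters are sorted. *)
Lemma seen_p b d : b :: d \in colours -> seen_at (b :: d) (P b) pi.
Proof.
move cE: (b :: d) => c cL; move: c cL d cE.
apply: (@colours_ind m b) => c cL IHc d cE.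
have [cs_c|[a1 [d1 c1E]]] := colours_sorted b cL.
  rewrite cs_c; apply: amplify_seen; first exact: sorted_colours_in.
  by rewrite -cs_c -cE p_one.
case: a1 c1E => [|u a1] c1E; first by move: c1E; rewrite -cE => -[/esym/eqP]; rewrite negb_eqF.
have uE : u = b by move: c1E; rewrite -cE => -[].
rewrite c1E; apply: (seen_at_move (g' := pi)); first by rewrite -c1E.
  apply: (IHc _ _ _ (a1 ++ b :: ~~ b :: d1)); rewrite ?uE //.
    by have := colours_swap m (b :: a1) b (~~ b) d1; rewrite /= => ->; rewrite c1E uE in cL.
  by have := inversions_swap b (b :: a1) d1; rewrite c1E uE => ->.
by have := @sps_one (u :: a1) (~~ b) d1; rewrite negbK -c1E; apply.
Qed.

Lemma E_e b w i : E b w * e i = if part b i == w then e i else 0.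
Proof. exact: sum_e_mul. Qed.

Lemma E_out b w : w \notin wordsb b -> E b w = 0.
Proof.
move=> nw; rewrite /= big_seq_cond big1 // => i /andP[/(word_part b) + /eqP iw].
by rewrite iw (negPf nw).
Qed.

Lemma E_size b w : size w != m b -> E b w = 0.
Proof. by move=> sw; apply: E_out; apply: contra sw => /vv_wordsP[->]. Qed.

(** Exchanging two letters of different colours does not change the parts of a
    word. *)
Lemma E_commute b w : units_commute (E b w).
Proof.
have E1 c : E b w * cidem c = cidem c * E b w.
  apply: word_ext => i _; rewrite -!mulrA one_e E_e.
  by case: ifP => h1; case: ifP => h2; rewrite ?mulr0 ?E_e ?one_e ?h1 ?h2.
apply: units_commute_gen => // a u d cL; apply: word_ext => i iw.
rewrite mulrA -[RHS]mulrA E_e -(mulrA _ _ (e i)) one_e.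
case: eqP => [ic|ic].
  have [a' [u' [v' [d' [iE aE uE vE _]]]]] := colour_word_split ic.
  rewrite -aE size_map -mulrA iE (ds_de ax) mulrA E_e colour_part_swap; last first.
    by rewrite uE vE; case: (u) (b) => -[].
  case: ifP => _; last by rewrite mul0r mulr0.
  by rewrite -mulrA one_e -iE ic aE eqxx iE (ds_de ax).
by rewrite !mulr0; case: ifP => _; rewrite ?mulr0 // -mulrA one_e ifN ?mulr0 //; apply/eqP.
Qed.

Lemma seen_E c b w : seen_at c (E b w) (E b w).
Proof. by split=> //; apply: E_commute. Qed.

Lemma sorted_word b i : i \in words -> colw i = cs b ->
  exists w w', [/\ i = w ++ w', all (fun u => col u == b) w, size w = m b & part b w' = [::]].
Proof.
move=> iw ic; have [w [w' [iE wE w'E]]] := colour_word_cat ic.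
have sw : size w = m b by rewrite -(size_map col) wE size_nseq.
have wb : all (fun u => col u == b) w.
  by rewrite -(all_map col (pred1 b)) wE all_nseq /= eqxx orbT.
exists w, w'; split=> //.
by rewrite colour_part_none // w'E -(size_map col) w'E size_nseq.
Qed.

(** At the colour word where b comes first, the words with part w are the
    words that begin with w, so a relation of W at those words is a relation
    at w. *)
Lemma part_rel b w z z' :
  (size w = m b -> all (fun u => col u == b) w -> exists z0 z0',
    [/\ seen_at (cs b) z z0, seen_at (cs b) z' z0' &
        forall w', z0 * e (w ++ w') = z0' * e (w ++ w')]) ->
  z * E b w = z' * E b w.
Proof.
have [sw|/E_size -> _] := eqVneq (size w) (m b); last by rewrite !mulr0.
have [wb|wb] := boolP (all (fun u => col u == b) w); last first.
  by rewrite E_out ?mulr0 //; apply: contra wb => /(sep_col sep).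
case=> // z0 [z0' [zz zz' rel]].
have csL := sorted_colours_in m b.
apply: (seen_at_inj csL (seen_atM csL zz (seen_E _ _ _)) (seen_atM csL zz' (seen_E _ _ _))).
apply: one_ext => i iw ic; rewrite -!mulrA E_e.
have [w1 [w' [iE w1b _ w'b]]] := sorted_word iw ic.
by rewrite iE colour_part_cat w'b cats0 colour_part_all //; case: eqP => [->|_]; rewrite ?mulr0.
Qed.

Lemma seen_sorted_x b r : (r < m b)%N -> seen_at (cs b) (X b r) (x r).
Proof.
move=> rm; apply: amplify_seen; first exact: sorted_colours_in.
by apply: x_one; apply: leq_trans rm _; case: (b); rewrite ?leq_addl ?leq_addr.
Qed.

Lemma sorted_coloursE b r : (r < m b)%N ->
  cs b = nseq r b ++ b :: nseq (m b - r.+1) b ++ nseq (m (~~ b)) (~~ b).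
Proof.
move=> rm; rewrite /sorted_colours -{1}(subnKC rm) addSnnS nseqD -catA.
by rewrite -[_ :: _]/(nseq 1 b ++ _).
Qed.

Lemma seen_sorted_s b r : (r.+1 < m b)%N -> seen_at (cs b) (S b r) (s r).
Proof.
move=> rm; apply: amplify_seen; first exact: sorted_colours_in.
rewrite (sorted_coloursE (ltnW rm)) -(subnSK rm) /=.
by have := s_one (nseq r b) b b (nseq (m b - r.+2) b ++ nseq (m (~~ b)) (~~ b)); rewrite size_nseq.
Qed.

Lemma seen_sorted_p b : (0 < m b)%N -> seen_at (cs b) (P b) pi.
Proof.
move=> mb; apply: amplify_seen; first exact: sorted_colours_in.
by rewrite (sorted_coloursE mb) /= p_one.
Qed.

Section SeenRhs.
Variables (K' : set k) (c : seq bool).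
Hypothesis cL : c \in colours.
Implicit Types u v : k.

Let seenN y z : seen_at c y z -> seen_at c (- y) (- z).
Proof. exact: seen_atN. Qed.
Let seenD y z y' z' : seen_at c y z -> seen_at c y' z' -> seen_at c (y + y') (z + z').
Proof. exact: seen_atD. Qed.
Let seenM y z y' z' : seen_at c y z -> seen_at c y' z' -> seen_at c (y * y') (z * z').
Proof. exact: seen_atM. Qed.

Lemma seen_sq_rhs u v y1 y2 z1 z2 : seen_at c y1 z1 -> seen_at c y2 z2 ->
  seen_at c (sq_rhs p K' u v y1 y2) (sq_rhs p K' u v z1 z2).
Proof.
exact: (sq_rhs_related p K' (seen_at0 c) (seen_at1 c) seenN seenD seenM).
Qed.

Lemma seen_br_rhs u v (w : k) y1 y2 y3 z1 z2 z3 :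
  seen_at c y1 z1 -> seen_at c y2 z2 -> seen_at c y3 z3 ->
  seen_at c (br_rhs p K' u v w y1 y2 y3) (br_rhs p K' u v w z1 z2 z3).
Proof.
exact: (br_rhs_related p K' (seen_at0 c) (seen_at1 c) seenN seenD seenM).
Qed.

Lemma seen_psq_rhs u y z : seen_at c y z -> seen_at c (psq_rhs q u y) (psq_rhs q u z).
Proof. exact: (psq_rhs_related q (seen_at1 c) seenN). Qed.

Lemma seen_sp_rhs u v y z : seen_at c y z -> seen_at c (sp_rhs q u v y) (sp_rhs q u v z).
Proof. exact: (sp_rhs_related q (seen_at0 c) seenN). Qed.

End SeenRhs.

Lemma part_sum_e b : \sum_(w <- wordsb b) E b w = 1.
Proof.
apply: word_ext => i iw; rewrite mul1r mulr_suml.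
rewrite (bigD1_seq (part b i)) ?vv_words_uniq ?word_part //= E_e eqxx.
by rewrite big1 ?addr0 // => w /negPf wi; rewrite E_e eq_sym wi.
Qed.

Lemma part_E_E b w w' : E b w * E b w' = if w == w' then E b w else 0.
Proof.
apply: word_ext => i _; rewrite -mulrA E_e.
have [<-|iw] := eqVneq (part b i) w'.
  rewrite E_e eq_sym; case: ifP => [/eqP wi|_]; last by rewrite mul0r.
  by rewrite E_e wi eqxx.
rewrite mulr0; case: eqP => [->|_]; last by rewrite mul0r.
by rewrite E_e (negPf iw).
Qed.

(** Each relation is checked at the colour word where b comes first: there the
    generators of the family are generators of W, and the relation is the one
    of W. *)
Lemma part_axioms b : vv_axioms p q (K b) (nu b) (m b) (part_data b).
Proof.
have csL := sorted_colours_in m b.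
have seenM := seen_atM csL.
have cat_size (a d : seq k) (u v : k) : size (a ++ u :: v :: d) = m b -> ((size a).+1 < m b)%N.
  by move=> <-; rewrite size_cat /= !addnS !ltnS leq_addr.
split.
- exact: E_out.
- exact: part_E_E.
- exact: part_sum_e.
- move=> a u v d; have [sw|sw] := eqVneq (size (a ++ u :: v :: d)) (m b); last first.
    rewrite (E_size sw) (E_size (w := a ++ v :: u :: d)) ?mulr0 ?mul0r //.
    by move: sw; rewrite !size_cat.
  have ln := cat_size _ _ _ _ sw; have Hs := seen_sorted_s ln.
  apply: (seen_at_inj csL (seenM _ _ _ _ Hs (seen_E _ _ _)) (seenM _ _ _ _ (seen_E _ _ _) Hs)).
  apply: one_ext => i iw ic; have [w [w' [iE wb wm w'b]]] := sorted_word iw ic.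
  have [|a1 [u1 [v1 [d1 [wE sa]]]]] := @split_at _ w (size a); first by rewrite wm.
  have w1b : all (fun y => col y == b) (a1 ++ v1 :: u1 :: d1).
    by rewrite -(perm_all _ (perm_swap u1 v1 a1 d1)) -wE.
  have se : s (size a) * e i = e ((a1 ++ v1 :: u1 :: d1) ++ w') * s (size a).
    by rewrite iE wE -sa -!catA /= (ds_de ax).
  have p1 : part b i = w by rewrite iE colour_part_cat w'b cats0 colour_part_all.
  have p2 : part b ((a1 ++ v1 :: u1 :: d1) ++ w') = a1 ++ v1 :: u1 :: d1.
    by rewrite colour_part_cat w'b cats0 colour_part_all.
  rewrite -!mulrA se E_e mulrA E_e p1 p2 wE.
  have -> : (a1 ++ v1 :: u1 :: d1 == a ++ v :: u :: d) = (a1 ++ u1 :: v1 :: d1 == a ++ u :: v :: d).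
    by rewrite !eqseq_cat // !eqseq_cons; congr (_ && _); rewrite andbCA.
  by case: ifP => _; rewrite ?mulr0 ?mul0r // -se.
- move=> l w lw; have [sw|/E_size->] := eqVneq (size w) (m b); last by rewrite mulr0 mul0r.
  rewrite sw in lw; have Hx := seen_sorted_x lw.
  apply: (seen_at_inj csL (seenM _ _ _ _ Hx (seen_E _ _ _)) (seenM _ _ _ _ (seen_E _ _ _) Hx)).
  apply: one_ext => i iw ic; have ln : (l < n)%N.
    by apply: leq_trans lw _; case: (b); rewrite ?leq_addl ?leq_addr.
  rewrite -!mulrA E_e x_e // mulrA E_e.
  by case: ifP => _; rewrite ?mulr0 ?mul0r // x_e.
- move=> l l' w lw l'w; apply: part_rel => sw wb; rewrite sw in lw l'w.
  have Hx := seen_sorted_x lw; have Hx' := seen_sorted_x l'w.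
  do 2!eexists; split; [exact: (seenM _ _ _ _ Hx Hx')|exact: (seenM _ _ _ _ Hx' Hx)|].
  move=> w'; apply: (dx_dx ax); rewrite size_cat sw; apply: ltn_addr => //.
- move=> a u v d l; apply: part_rel => sw wb; have ln := cat_size _ _ _ _ sw.
  have Hs := seen_sorted_s ln; have Hx := seen_sorted_x (ltnW ln); have Hx' := seen_sorted_x ln.
  have [ub vb] : col u = b /\ col v = b by move: wb; rewrite all_cat /= => /and4P[_ /eqP-> /eqP->].
  do 2!eexists; split; [exact: (seenM _ _ _ _ Hs Hs)|exact: (seen_sq_rhs _ csL _ _ Hx Hx')|].
  by move=> w'; rewrite -catA /= (ds_ds ax) (sq_rhs_same _ _ ub vb).
- move=> a u v d u' v' f l l' i; apply: part_rel => sw wb.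
  have ln := cat_size _ _ _ _ sw; have Hs := seen_sorted_s ln.
  have l'n : (l'.+1 < m b)%N.
    by rewrite -sw !size_cat /= /l' size_cat /= !addnS !ltnS addnA leq_addr.
  have Hs' := seen_sorted_s l'n.
  do 2!eexists; split; [exact: (seenM _ _ _ _ Hs Hs')|exact: (seenM _ _ _ _ Hs' Hs)|].
  by move=> w'; rewrite /i -catA /= -catA; apply: (ds_far ax).
- move=> a u v w d l i; rewrite -mulrDl; apply: part_rel => sw wb.
  have ln := cat_size _ _ _ _ sw; have Hs := seen_sorted_s ln.
  have l'n : (l.+2 < m b)%N.
    by rewrite -sw size_cat /= !addnS !ltnS leq_addr.
  have Hs' := seen_sorted_s l'n.
  have Hx := seen_sorted_x (ltnW ln); have Hx' := seen_sorted_x ln; have Hx'' := seen_sorted_x l'n.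
  have [ub vb] : col u = b /\ col v = b by move: wb; rewrite all_cat /= => /and4P[_ /eqP-> /eqP->].
  do 2!eexists; split; [exact: (seenM _ _ _ _ (seenM _ _ _ _ Hs' Hs) Hs')| |].
    exact: (seen_atD (seenM _ _ _ _ (seenM _ _ _ _ Hs Hs') Hs) (seen_br_rhs _ csL _ _ _ Hx Hx' Hx'')).
  by move=> w'; rewrite /i -catA /= mulrDl (ds_braid ax) (br_rhs_same _ _ _ _ ub vb).
- move=> a u v d l i.
  have -> : (if u == v then E b i else 0) = (if u == v then 1 else 0) * E b i.
    by case: ifP => _; rewrite ?mul1r ?mul0r.
  rewrite -mulrBl; apply: part_rel => sw wb; have ln := cat_size _ _ _ _ sw.
  have Hs := seen_sorted_s ln; have Hx := seen_sorted_x (ltnW ln); have Hx' := seen_sorted_x ln.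
  have H1 : seen_at (cs b) (if u == v then 1 else 0) (if u == v then 1 else 0).
    by case: ifP => _; [exact: seen_at1|exact: seen_at0].
  do 2!eexists; split; [exact: (seenM _ _ _ _ Hs Hx)| |].
    exact: (seen_atD (seenM _ _ _ _ Hx' Hs) (seen_atN H1)).
  move=> w'; rewrite /i -catA /= mulrBl (ds_dxl ax); congr (_ - _).
  by case: ifP => _; rewrite ?mul1r ?mul0r.
- move=> a u v d l i.
  have -> : (if u == v then E b i else 0) = (if u == v then 1 else 0) * E b i.
    by case: ifP => _; rewrite ?mul1r ?mul0r.
  rewrite -mulrDl; apply: part_rel => sw wb; have ln := cat_size _ _ _ _ sw.
  have Hs := seen_sorted_s ln; have Hx := seen_sorted_x (ltnW ln); have Hx' := seen_sorted_x ln.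
  have H1 : seen_at (cs b) (if u == v then 1 else 0) (if u == v then 1 else 0).
    by case: ifP => _; [exact: seen_at1|exact: seen_at0].
  do 2!eexists; split; [exact: (seenM _ _ _ _ Hs Hx')| |].
    exact: (seen_atD (seenM _ _ _ _ Hx Hs) H1).
  move=> w'; rewrite /i -catA /= mulrDl (ds_dxr ax); congr (_ + _).
  by case: ifP => _; rewrite ?mul1r ?mul0r.
- move=> a u v d j l i ji jl jl'; apply: part_rel => sw wb; have ln := cat_size _ _ _ _ sw.
  rewrite sw in ji; have Hs := seen_sorted_s ln; have Hx := seen_sorted_x ji.
  do 2!eexists; split; [exact: (seenM _ _ _ _ Hs Hx)|exact: (seenM _ _ _ _ Hx Hs)|].
  move=> w'; have iE : i ++ w' = a ++ u :: v :: (d ++ w') by rewrite /i -catA.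
  by rewrite iE (ds_dx ax) // -iE size_cat sw ltn_addr.
- move=> u d; have [sw|sw] := eqVneq (size (u :: d)) (m b); last first.
    by rewrite (E_size sw) (E_size (w := u^-1 :: d)) ?mulr0 ?mul0r.
  have m0 : (0 < m b)%N by rewrite -sw.
  have Hp := seen_sorted_p m0.
  apply: (seen_at_inj csL (seenM _ _ _ _ Hp (seen_E _ _ _)) (seenM _ _ _ _ (seen_E _ _ _) Hp)).
  apply: one_ext => i iw ic; have [w [w' [iE wb wm w'b]]] := sorted_word iw ic.
  case: w iE wb wm => [|u1 w] iE wb wm; first by rewrite -wm in m0.
  have w1b : all (fun y => col y == b) (u1^-1 :: w) by rewrite /= (sep_inv sep).
  have pe : pi * e i = e ((u1^-1 :: w) ++ w') * pi by rewrite iE (dp_de ax).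
  have p1 : part b i = u1 :: w by rewrite iE colour_part_cat w'b cats0 colour_part_all.
  have p2 : part b ((u1^-1 :: w) ++ w') = u1^-1 :: w.
    by rewrite colour_part_cat w'b cats0 colour_part_all.
  rewrite -!mulrA pe E_e mulrA E_e p1 p2.
  rewrite !eqseq_cons (inj_eq invr_inj).
  by case: ifP => _; rewrite ?mulr0 ?mul0r // -pe.
- move=> u d; apply: part_rel => sw wb; have m0 : (0 < m b)%N by rewrite -sw.
  have Hp := seen_sorted_p m0; have Hx := seen_sorted_x m0.
  do 2!eexists; split; [exact: (seenM _ _ _ _ Hp Hp)|exact: (seen_psq_rhs _ Hx)|].
  by move=> w'; rewrite /= (dp_dp ax).
- move=> u d; rewrite -mulNr; apply: part_rel => sw wb; have m0 : (0 < m b)%N by rewrite -sw.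
  have Hp := seen_sorted_p m0; have Hx := seen_sorted_x m0.
  do 2!eexists; split; [exact: (seenM _ _ _ _ Hp Hx)|exact: (seen_atN (seenM _ _ _ _ Hx Hp))|].
  by move=> w'; rewrite /= (dp_dx0 ax) mulNr.
- move=> j u d jd; apply: part_rel => sw wb; have m0 : (0 < m b)%N by rewrite -sw.
  have jm : (j.+1 < m b)%N by rewrite -sw.
  have Hp := seen_sorted_p m0; have Hx := seen_sorted_x jm.
  do 2!eexists; split; [exact: (seenM _ _ _ _ Hp Hx)|exact: (seenM _ _ _ _ Hx Hp)|].
  by move=> w'; rewrite /= (dp_dx ax) // size_cat ltn_addr.
- move=> u v d i; rewrite -mulrDl; apply: part_rel => sw wb.
  have ln : (1 < m b)%N by rewrite -sw.
  have Hp := seen_sorted_p (ltnW ln); have Hs := seen_sorted_s ln.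
  have H1 := seenM _ _ _ _ (seenM _ _ _ _ (seenM _ _ _ _ Hs Hp) Hs) Hp.
  have H2 := seenM _ _ _ _ (seenM _ _ _ _ (seenM _ _ _ _ Hp Hs) Hp) Hs.
  do 2!eexists; split; [exact: H1|exact: (seen_atD H2 (seen_sp_rhs _ _ Hs))|].
  by move=> w'; rewrite /i /= mulrDl (ds_dp ax).
- move=> a w u v d l i; apply: part_rel => sw wb.
  have ln : (l.+1 < m b)%N by rewrite -sw /i /= size_cat /= !addnS !ltnS leq_addr.
  have l0 : (0 < m b)%N by apply: leq_trans ln.
  have Hp := seen_sorted_p l0; have Hs := seen_sorted_s ln.
  do 2!eexists; split; [exact: (seenM _ _ _ _ Hp Hs)|exact: (seenM _ _ _ _ Hs Hp)|].
  by move=> w'; rewrite /i /= -catA /=; apply: (dp_ds ax).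
Qed.

Lemma x_s l r : (l.+1 < n)%N -> (r < l)%N -> s l * x r = x r * s l.
Proof.
move=> ln rl; apply: word_ext => i iw; have si := word_size iw.
have [|a [u [v [d [iE sa]]]]] := @split_at _ i l; first by rewrite si.
have rn : (r < n)%N by apply: leq_trans ln; apply: leqW; apply: ltnW.
rewrite iE -sa; apply: (ds_dx ax); rewrite -?iE ?si //; first by rewrite sa ltn_eqF.
by rewrite sa ltn_eqF // ltnW.
Qed.

(** At the colour word where b comes first, the letters of the other colour
    are shifted by m b. Hence the two families are seen there as generators of
    W with disjoint positions, which commute; the only exception is the pair
    of the two generators pi. *)
Lemma sorted_colours_at b r : (r < m (~~ b))%N ->
  cs b = (nseq (m b) b ++ nseq r (~~ b)) ++ ~~ b :: nseq (m (~~ b) - r.+1) (~~ b).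
Proof.
move=> rm; rewrite /sorted_colours -{1}(subnKC rm) addSnnS nseqD -!catA.
by rewrite -[_ :: nseq _ _]/(nseq 1 (~~ b) ++ _).
Qed.

Lemma count_sorted_prefix b r :
  count_mem (~~ b) (nseq (m b) b ++ nseq r (~~ b)) = r /\
  size (nseq (m b) b ++ nseq r (~~ b)) = (m b + r)%N.
Proof.
by rewrite count_cat !count_nseq /= eqxx mul1n eq_sym negb_eqF mul0n size_cat !size_nseq.
Qed.

Lemma seen_other_x b r : (r < m (~~ b))%N ->
  seen_at (cs b) (X (~~ b) r) (x (m b + r)%N).
Proof.
move=> rm; have := sorted_colours_in m b; rewrite (sorted_colours_at rm) => cL.
by have := seen_x cL; have [-> ->] := count_sorted_prefix b r.
Qed.

Lemma seen_other_s b r : (r.+1 < m (~~ b))%N ->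
  seen_at (cs b) (S (~~ b) r) (s (m b + r)%N).
Proof.
move=> rm; have := sorted_colours_in m b; rewrite (sorted_colours_at (ltnW rm)).
rewrite -(subnSK rm) => cL.
by have := seen_s cL; have [-> ->] := count_sorted_prefix b r.
Qed.

Lemma mnE b : (m b + m (~~ b))%N = n.
Proof. by case: b; rewrite //= addnC. Qed.

Lemma other_lt b r : (r < m (~~ b))%N -> (m b + r < n)%N.
Proof. by move=> rm; rewrite -(mnE b) ltn_add2l. Qed.

Lemma other_ltS b r : (r.+1 < m (~~ b))%N -> ((m b + r).+1 < n)%N.
Proof. by rewrite -addnS; apply: other_lt. Qed.

Section CrossCommutation.
Variable b : bool.

Lemma commute_at z z' z0 z0' : seen_at (cs b) z z0 -> seen_at (cs b) z' z0' ->
  z0 * z0' * cidem (cs b) = z0' * z0 * cidem (cs b) -> z * z' = z' * z.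
Proof.
have csL := sorted_colours_in m b.
by move=> H H'; apply: (seen_at_inj csL (seen_atM csL H H') (seen_atM csL H' H)).
Qed.

Lemma X_X r r' : (r < m b)%N -> (r' < m (~~ b))%N ->
  X b r * X (~~ b) r' = X (~~ b) r' * X b r.
Proof.
move=> rm rm'; apply: commute_at (seen_sorted_x rm) (seen_other_x rm') _.
by rewrite x_x ?other_lt // -(mnE b) ltn_addr.
Qed.

Lemma X_S r r' : (r < m b)%N -> (r'.+1 < m (~~ b))%N ->
  X b r * S (~~ b) r' = S (~~ b) r' * X b r.
Proof.
move=> rm rm'; apply: commute_at (seen_sorted_x rm) (seen_other_s rm') _.
by rewrite x_s ?other_ltS // ltn_addr.
Qed.

Lemma S_S r r' : (r.+1 < m b)%N -> (r'.+1 < m (~~ b))%N ->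
  S b r * S (~~ b) r' = S (~~ b) r' * S b r.
Proof.
move=> rm rm'; apply: commute_at (seen_sorted_s rm) (seen_other_s rm') _.
by rewrite s_far ?other_ltS // ltn_addr.
Qed.

Lemma P_X r' : (0 < m b)%N -> (r' < m (~~ b))%N ->
  P b * X (~~ b) r' = X (~~ b) r' * P b.
Proof.
move=> rm rm'; apply: commute_at (seen_sorted_p rm) (seen_other_x rm') _.
by rewrite p_x ?other_lt ?addn_gt0 ?rm.
Qed.

Lemma P_S r' : (0 < m b)%N -> (r'.+1 < m (~~ b))%N ->
  P b * S (~~ b) r' = S (~~ b) r' * P b.
Proof.
move=> rm rm'; apply: commute_at (seen_sorted_p rm) (seen_other_s rm') _.
by rewrite p_s ?other_ltS ?addn_gt0 ?rm.
Qed.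

(** Both generators act on a first letter, so none of the sorted colour words
    shows both of them directly. At a colour word that begins with the two
    colours, one is pi and the other is its conjugate by the first exchange,
    and the claim is the relation between pi and this exchange. *)
Lemma P_P : (0 < m b)%N -> (0 < m (~~ b))%N -> P b * P (~~ b) = P (~~ b) * P b.
Proof.
move=> mb mb'; pose d := nseq (m b).-1 b ++ nseq (m (~~ b)).-1 (~~ b).
have cL : ~~ b :: b :: d \in colours.
  rewrite /d; apply/coloursP; case: (b) mb mb' => /= mb mb' [] /=;
    by rewrite count_cat !count_nseq /= !(mul0n, mul1n, addn0, add0n, add1n) prednK.
have c'L : b :: ~~ b :: d \in colours by rewrite (colours_swap m [::] b (~~ b) d).
have H' : seen_at (~~ b :: b :: d) (P (~~ b)) pi by apply: seen_p.
have H : seen_at (~~ b :: b :: d) (P b) (s 0 * pi * s 0).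
  exact: (@seen_at_move [::] b d (P b) (s 0 * pi * s 0) pi cL (seen_p c'L)).
apply: (seen_at_inj cL (seen_atM cL H H') (seen_atM cL H' H)).
by have := psps_one (~~ b) d; rewrite negbK !mulrA.
Qed.

Lemma X_E r w : (r < m b)%N -> X b r * E (~~ b) w = E (~~ b) w * X b r.
Proof.
move=> rm; apply: commute_at (seen_sorted_x rm) (seen_E _ _ _) _.
have rn : (r < n)%N by rewrite -(mnE b) ltn_addr.
apply: one_ext => i _ _; rewrite -!mulrA E_e x_e // mulrA E_e.
by case: ifP => _; rewrite ?mulr0 ?mul0r // x_e.
Qed.

Lemma S_E r w : (r.+1 < m b)%N -> S b r * E (~~ b) w = E (~~ b) w * S b r.
Proof.
move=> rm; apply: commute_at (seen_sorted_s rm) (seen_E _ _ _) _.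
rewrite (sorted_coloursE (ltnW rm)) -(subnSK rm).
apply: one_ext => i _ /colour_word_split[a [u [v [d [-> aE ub vb _]]]]].
have <- : size a = r by rewrite -(size_map col) aE size_nseq.
rewrite -!mulrA E_e (ds_de ax) mulrA E_e colour_part_swap ?ub; last first.
  by rewrite eq_sym negb_eqF.
by case: ifP => _; rewrite ?mulr0 ?mul0r // (ds_de ax).
Qed.

Lemma P_E w : (0 < m b)%N -> P b * E (~~ b) w = E (~~ b) w * P b.
Proof.
move=> rm; apply: commute_at (seen_sorted_p rm) (seen_E _ _ _) _.
rewrite (sorted_coloursE rm).
apply: one_ext => i _ /colour_word_head[u [d [-> ub _]]].
rewrite -!mulrA E_e (dp_de ax) mulrA E_e /= (sep_inv sep) ub (eq_sym b) negb_eqF.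
by case: ifP => _; rewrite ?mulr0 ?mul0r // (dp_de ax).
Qed.

Lemma E_E w w' : E b w * E (~~ b) w' = E (~~ b) w' * E b w.
Proof.
apply: word_ext => i _; rewrite -!mulrA !E_e.
by case: ifP => h; case: ifP => h'; rewrite ?mulr0 ?E_e ?E_e ?h ?h'.
Qed.

End CrossCommutation.

Lemma part_comm b :
  data_all (m b) (part_data b) (fun z =>
    data_all (m (~~ b)) (part_data (~~ b)) (fun z' => z * z' = z' * z)).
Proof.
split=> [r rm|r rm|rm|w].
- split=> [r' rm'|r' rm'|rm'|w'].
  + exact: X_X.
  + exact: X_S.
  + by have := @P_X (~~ b) r rm'; rewrite negbK => ->.
  + exact: X_E.
- split=> [r' rm'|r' rm'|rm'|w'].
  + by have := @X_S (~~ b) r' r rm'; rewrite negbK => ->.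
  + exact: S_S.
  + by have := @P_S (~~ b) r rm'; rewrite negbK => ->.
  + exact: S_E.
- split=> [r' rm'|r' rm'|rm'|w'].
  + exact: P_X.
  + exact: P_S.
  + exact: P_P.
  + exact: P_E.
- split=> [r' rm'|r' rm'|rm'|w'].
  + by have := @X_E (~~ b) r' w rm'; rewrite negbK => ->.
  + by have := @S_E (~~ b) r' w rm'; rewrite negbK => ->.
  + by have := @P_E (~~ b) w rm'; rewrite negbK => ->.
  + exact: E_E.
Qed.

Lemma part_commute b : data_all (m b) (part_data b) units_commute.
Proof.
split=> [r _|r _|_|w]; try exact: E_commute;
  apply: amplify_commute; exact: sorted_colours_in.
Qed.

(** A word is determined by its two parts and its colour word, so its
    idempotent is recovered from the families and the matrix units. *)
Lemma E_colours i : E false (part false i) * E true (part true i) * cidem (colw i) = e i.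
Proof.
apply: word_ext => j _; rewrite -!mulrA one_e (de_de ax) (eq_sym i).
case: eqP => [ji|ji]; last by rewrite !mulr0; case: eqP => // ji'; rewrite ji' in ji.
rewrite !E_e; case: eqP => [pt|pt]; last first.
  by rewrite mulr0; case: eqP => // ji'; rewrite ji' in pt.
rewrite E_e; case: eqP => [pf|pf]; last by case: eqP => // ji'; rewrite ji' in pf.
by rewrite (colour_parts_inj ji pf pt) eqxx.
Qed.

End MatrixUnits.
End Separated.

(** * Matrices over the tensor product *)

Section IndexedMatrices.
Variables (T : eqType) (t0 : T) (L : seq T) (R : pzRingType).
Hypothesis L_uniq : uniq L.
Implicit Types c t f : T.

(** Rows and columns are named by the members of L, here the colour words; for
    names outside L the matrix is zero. *)
Definition entry c t (r : R) : 'M[R]_(size L) :=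
  \matrix_(i, j) if (nth t0 L i == c) && (nth t0 L j == t) then r else 0.

Lemma entryD c t r r' : entry c t (r + r') = entry c t r + entry c t r'.
Proof. by apply/matrixP => i j; rewrite !mxE; case: ifP => _; rewrite ?addr0. Qed.
Lemma entryN c t r : entry c t (- r) = - entry c t r.
Proof. by apply/matrixP => i j; rewrite !mxE; case: ifP => _; rewrite ?oppr0. Qed.
Lemma entry0 c t : entry c t 0 = 0.
Proof. by apply/matrixP => i j; rewrite !mxE if_same. Qed.
Lemma entry_sum c t (I : Type) (s : seq I) (P : pred I) (F : I -> R) :
  entry c t (\sum_(i <- s | P i) F i) = \sum_(i <- s | P i) entry c t (F i).
Proof. exact: (big_morph _ (@entryD c t) (@entry0 c t)). Qed.

Lemma entryM c t t' f r r' : t \in L ->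
  entry c t r * entry t' f r' = if t == t' then entry c f (r * r') else 0.
Proof.
move=> tL; apply/matrixP => i j; rewrite -[_ * _]/(_ *m _) mxE.
have ti : (index t L < size L)%N by rewrite index_mem.
rewrite (bigD1 (Ordinal ti)) //= big1 ?addr0 => [|l /eqP li].
  rewrite !mxE /= nth_index // eqxx andbT.
  case: (t == t') => /=; rewrite mxE ?mulr0 //.
  by case: (_ == c); case: (_ == f); rewrite /= ?(mulr0, mul0r).
rewrite !mxE; have [lt|_] := eqVneq (nth t0 L l) t; last by rewrite andbF mul0r.
by case: li; apply: val_inj; rewrite /= -lt index_uniq.
Qed.

Lemma entry_sum1 : \sum_(c <- L) entry c c 1 = 1.
Proof.
apply/matrixP => i j; rewrite summxE !mxE (bigD1_seq (nth t0 L i)) ?mem_nth //=.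
rewrite big1 => [|c /negPf ci]; last by rewrite mxE eq_sym ci.
by rewrite mxE eqxx /= addr0 eq_sym nth_uniq // val_eqE; case: (i == j).
Qed.

Lemma entry_out c t r : c \notin L -> entry c t r = 0.
Proof.
move=> cL; apply/matrixP => i j; rewrite !mxE ifN //; apply: contra cL => /andP[/eqP <- _].
exact: mem_nth.
Qed.

Lemma matrix_sum_entry (M : 'M[R]_(size L)) :
  M = \sum_(i < size L) \sum_(j < size L) entry (nth t0 L i) (nth t0 L j) (M i j).
Proof.
rewrite [LHS]matrix_sum_delta; apply: eq_bigr => i _; apply: eq_bigr => j _.
apply/matrixP => i' j'; rewrite !mxE !nth_uniq // !val_eqE.
by case: (_ && _); rewrite ?mulr1 ?mulr0.
Qed.

End IndexedMatrices.

Section MatrixRepresentation.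
Variables (k : fieldType) (p q : k) (KK : set k) (nn : {mset k}%mset).
Variables (K : bool -> set k) (nu : bool -> {mset k}%mset) (m : bool -> nat).
Variable col : k -> bool.
Hypothesis sep : separation p KK nn K nu m col.
Local Notation n := (m false + m true)%N.
Local Notation words := (vv_words KK nn n).
Local Notation wordsb b := (vv_words (K b) (nu b) (m b)).
Local Notation part := (colour_part col).
Local Notation colw := (map col).
Local Notation colours := (colours m).
Local Notation cnt b c := (count_mem b c).

Variables (R : pzRingType) (Dc : bool -> vv_data k R).
Hypothesis Dax : forall b, vv_axioms p q (K b) (nu b) (m b) (Dc b).
Hypothesis Dcomm : forall b, data_all (m b) (Dc b) (fun z =>
  data_all (m (~~ b)) (Dc (~~ b)) (fun z' => z * z' = z' * z)).
Local Notation X b := (dx (Dc b)).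
Local Notation S b := (ds (Dc b)).
Local Notation P b := (dp (Dc b)).
Local Notation E b := (de (Dc b)).
Local Notation N := (size colours).
Local Notation U := (@entry _ ([::] : seq bool) colours R).

Definition swap_colours l (c : seq bool) : seq bool :=
  take l c ++ nth false c l.+1 :: nth false c l :: drop l.+2 c.

Lemma swap_coloursE a u v d : swap_colours (size a) (a ++ u :: v :: d) = a ++ v :: u :: d.
Proof.
have dE : drop (size a).+2 (a ++ u :: v :: d) = d.
  by rewrite -2!cat_rcons drop_size_cat ?size_rcons.
by rewrite /swap_colours dE take_size_cat // !nth_cat ltnn subnn ltnNge leqnSn subSnn.
Qed.

Lemma swap_coloursK l c : (l.+1 < size c)%N -> swap_colours l (swap_colours l c) = c.
Proof. by move=> /split_at[a [u [v [d [-> <-]]]]]; rewrite !swap_coloursE. Qed.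

Lemma swap_colours_in l c : c \in colours -> (l.+1 < n)%N -> swap_colours l c \in colours.
Proof.
move=> cL; rewrite -(colours_size cL) => /split_at[a [u [v [d [cE <-]]]]].
by rewrite cE swap_coloursE -colours_swap -cE.
Qed.

(** Locked to prevent the unifier from splitting this product during rewriting
    with associativity. *)
Definition word_idem i : R := locked (E false (part false i) * E true (part true i)).

Lemma word_idem_def i : word_idem i = E false (part false i) * E true (part true i).
Proof. by rewrite /word_idem -lock. Qed.

(** The exchange at l permutes the colour words; it fixes those with equal
    colours at l and l + 1, where it acts through the generator of that
    colour. *)
Definition s_target l (c : seq bool) : seq bool :=
  if nth false c l == nth false c l.+1 then c else swap_colours l c.
Definition s_coef l (c : seq bool) : R :=
  let b := nth false c l in
  if b == nth false c l.+1 then S b (cnt b (take l c)) else 1.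
Definition x_coef l (c : seq bool) : R :=
  let b := nth false c l in X b (cnt b (take l c)).

(** The matrices of the generators, in the form in which they act on the
    columns: a generator at position l becomes the generator of the factor of
    that colour, at the rank of the position among the letters of this colour. *)
Definition matrix_data : vv_data k 'M[R]_N := VVData
  (fun l => \sum_(c <- colours) U c c (x_coef l c))
  (fun l => \sum_(c <- colours) U (s_target l c) c (s_coef l c))
  (\sum_(c <- colours) U c c (P (head false c)))
  (fun i => U (colw i) (colw i) (word_idem i)).
Local Notation x := (dx matrix_data).
Local Notation s := (ds matrix_data).
Local Notation pi := (dp matrix_data).
Local Notation e := (de matrix_data).

(** All matrices above are monomial, with one entry in each column. *)
Lemma mono_entry (g : seq bool -> seq bool) (y : seq bool -> R) c t r : c \in colours ->
  (\sum_(f <- colours) U (g f) f (y f)) * U c t r = U (g c) t (y c * r).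
Proof.
move=> cL; rewrite mulr_suml (bigD1_seq c) ?colours_uniq //= entryM ?colours_uniq // eqxx.
rewrite big1_seq ?addr0 // => f /andP[/negPf fc fL].
by rewrite entryM ?colours_uniq // fc.
Qed.

Lemma entry_mono (g : seq bool -> seq bool) (y : seq bool -> R) c f t r :
  c \in colours -> f \in colours -> g f = c ->
  (forall f', f' \in colours -> g f' = c -> f' = f) ->
  U t c r * (\sum_(f <- colours) U (g f) f (y f)) = U t f (r * y f).
Proof.
move=> cL fL gf gU; rewrite mulr_sumr (bigD1_seq f) ?colours_uniq //=.
rewrite entryM ?colours_uniq // gf eqxx big1_seq ?addr0 // => f' /andP[/eqP f'f f'L].
rewrite entryM ?colours_uniq //; case: eqP => // cE.
by case: f'f; apply: gU.
Qed.

Lemma nth_mid (a : seq bool) b d : nth false (a ++ b :: d) (size a) = b.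
Proof. by rewrite nth_cat ltnn subnn. Qed.

Lemma nth_midS (a : seq bool) b b' d : nth false (a ++ b :: b' :: d) (size a).+1 = b'.
Proof. by rewrite nth_cat ltnNge leqnSn subSnn. Qed.

Lemma x_entry a b d t r : a ++ b :: d \in colours ->
  x (size a) * U (a ++ b :: d) t r = U (a ++ b :: d) t (X b (cnt b a) * r).
Proof. by move=> cL; rewrite mono_entry // /x_coef nth_mid take_size_cat. Qed.

Lemma s_entry_same a b d t r : a ++ b :: b :: d \in colours ->
  s (size a) * U (a ++ b :: b :: d) t r = U (a ++ b :: b :: d) t (S b (cnt b a) * r).
Proof.
move=> cL; rewrite mono_entry // /s_target /s_coef nth_mid nth_midS eqxx.
by rewrite take_size_cat.
Qed.

Lemma s_entry_diff a u v d t r : u != v -> a ++ u :: v :: d \in colours ->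
  s (size a) * U (a ++ u :: v :: d) t r = U (a ++ v :: u :: d) t r.
Proof.
move=> uv cL; rewrite mono_entry // /s_target /s_coef nth_mid nth_midS (negPf uv).
by rewrite mul1r swap_coloursE.
Qed.

Lemma p_entry b d t r : b :: d \in colours ->
  pi * U (b :: d) t r = U (b :: d) t (P b * r).
Proof. by move=> cL; rewrite mono_entry. Qed.

Lemma entry_x a b d t r : a ++ b :: d \in colours ->
  U t (a ++ b :: d) r * x (size a) = U t (a ++ b :: d) (r * X b (cnt b a)).
Proof.
by move=> cL; rewrite (@entry_mono id _ _ (a ++ b :: d)) // /x_coef nth_mid take_size_cat.
Qed.

Lemma entry_p b d t r : b :: d \in colours ->
  U t (b :: d) r * pi = U t (b :: d) (r * P b).
Proof. by move=> cL; rewrite (@entry_mono id _ _ (b :: d)). Qed.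

Lemma entry_s a u v d t r : a ++ u :: v :: d \in colours ->
  U t (a ++ u :: v :: d) r * s (size a) =
  U t (a ++ v :: u :: d) (r * if u == v then S u (cnt u a) else 1).
Proof.
move=> cL; have c'L : a ++ v :: u :: d \in colours by rewrite -colours_swap.
rewrite (@entry_mono _ _ _ (a ++ v :: u :: d)) //.
- by rewrite /s_coef nth_mid nth_midS take_size_cat // eq_sym; case: eqP => // ->.
- by rewrite /s_target nth_mid nth_midS swap_coloursE; case: eqP => // ->.
move=> f fL; rewrite /s_target; case: eqP => fs fE.
  have uv : u = v by move: fs; rewrite fE nth_mid nth_midS.
  by rewrite fE uv.
have sf : ((size a).+1 < size f)%N.
  by rewrite (colours_size fL) -(colours_size cL) size_cat /= !addnS !ltnS leq_addr.
by rewrite -(swap_coloursK sf) fE swap_coloursE.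
Qed.

(** Restricting a matrix to a column that it preserves is multiplicative,
    which carries the right-hand sides of the relations from R to matrices. *)
Definition acts c (M : 'M[R]_N) (r : R) : Prop :=
  forall t z, M * U c t z = U c t (r * z).

Section Acts.
Variable c : seq bool.
Let acts0 : acts c 0 0. Proof. by move=> t z; rewrite !mul0r entry0. Qed.
Let acts1 : acts c 1 1. Proof. by move=> t z; rewrite !mul1r. Qed.
Let actsN M r : acts c M r -> acts c (- M) (- r).
Proof. by move=> H t z; rewrite !mulNr H entryN. Qed.
Let actsD M r M' r' : acts c M r -> acts c M' r' -> acts c (M + M') (r + r').
Proof. by move=> H H' t z; rewrite !mulrDl H H' entryD. Qed.
Let actsM M r M' r' : acts c M r -> acts c M' r' -> acts c (M * M') (r * r').
Proof. by move=> H H' t z; rewrite -!mulrA H' H. Qed.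

Lemma acts_sq_rhs K' u v M M' r r' : acts c M r -> acts c M' r' ->
  acts c (sq_rhs p K' u v M M') (sq_rhs p K' u v r r').
Proof. exact: (sq_rhs_related p K' acts0 acts1 actsN actsD actsM). Qed.
Lemma acts_br_rhs K' u v w M M' M'' r r' r'' :
  acts c M r -> acts c M' r' -> acts c M'' r'' ->
  acts c (br_rhs p K' u v w M M' M'') (br_rhs p K' u v w r r' r'').
Proof. exact: (br_rhs_related p K' acts0 acts1 actsN actsD actsM). Qed.
Lemma acts_psq_rhs u M r : acts c M r -> acts c (psq_rhs q u M) (psq_rhs q u r).
Proof. exact: (psq_rhs_related q acts1 actsN). Qed.
Lemma acts_sp_rhs u v M r : acts c M r -> acts c (sp_rhs q u v M) (sp_rhs q u v r).
Proof. exact: (sp_rhs_related q acts0 actsN). Qed.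

End Acts.

Section Commutation.
Variable b : bool.

Lemma XX_comm r r' : (r < m b)%N -> (r' < m (~~ b))%N ->
  X b r * X (~~ b) r' = X (~~ b) r' * X b r.
Proof. by have [HX _ _ _] := Dcomm b; move=> /HX[+ _ _ _]; apply. Qed.
Lemma XE_comm r w : (r < m b)%N -> X b r * E (~~ b) w = E (~~ b) w * X b r.
Proof. by have [HX _ _ _] := Dcomm b; move=> /HX[_ _ _]; apply. Qed.
Lemma SX_comm r r' : (r.+1 < m b)%N -> (r' < m (~~ b))%N ->
  S b r * X (~~ b) r' = X (~~ b) r' * S b r.
Proof. by have [_ HS _ _] := Dcomm b; move=> /HS[+ _ _ _]; apply. Qed.
Lemma SS_comm r r' : (r.+1 < m b)%N -> (r'.+1 < m (~~ b))%N ->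
  S b r * S (~~ b) r' = S (~~ b) r' * S b r.
Proof. by have [_ HS _ _] := Dcomm b; move=> /HS[_ + _ _]; apply. Qed.
Lemma SE_comm r w : (r.+1 < m b)%N -> S b r * E (~~ b) w = E (~~ b) w * S b r.
Proof. by have [_ HS _ _] := Dcomm b; move=> /HS[_ _ _]; apply. Qed.
Lemma PX_comm r' : (0 < m b)%N -> (r' < m (~~ b))%N ->
  P b * X (~~ b) r' = X (~~ b) r' * P b.
Proof. by have [_ _ HP _] := Dcomm b; move=> /HP[+ _ _ _]; apply. Qed.
Lemma PS_comm r' : (0 < m b)%N -> (r'.+1 < m (~~ b))%N ->
  P b * S (~~ b) r' = S (~~ b) r' * P b.
Proof. by have [_ _ HP _] := Dcomm b; move=> /HP[_ + _ _]; apply. Qed.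
Lemma PP_comm : (0 < m b)%N -> (0 < m (~~ b))%N ->
  P b * P (~~ b) = P (~~ b) * P b.
Proof. by have [_ _ HP _] := Dcomm b; move=> /HP[_ _ + _]; apply. Qed.
Lemma PE_comm w : (0 < m b)%N -> P b * E (~~ b) w = E (~~ b) w * P b.
Proof. by have [_ _ HP _] := Dcomm b; move=> /HP[_ _ _]; apply. Qed.
Lemma EE_comm w w' : E b w * E (~~ b) w' = E (~~ b) w' * E b w.
Proof. by have [_ _ _ HE] := Dcomm b; have [_ _ _] := HE w; apply. Qed.

Lemma word_idemE i : word_idem i = E b (part b i) * E (~~ b) (part (~~ b) i).
Proof. by rewrite word_idem_def; case: (b) EE_comm => //= ->. Qed.

Lemma word_idem_rel i z z' : z * E b (part b i) = z' * E b (part b i) ->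
  z * word_idem i = z' * word_idem i.
Proof. by move=> zz'; rewrite word_idemE !mulrA zz'. Qed.

Lemma part_in (i : seq k) u (j : seq k) : col u = b ->
  part b (i ++ u :: j) = part b i ++ u :: part b j.
Proof. by move=> ub; rewrite colour_part_cat /colour_part /= ub eqxx. Qed.

Lemma part_notin (i : seq k) u (j : seq k) : col u = ~~ b ->
  part b (i ++ u :: j) = part b i ++ part b j.
Proof. by move=> ub; rewrite colour_part_cat /colour_part /= ub negb_eqF. Qed.

Lemma rank_lt (i j : seq k) u : i ++ u :: j \in words -> col u = b ->
  (cnt b (colw i) < m b)%N.
Proof.
move=> iw ub; have /vv_wordsP[<- _ _] := word_part sep b iw.
by rewrite part_in // size_cat -size_colour_part /= addnS ltnS leq_addr.
Qed.

Lemma rank_ltS (i j : seq k) u v : i ++ u :: v :: j \in words ->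
  col u = b -> col v = b -> ((cnt b (colw i)).+1 < m b)%N.
Proof.
move=> iw ub vb; have := @rank_lt (i ++ [:: u]) j v.
rewrite -catA => /(_ iw vb); rewrite map_cat count_cat /= ub eqxx addn0.
by rewrite addn1.
Qed.

End Commutation.

Lemma word_idem_out i : i \notin words -> word_idem i = 0.
Proof.
rewrite (sep_words sep) negb_and word_idem_def.
by case/orP=> ni; rewrite (de_out (Dax _) ni) ?mul0r ?mulr0.
Qed.

Lemma e_out i : i \notin words -> e i = 0.
Proof. by move=> ni; rewrite /= word_idem_out ?entry0. Qed.

Lemma colour_cases (u v : k) : col v = col u \/ col v = ~~ col u.
Proof. by case: (col u) (col v) => -[]; [left|right|right|left]. Qed.

Lemma neg_neq b : b != ~~ b. Proof. by case: b. Qed.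

(** The relations are indexed by words in k rather than by colour words. Each
    proof below distinguishes the colours of the letters involved: equal
    colours give a relation of one factor, different colours a permutation of
    colour words, whose right-hand side is trivial by the separation, or a
    commutation between the factors. *)
Section WordActions.
Implicit Types (a d i : seq k) (u v w : k).
Local Notation rk b a := (size (part b a)).

Lemma eE i : e i = U (colw i) (colw i) (word_idem i). Proof. by []. Qed.

Lemma swap_word a u v d : a ++ u :: v :: d \in words -> a ++ v :: u :: d \in words.
Proof. by rewrite (vv_words_perm _ _ _ (perm_swap u v a d)). Qed.

Lemma x_word a u d : a ++ u :: d \in words ->
  acts (colw (a ++ u :: d)) (x (size a)) (X (col u) (rk (col u) a)).
Proof.
move=> iw t z; have := word_colours sep iw.
by rewrite size_colour_part -(size_map col) map_cat /= => /x_entry->.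
Qed.

Lemma xS_word a u v d : a ++ u :: v :: d \in words ->
  acts (colw (a ++ u :: v :: d)) (x (size a).+1) (X (col v) (rk (col v) (a ++ [:: u]))).
Proof. by move=> iw; have := @x_word (a ++ [:: u]) v d; rewrite -catA size_cat addn1; apply. Qed.

Lemma s_word b a u v d : a ++ u :: v :: d \in words -> col u = b -> col v = b ->
  acts (colw (a ++ u :: v :: d)) (s (size a)) (S b (rk b a)).
Proof.
move=> iw ub vb t z; have := word_colours sep iw.
by rewrite size_colour_part -(size_map col) map_cat /= ub vb => /s_entry_same->.
Qed.

Lemma s_swap a u v d t z : a ++ u :: v :: d \in words -> col v = ~~ col u ->
  s (size a) * U (colw (a ++ u :: v :: d)) t z = U (colw (a ++ v :: u :: d)) t z.
Proof.
move=> iw vu; have := word_colours sep iw.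
by rewrite -(size_map col) !map_cat /= => /s_entry_diff-> //; rewrite vu neg_neq.
Qed.

Lemma sS_word b a w u v d : a ++ w :: u :: v :: d \in words -> col u = b -> col v = b ->
  acts (colw (a ++ w :: u :: v :: d)) (s (size a).+1) (S b (rk b (a ++ [:: w]))).
Proof.
move=> iw ub vb; have := @s_word b (a ++ [:: w]) u v d.
by rewrite -catA size_cat addn1; apply.
Qed.

Lemma sS_swap a w u v d t z : a ++ w :: u :: v :: d \in words -> col v = ~~ col u ->
  s (size a).+1 * U (colw (a ++ w :: u :: v :: d)) t z =
  U (colw (a ++ w :: v :: u :: d)) t z.
Proof.
move=> iw vu; have := @s_swap (a ++ [:: w]) u v d t z.
by rewrite -!catA size_cat addn1; apply.
Qed.

Lemma p_word u d : u :: d \in words -> acts (colw (u :: d)) pi (P (col u)).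
Proof. by move=> /(word_colours sep) cL t z; apply: p_entry. Qed.

Lemma rk_in b a u : col u = b -> rk b (a ++ [:: u]) = (rk b a).+1.
Proof. by move=> ub; rewrite part_in // size_cat addn1. Qed.

Lemma rk_notin b a u : col u = ~~ b -> rk b (a ++ [:: u]) = rk b a.
Proof. by move=> ub; rewrite part_notin // cats0. Qed.

Lemma word_idem_swap a u v d : col v = ~~ col u ->
  word_idem (a ++ u :: v :: d) = word_idem (a ++ v :: u :: d).
Proof.
move=> vu; rewrite !word_idem_def; congr (E _ _ * E _ _);
  by rewrite colour_part_swap // vu; case: (col u).
Qed.

Lemma swapS_word a w u v d :
  a ++ w :: u :: v :: d \in words -> a ++ w :: v :: u :: d \in words.
Proof. by have := @swap_word (a ++ [:: w]) u v d; rewrite -!catA; apply. Qed.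

Lemma matrix_ds_ds a u v d (l := size a) :
  s l * s l * e (a ++ u :: v :: d) =
  sq_rhs p KK u v (x l) (x l.+1) * e (a ++ u :: v :: d).
Proof.
have [iw|/e_out->] := boolP (a ++ u :: v :: d \in words); last by rewrite !mulr0.
rewrite eE -mulrA; have [vu|vu] := colour_cases u v; last first.
  rewrite (sq_rhs_diff sep) ?mul1r ?vu ?neg_neq // s_swap //.
  by rewrite s_swap ?vu ?negbK //; apply: swap_word.
rewrite !(s_word iw erefl vu) (acts_sq_rhs _ _ _ (x_word iw) (xS_word iw)).
rewrite (sq_rhs_same sep _ _ erefl vu) vu rk_in // mulrA; congr entry.
by apply: (word_idem_rel (b := col u)); rewrite part_in // /colour_part /= vu eqxx (ds_ds (Dax _)).
Qed.

Lemma matrix_braid a u v w d (l := size a) (i := a ++ u :: v :: w :: d) :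
  s l.+1 * s l * s l.+1 * e i =
  s l * s l.+1 * s l * e i + br_rhs p KK u v w (x l) (x l.+1) (x l.+2) * e i.
Proof.
rewrite {}/i; have [iw|/e_out->] := boolP (a ++ u :: v :: w :: d \in words); last by rewrite !mulr0 addr0.
have iw1 := swap_word iw; have iw2 := swapS_word iw.
rewrite !eE -!mulrA; have [vu|vu] := colour_cases u v; last first.
  have uv : col u = ~~ col v by rewrite vu negbK.
  rewrite (br_rhs_diff sep) ?vu ?neg_neq // mul0r addr0.
  have [wv|wv] := colour_cases v w.
    rewrite (sS_word iw erefl wv) rk_notin // s_swap // sS_swap //; last by rewrite wv.
    rewrite s_swap // sS_swap ?wv // (s_word (swapS_word iw1) erefl) //.
  have wu : col w = col u by rewrite wv vu negbK.
  rewrite (sS_swap _ _ iw) // (s_word iw2 erefl) // sS_swap // ?wu //.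
  by rewrite s_swap // (sS_word iw1 erefl) // rk_notin // s_swap.
have [wv|wv] := colour_cases v w; last first.
  rewrite (br_rhs_diff sep) ?wv ?neg_neq ?orbT // mul0r addr0.
  have wu : col w = ~~ col u by rewrite wv vu.
  rewrite (sS_swap _ _ iw) // s_swap // (sS_word (swap_word iw2) erefl) // rk_notin ?wu ?negbK //.
  by rewrite (s_word iw erefl) // sS_swap // s_swap.
have wu : col w = col u by rewrite wv.
have x2 : acts (colw (a ++ u :: v :: w :: d)) (x l.+2) (X (col u) (rk (col u) a).+2).
  have <- : rk (col u) (a ++ [:: u; v]) = (rk (col u) a).+2.
    by rewrite part_in // /colour_part /= vu eqxx size_cat addn2.
  by have := @x_word (a ++ [:: u; v]) w d; rewrite -catA wu size_cat addn2; apply.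
rewrite !(sS_word iw vu wu) !(s_word iw erefl vu) !(sS_word iw vu wu) !(s_word iw erefl vu).
rewrite (acts_br_rhs _ _ _ _ (x_word iw) (xS_word iw) x2) -entryD rk_in // vu.
rewrite (br_rhs_same sep _ _ _ _ erefl vu) !mulrA -mulrDl; congr entry.
apply: (word_idem_rel (b := col u)); rewrite part_in // /colour_part /= vu wu eqxx mulrDl.
by rewrite rk_in // (ds_braid (Dax _)).
Qed.

Lemma rk_lt b a u d : a ++ u :: d \in words -> col u = b -> (rk b a < m b)%N.
Proof. by move=> iw ub; rewrite size_colour_part; apply: rank_lt iw ub. Qed.

Lemma rk_ltS b a u v d : a ++ u :: v :: d \in words -> col u = b -> col v = b ->
  ((rk b a).+1 < m b)%N.
Proof. by move=> iw ub vb; rewrite size_colour_part; apply: rank_ltS iw ub vb. Qed.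

Lemma rk_swap b a u v d : rk b (a ++ u :: v :: d) = rk b (a ++ v :: u :: d).
Proof. by rewrite !size_colour_part; apply/seq.permP/perm_map/perm_swap. Qed.

Lemma part2_in b a u v d : col u = b -> col v = b ->
  part b (a ++ u :: v :: d) = part b a ++ u :: v :: part b d.
Proof. by move=> ub vb; rewrite part_in // /colour_part /= vb eqxx. Qed.

Lemma entry_s_word a u v d t r : a ++ u :: v :: d \in words ->
  U t (colw (a ++ u :: v :: d)) r * s (size a) =
  U t (colw (a ++ v :: u :: d)) (r * if col u == col v then S (col u) (rk (col u) a) else 1).
Proof.
move=> /(word_colours sep); rewrite -(size_map col) !map_cat size_colour_part /=.
exact: entry_s.
Qed.

Lemma entry_x_word a u d t r : a ++ u :: d \in words ->
  U t (colw (a ++ u :: d)) r * x (size a) =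
  U t (colw (a ++ u :: d)) (r * X (col u) (rk (col u) a)).
Proof.
move=> /(word_colours sep); rewrite -(size_map col) !map_cat size_colour_part /=.
exact: entry_x.
Qed.

Lemma matrix_ds_de a u v d :
  s (size a) * e (a ++ u :: v :: d) = e (a ++ v :: u :: d) * s (size a).
Proof.
have [iw|nw] := boolP (a ++ u :: v :: d \in words); last first.
  rewrite !e_out ?mulr0 ?mul0r //; apply: contra nw; exact: swap_word.
have iw' := swap_word iw; rewrite !eE entry_s_word //.
have [vu|vu] := colour_cases u v; last first.
  by rewrite vu eq_sym (negPf (neg_neq _)) s_swap // mulr1 word_idem_swap.
rewrite vu eqxx (s_word iw erefl vu).
have -> : colw (a ++ v :: u :: d) = colw (a ++ u :: v :: d) by rewrite !map_cat /= vu.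
congr entry; rewrite !(word_idemE (col u)) -mulrA -SE_comm ?(rk_ltS iw erefl vu) //.
rewrite !mulrA !(@part2_in (col u)) // (ds_de (Dax _)) colour_part_swap //.
by rewrite vu; case: (col u).
Qed.

Lemma matrix_dx_de l i : (l < size i)%N -> x l * e i = e i * x l.
Proof.
move=> /split_at1[a [u [d [-> <-]]]].
have [iw|nw] := boolP (a ++ u :: d \in words); last by rewrite e_out ?mulr0 ?mul0r.
rewrite eE (x_word iw) entry_x_word //; congr entry.
rewrite (word_idemE (col u)) -mulrA -XE_comm ?(rk_lt iw) // !mulrA (dx_de (Dax _)) //.
by rewrite part_in // size_cat /= addnS ltnS leq_addr.
Qed.

Lemma X_X_idem b b' r r' i : (r < size (part b i))%N -> (r' < size (part b' i))%N ->
  i \in words -> X b r * X b' r' * word_idem i = X b' r' * X b r * word_idem i.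
Proof.
move=> ri r'i iw; have [bE|bE] : b' = b \/ b' = ~~ b by case: b b' {ri r'i} => -[]; auto.
  by rewrite bE in r'i *; apply: (word_idem_rel (b := b)); apply: (dx_dx (Dax _)).
rewrite bE in r'i *; congr (_ * _); apply: XX_comm.
  by case/vv_wordsP: (word_part sep b iw) => <-.
by case/vv_wordsP: (word_part sep (~~ b) iw) => <-.
Qed.

Lemma matrix_dx_dx l l' i : (l < size i)%N -> (l' < size i)%N ->
  x l * x l' * e i = x l' * x l * e i.
Proof.
move=> li l'i; have [iw|nw] := boolP (i \in words); last by rewrite e_out ?mulr0.
have [a [u [d [iE la]]]] := split_at1 li; have [a' [u' [d' [iE' la']]]] := split_at1 l'i.
have Hx : acts (colw i) (x l) (X (col u) (rk (col u) a)).
  by rewrite -la iE; apply: x_word; rewrite -iE.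
have Hx' : acts (colw i) (x l') (X (col u') (rk (col u') a')).
  by rewrite -la' iE'; apply: x_word; rewrite -iE'.
rewrite eE -!mulrA Hx' Hx Hx Hx'; congr entry; rewrite !mulrA.
apply: X_X_idem => //; first by rewrite iE part_in // size_cat /= addnS ltnS leq_addr.
by rewrite iE' part_in // size_cat /= addnS ltnS leq_addr.
Qed.

Section Far.
Variables (a f g : seq k).
Let l' := (size a + (size f).+2)%N.

Lemma far_acts b u v u' v' : a ++ u :: v :: f ++ u' :: v' :: g \in words ->
  col u' = b -> col v' = b ->
  acts (colw (a ++ u :: v :: f ++ u' :: v' :: g)) (s l') (S b (rk b (a ++ u :: v :: f))).
Proof.
move=> iw ub vb; have := @s_word b (a ++ u :: v :: f) u' v' g.
by rewrite -catA /= size_cat /=; apply.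
Qed.

Lemma far_swap u v u' v' t z : a ++ u :: v :: f ++ u' :: v' :: g \in words ->
  col v' = ~~ col u' ->
  s l' * U (colw (a ++ u :: v :: f ++ u' :: v' :: g)) t z =
  U (colw (a ++ u :: v :: f ++ v' :: u' :: g)) t z.
Proof.
move=> iw vu; have := @s_swap (a ++ u :: v :: f) u' v' g t z.
by rewrite -!catA /= size_cat /=; apply.
Qed.

Lemma far_swap_word u v u' v' : a ++ u :: v :: f ++ u' :: v' :: g \in words ->
  a ++ u :: v :: f ++ v' :: u' :: g \in words.
Proof.
by have := @swap_word (a ++ u :: v :: f) u' v' g; rewrite -!catA /=; apply.
Qed.

Lemma matrix_ds_far u v u' v' (l := size a) (i := a ++ u :: v :: f ++ u' :: v' :: g) :
  s l * s l' * e i = s l' * s l * e i.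
Proof.
rewrite {}/i; have [iw|/e_out->] := boolP (a ++ u :: v :: f ++ u' :: v' :: g \in words); last by rewrite !mulr0.
have iw1 := swap_word iw; have iw2 := far_swap_word iw.
rewrite eE -!mulrA; have [vu|vu] := colour_cases u v; have [vu'|vu'] := colour_cases u' v'.
- rewrite (s_word iw erefl vu) !(far_acts iw erefl vu') (s_word iw erefl vu).
  congr entry; rewrite !mulrA; have [uu|uu] := colour_cases u u'; last first.
    congr (_ * _); rewrite uu; apply: SS_comm; first exact: rk_ltS iw erefl vu.
    apply: (@rk_ltS _ (a ++ u :: v :: f) u' v' g); rewrite -?catA //.
    by rewrite vu'.
  rewrite uu; apply: (word_idem_rel (b := col u)); rewrite !(@part2_in (col u)) ?vu ?vu' ?uu //.
  by rewrite size_cat /=; apply: (ds_far (Dax _)).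
- rewrite far_swap // !(s_word iw erefl vu) (s_word iw2 erefl vu).
  by rewrite far_swap.
- rewrite s_swap // !(far_acts iw erefl vu') (far_acts iw1 erefl vu') s_swap //.
  by rewrite rk_swap.
- by rewrite far_swap // !s_swap // far_swap.
Qed.

End Far.

Lemma matrix_dxl a u v d (l := size a) (i := a ++ u :: v :: d) :
  s l * x l * e i = x l.+1 * s l * e i - (if u == v then e i else 0).
Proof.
rewrite {}/i; have [iw|/e_out->] := boolP (a ++ u :: v :: d \in words); last first.
  by rewrite !mulr0 if_same subr0.
rewrite eE -!mulrA; have [vu|vu] := colour_cases u v; last first.
  have -> : (u == v) = false by apply/eqP => uv; move: vu; rewrite uv => /eqP; rewrite (negPf (neg_neq _)).
  by rewrite subr0 (x_word iw) !s_swap // (xS_word (swap_word iw)) rk_notin.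
rewrite (x_word iw) !(s_word iw erefl vu) (xS_word iw) vu rk_in //.
have -> : (if u == v then U (colw (a ++ u :: v :: d)) (colw (a ++ u :: v :: d)) (word_idem (a ++ u :: v :: d)) else 0) =
    U (colw (a ++ u :: v :: d)) (colw (a ++ u :: v :: d)) ((if u == v then 1 else 0) * word_idem (a ++ u :: v :: d)).
  by case: ifP => _; rewrite ?mul1r ?mul0r ?entry0.
rewrite -entryN -entryD !mulrA -mulrBl; congr entry.
apply: (word_idem_rel (b := col u)); rewrite part2_in // (ds_dxl (Dax _)) mulrBl.
by case: ifP => _; rewrite ?mul1r ?mul0r.
Qed.

Lemma matrix_dxr a u v d (l := size a) (i := a ++ u :: v :: d) :
  s l * x l.+1 * e i = x l * s l * e i + (if u == v then e i else 0).
Proof.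
rewrite {}/i; have [iw|/e_out->] := boolP (a ++ u :: v :: d \in words); last first.
  by rewrite !mulr0 if_same addr0.
rewrite eE -!mulrA; have [vu|vu] := colour_cases u v; last first.
  have -> : (u == v) = false by apply/eqP => uv; move: vu; rewrite uv => /eqP; rewrite (negPf (neg_neq _)).
  rewrite addr0 (xS_word iw) !s_swap // (x_word (swap_word iw)) rk_notin //.
  by rewrite vu negbK.
rewrite (xS_word iw) !(s_word iw erefl vu) (x_word iw) vu rk_in //.
have -> : (if u == v then U (colw (a ++ u :: v :: d)) (colw (a ++ u :: v :: d)) (word_idem (a ++ u :: v :: d)) else 0) =
    U (colw (a ++ u :: v :: d)) (colw (a ++ u :: v :: d)) ((if u == v then 1 else 0) * word_idem (a ++ u :: v :: d)).
  by case: ifP => _; rewrite ?mul1r ?mul0r ?entry0.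
rewrite -entryD !mulrA -mulrDl; congr entry.
apply: (word_idem_rel (b := col u)); rewrite part2_in // (ds_dxr (Dax _)) mulrDl.
by case: ifP => _; rewrite ?mul1r ?mul0r.
Qed.

Lemma X_S_idem b b' r r' i : (r.+1 < size (part b i))%N -> (r' < size (part b' i))%N ->
  (b' = b -> r' != r /\ r' != r.+1) -> i \in words ->
  S b r * X b' r' * word_idem i = X b' r' * S b r * word_idem i.
Proof.
move=> ri r'i rr' iw; have [bE|bE] : b' = b \/ b' = ~~ b by case: b b' {ri r'i rr'} => -[]; auto.
  have [f [u [v [g [iE sf]]]]] := split_at ri; have [n1 n2] := rr' bE.
  rewrite bE in r'i *; apply: (word_idem_rel (b := b)).
  by rewrite iE -sf; apply: (ds_dx (Dax _)); rewrite -?iE ?sf.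
rewrite bE in r'i *; congr (_ * _); apply: SX_comm.
  by case/vv_wordsP: (word_part sep b iw) => <-.
by case/vv_wordsP: (word_part sep (~~ b) iw) => <-.
Qed.

Lemma matrix_ds_dx a u v d j (l := size a) (i := a ++ u :: v :: d) :
  (j < size i)%N -> j != l -> j != l.+1 ->
  s l * x j * e i = x j * s l * e i.
Proof.
rewrite {}/i => ji jl jl'; have [iw|/e_out->] := boolP (a ++ u :: v :: d \in words); last by rewrite !mulr0.
have iw' := swap_word iw; have [a0 [w [d0 [iE ja]]]] := split_at1 ji.
(* An exchange at other positions does not affect the letter at position j
   nor its rank among the letters of its colour. *)
have [d0' iE' rkE] : exists2 a0' , exists d0', a ++ v :: u :: d = a0' ++ w :: d0' &
    size a0' = j /\ forall b, rk b a0' = rk b a0.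
  move: iE jl jl'; rewrite -ja => /cat_cases[[t [a0E]]|[t [aE]]].
    case: t a0E => [|y [|y' t]] a0E /=.
    - by move=> _; rewrite a0E cats0 eqxx.
    - by move=> _ _; rewrite a0E size_cat addn1 eqxx.
    case=> yE y'E dE _ _; exists (a ++ v :: u :: t).
      by exists d0; rewrite dE -catA.
    by rewrite a0E -yE -y'E !size_cat; split=> // b; rewrite rk_swap.
  case: t aE => [|y t] aE; first by move=> _; rewrite /l aE cats0 eqxx.
  case=> wE d0E _ _; exists a0; last by [].
  by exists (t ++ v :: u :: d); rewrite aE wE -catA.
case: rkE iE' => ja' rkE [d1 iE'].
have Hx : acts (colw (a ++ u :: v :: d)) (x j) (X (col w) (rk (col w) a0)).
  by rewrite -ja iE; apply: x_word; rewrite -iE.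
have Hx' : acts (colw (a ++ v :: u :: d)) (x j) (X (col w) (rk (col w) a0)).
  by rewrite -rkE -ja' iE'; apply: x_word; rewrite -iE'.
rewrite eE -!mulrA; have [vu|vu] := colour_cases u v; last first.
  by rewrite Hx !s_swap // Hx'.
rewrite Hx !(s_word iw erefl vu) Hx !mulrA; congr entry.
apply: X_S_idem => //.
- by rewrite part2_in // size_cat /= !addnS !ltnS leq_addr.
- by rewrite iE part_in // size_cat /= addnS ltnS leq_addr.
- move=> wu; move: iE jl jl'; rewrite -ja wu => /cat_cases[[t [a0E]]|[t [aE]]].
    case: t a0E => [|y [|y' t]] a0E /=.
    - by move=> _ /eqP[]; rewrite a0E cats0.
    - by move=> _ _ /eqP[]; rewrite a0E size_cat addn1.
    case=> yE y'E _ _ _; rewrite a0E -yE -y'E part2_in // size_cat /= !addnS.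
    by rewrite !gtn_eqF ?ltnS ?leqW ?leq_addr.
  case: t aE => [|y t] aE; first by move=> _ /eqP[]; rewrite /l aE cats0.
  case=> wE _ _ _; rewrite aE -wE part_in // size_cat /= addnS.
  by rewrite !ltn_eqF ?ltnS ?leqW ?leq_addr.
Qed.

Lemma rk_gt0 u d : u :: d \in words -> (0 < m (col u))%N.
Proof. by move=> iw; apply: leq_trans (@rk_lt (col u) [::] u d iw erefl). Qed.

Lemma part_cons b u d : col u = b -> part b (u :: d) = u :: part b d.
Proof. exact: (@part_in b [::]). Qed.

Lemma matrix_dp_de u d : pi * e (u :: d) = e (u^-1 :: d) * pi.
Proof.
rewrite !eE [colw (u^-1 :: d)]/= (sep_inv sep) -[col u :: _]/(colw (u :: d)).
have [cL|cL] := boolP (colw (u :: d) \in colours); last by rewrite !entry_out // mulr0 mul0r.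
rewrite [in LHS]p_entry // [in RHS]entry_p //; congr entry.
have m0 : (0 < m (col u))%N by have /coloursP <- := cL; rewrite /= eqxx.
rewrite !(word_idemE (col u)) -[RHS]mulrA -PE_comm // !mulrA.
rewrite !(@part_cons (col u)) ?(sep_inv sep) // (dp_de (Dax _)).
by rewrite /colour_part /= (sep_inv sep) (negPf (neg_neq _)).
Qed.

Lemma x0_word u d : u :: d \in words -> acts (colw (u :: d)) (x 0) (X (col u) 0).
Proof. exact: (@x_word [::]). Qed.

Lemma matrix_dp_dp u d :
  pi * pi * e (u :: d) = psq_rhs q u (x 0) * e (u :: d).
Proof.
have [iw|/e_out->] := boolP (u :: d \in words); last by rewrite !mulr0.
rewrite eE -mulrA !(p_word iw) (acts_psq_rhs _ (x0_word iw)) mulrA; congr entry.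
by apply: (word_idem_rel (b := col u)); rewrite part_cons // (dp_dp (Dax _)).
Qed.

Lemma matrix_dp_dx0 u d : pi * x 0 * e (u :: d) = - (x 0 * pi * e (u :: d)).
Proof.
have [iw|/e_out->] := boolP (u :: d \in words); last by rewrite !mulr0 oppr0.
rewrite eE -!mulrA !(p_word iw) !(x0_word iw) (p_word iw) -entryN !mulrA -mulNr; congr entry.
apply: (word_idem_rel (b := col u)); rewrite part_cons // (dp_dx0 (Dax _)).
by rewrite mulNr.
Qed.

Lemma matrix_dp_dx j u d : (j < size d)%N ->
  pi * x j.+1 * e (u :: d) = x j.+1 * pi * e (u :: d).
Proof.
move=> /split_at1[a [w [d' [dE <-]]]].
have [iw|/e_out->] := boolP (u :: d \in words); last by rewrite !mulr0.
have Hx : acts (colw (u :: d)) (x (size a).+1) (X (col w) (rk (col w) (u :: a))).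
  by rewrite dE; apply: (@x_word (u :: a)); rewrite -[_ ++ _]/(u :: a ++ w :: d') -dE.
rewrite eE -!mulrA (p_word iw) !Hx (p_word iw) !mulrA; congr entry.
have [wu|wu] := colour_cases u w.
  apply: (word_idem_rel (b := col u)); rewrite wu !part_cons // (dp_dx (Dax _)) //.
  by rewrite dE part_in // size_cat /= addnS ltnS leq_addr.
congr (_ * _); rewrite wu; apply: PX_comm; first exact: rk_gt0 iw.
by apply: (@rk_lt _ (u :: a) w d'); rewrite // /= -dE.
Qed.

Lemma s0_word u v d : u :: v :: d \in words -> col v = col u ->
  acts (colw (u :: v :: d)) (s 0) (S (col u) 0).
Proof. by move=> iw vu; apply: (@s_word (col u) [::] u v d). Qed.

Lemma s0_swap u v d t z : u :: v :: d \in words -> col v = ~~ col u ->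
  s 0 * U (colw (u :: v :: d)) t z = U (colw (v :: u :: d)) t z.
Proof. exact: (@s_swap [::]). Qed.

Lemma matrix_ds_dp u v d (i := u :: v :: d) :
  s 0 * pi * s 0 * pi * e i = pi * s 0 * pi * s 0 * e i + sp_rhs q u v (s 0) * e i.
Proof.
rewrite {}/i; have [iw|/e_out->] := boolP (u :: v :: d \in words); last by rewrite !mulr0 addr0.
rewrite eE -!mulrA; have [vu|vu] := colour_cases u v; last first.
  have iw' : v :: u :: d \in words by apply: (@swap_word [::]).
  rewrite (sp_rhs_diff q sep) ?vu ?neg_neq // mul0r addr0 (p_word iw) !(s0_swap _ _ iw) //.
  rewrite !(p_word iw') !(s0_swap _ _ iw') ?vu ?negbK // (p_word iw) !mulrA; congr entry.
  have := rk_gt0 iw'; rewrite vu => m1.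
  by rewrite -PP_comm // (rk_gt0 iw).
have H0 := s0_word iw vu; have Hp := p_word iw.
rewrite Hp H0 Hp H0 H0 Hp H0 Hp (acts_sp_rhs _ _ H0) -entryD !mulrA -mulrDl; congr entry.
apply: (word_idem_rel (b := col u)); rewrite part_cons // part_cons // mulrDl.
exact: (ds_dp (Dax _)).
Qed.

Lemma matrix_dp_ds a w u v d (l := (size a).+1) (i := w :: a ++ u :: v :: d) :
  pi * s l * e i = s l * pi * e i.
Proof.
rewrite {}/i; have [iw|/e_out->] := boolP (w :: a ++ u :: v :: d \in words); last by rewrite !mulr0.
rewrite eE -!mulrA; have [vu|vu] := colour_cases u v; last first.
  have sw t z : s l * U (colw (w :: a ++ u :: v :: d)) t z = U (colw (w :: a ++ v :: u :: d)) t z.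
    exact: (@s_swap (w :: a)).
  rewrite (p_word iw) !sw p_word //.
  by have := @swap_word (w :: a) u v d; apply.
have Hs : acts (colw (w :: a ++ u :: v :: d)) (s l) (S (col u) (rk (col u) (w :: a))).
  exact: (@s_word (col u) (w :: a) u v d).
rewrite (p_word iw) !Hs (p_word iw) !mulrA; congr entry.
have [uw|uw] := colour_cases w u.
  apply: (word_idem_rel (b := col w)); rewrite uw !part_cons // part2_in ?vu //.
  exact: (dp_ds (Dax _)).
congr (_ * _); rewrite uw; apply: PS_comm; first exact: rk_gt0 iw.
by apply: (@rk_ltS _ (w :: a) u v d); rewrite ?vu.
Qed.

Lemma matrix_de_de i j : e i * e j = if i == j then e i else 0.
Proof.
have [iw|/e_out ei] := boolP (i \in words); last by rewrite ei mul0r if_same.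
rewrite !eE entryM ?colours_uniq ?(word_colours sep) //.
case: (eqVneq (colw i) (colw j)) => [ij|ij]; last first.
  by case: eqP => // ij'; rewrite ij' eqxx in ij.
have -> : word_idem i * word_idem j = if i == j then word_idem i else 0.
  rewrite !word_idem_def mulrA -(mulrA (E false _)) -(EE_comm false) !mulrA (de_de (Dax _)).
  rewrite -!mulrA (de_de (Dax _)); case: (eqVneq i j) => [<-|nij]; first by rewrite !eqxx.
  case: eqP => [pf|_]; last by rewrite mul0r.
  case: eqP => [pt|_]; last by rewrite mulr0.
  by case/eqP: nij; apply: colour_parts_inj ij pf pt.
by rewrite -ij; case: ifP => _; rewrite ?entry0.
Qed.

Lemma word_join (c : seq bool) (w w' : seq k) : c \in colours -> w \in wordsb false -> w' \in wordsb true ->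
  exists i, [/\ colw i = c, part false i = w & part true i = w'].
Proof.
move=> /coloursP cL /[dup] /(sep_col sep) wb /vv_wordsP[sw _ _].
move=> /[dup] /(sep_col sep) wb' /vv_wordsP[sw' _ _].
move: (cL false) (cL true); rewrite -{}sw -{}sw' {cL}; elim: c w w' wb wb' => [|b c IHc] w w' wb wb' /=.
  by move=> /esym/size0nil-> /esym/size0nil->; exists [::].
case: b => /=; rewrite !(add0n, add1n).
  case: w' wb' => //= v w' /andP[/eqP vb wb'] c1 [c2].
  have [i [ic i1 i2]] := IHc w w' wb wb' c1 c2; exists (v :: i).
  by rewrite /colour_part /= vb eqxx -i1 -i2 ic.
case: w wb => //= v w /andP[/eqP vb wb] [c1] c2.
have [i [ic i1 i2]] := IHc w w' wb wb' c1 c2; exists (v :: i).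
by rewrite /colour_part /= vb eqxx -i1 -i2 ic.
Qed.

(** The words with colour word c correspond to pairs of words of the two
    factors, so the sum is the product of the two units. *)
Lemma colour_sum c : c \in colours -> \sum_(i <- words | colw i == c) word_idem i = 1.
Proof.
move=> cL; pose parts i := (part false i, part true i).
rewrite -big_filter; under eq_bigr => i _ do rewrite word_idem_def.
rewrite -(big_map parts predT (fun ww => E false ww.1 * E true ww.2)).
rewrite (perm_big (allpairs pair (wordsb false) (wordsb true))).
  rewrite big_allpairs /=; under eq_bigr => w _ do rewrite -mulr_sumr (de_sum (Dax true)) mulr1.
  exact: de_sum (Dax false).
apply: uniq_perm.
- rewrite map_inj_in_uniq ?filter_uniq ?vv_words_uniq // => i j.
  rewrite !mem_filter => /andP[/eqP ic _] /andP[/eqP jc _] [pf pt].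
  by apply: colour_parts_inj pf pt; rewrite ic jc.
- by rewrite allpairs_uniq ?vv_words_uniq // => -[? ?] [? ?].
move=> [w w']; apply/mapP/allpairsP => [[i]|[[v v'] /= [vw vw' [-> ->]]]].
  rewrite mem_filter => /andP[_ iw] [-> ->].
  by exists (part false i, part true i); split=> //; apply: (word_part sep).
have [i [ic pf pt]] := word_join cL vw vw'; exists i; last by rewrite /parts pf pt.
by rewrite mem_filter ic eqxx (sep_words sep) pf pt vw vw'.
Qed.

Lemma matrix_de_sum : \sum_(i <- words) e i = 1.
Proof.
rewrite -(entry_sum1 [::] R (colours_uniq m)) big_seq.
rewrite [RHS]big_seq; under [RHS]eq_bigr => c cL do rewrite -(colour_sum cL) entry_sum.
rewrite -big_seq -[RHS]big_seq (exchange_big_dep predT) //=.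
rewrite big_seq [RHS]big_seq; apply: eq_bigr => i iw.
rewrite big_mkcond (bigD1_seq (colw i)) ?colours_uniq ?(word_colours sep) //= eqxx.
by rewrite big1 ?addr0 // => c /negPf ci; rewrite eq_sym ci.
Qed.

End WordActions.

Lemma matrix_axioms : vv_axioms p q KK nn n matrix_data.
Proof.
split.
- exact: e_out.
- exact: matrix_de_de.
- exact: matrix_de_sum.
- exact: matrix_ds_de.
- exact: matrix_dx_de.
- exact: matrix_dx_dx.
- exact: matrix_ds_ds.
- by move=> a u v b u' v' c; apply: matrix_ds_far.
- exact: matrix_braid.
- exact: matrix_dxl.
- exact: matrix_dxr.
- exact: matrix_ds_dx.
- exact: matrix_dp_de.
- exact: matrix_dp_dp.
- exact: matrix_dp_dx0.
- by move=> j u d; apply: matrix_dp_dx.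
- exact: matrix_ds_dp.
- exact: matrix_dp_ds.
Qed.

End MatrixRepresentation.

(** * The isomorphism with a matrix algebra *)

Section DataImage.
Variables (k : fieldType) (p q : k) (K : set k) (nu : {mset k}%mset) (m : nat).
Variables (C C' : pzRingType) (f : {rmorphism C -> C'}).

Definition data_image (D : vv_data k C) : vv_data k C' :=
  VVData (fun l => f (dx D l)) (fun l => f (ds D l)) (f (dp D)) (fun a => f (de D a)).

Lemma vv_axioms_image D : vv_axioms p q K nu m D -> vv_axioms p q K nu m (data_image D).
Proof.
have fif (t : bool) z : (if t then f z else 0) = f (if t then z else 0).
  by case: t; rewrite ?rmorph0.
move=> ax; split=> /=; intros; rewrite ?fif -?sq_rhs_morph -?br_rhs_morph
  -?psq_rhs_morph -?sp_rhs_morph -?(rmorph1, rmorph_sum, rmorphM, rmorphD, rmorphB, rmorphN) /=.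
- by rewrite (de_out ax) ?rmorph0.
- by rewrite (de_de ax).
- by rewrite -rmorph_sum (de_sum ax) rmorph1.
- by rewrite (ds_de ax).
- by rewrite (dx_de ax).
- by rewrite (dx_dx ax).
- by rewrite (ds_ds ax).
- by rewrite (ds_far ax).
- by rewrite (ds_braid ax).
- by rewrite (ds_dxl ax).
- by rewrite (ds_dxr ax).
- by rewrite (ds_dx ax).
- by rewrite (dp_de ax).
- by rewrite (dp_dp ax).
- by rewrite (dp_dx0 ax).
- by rewrite (dp_dx ax).
- by rewrite (ds_dp ax).
- by rewrite (dp_ds ax).
Qed.

End DataImage.

Lemma data_all_sym (k : fieldType) (C C' : Type) (D : vv_data k C) (D' : vv_data k C')
    m m' (Q : C -> C' -> Prop) :
  data_all m D (fun z => data_all m' D' (Q z)) ->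
  data_all m' D' (fun z' => data_all m D (fun z => Q z z')).
Proof.
case=> hx hs hp he.
split=> [r rm|r rm|rm|w].
- by split=> [r' /hx|r' /hs|/hp|w']; [case=> + _ _ _..|have [+ _ _ _] := he w']; apply.
- by split=> [r' /hx|r' /hs|/hp|w']; [case=> _ + _ _..|have [_ + _ _] := he w']; apply.
- by split=> [r' /hx|r' /hs|/hp|w']; [case=> _ _ + _..|have [_ _ + _] := he w']; apply.
- by split=> [r' /hx|r' /hs|/hp|w']; [case=> _ _ _ +..|have [_ _ _ +] := he w']; apply.
Qed.

Lemma data_all_map (k : fieldType) (C C' : Type) (D : vv_data k C) (D' : vv_data k C')
    m (f : C -> C') (Q : C' -> Prop) :
  data_map m D D' f -> data_all m D' Q -> data_all m D (fun z => Q (f z)).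
Proof.
by move=> [fx fs fp fe] [hx hs hp he]; split=> *; rewrite ?fx ?fs ?fp ?fe //; auto.
Qed.

Section Assembly.
Variables (k : fieldType) (p q : k) (KK : set k) (nn : {mset k}%mset).
Variables (K : bool -> set k) (nu : bool -> {mset k}%mset) (m : bool -> nat).
Variable col : k -> bool.
Hypothesis sep : separation p KK nn K nu m col.
Local Notation n := (m false + m true)%N.
Local Notation words := (vv_words KK nn n).
Local Notation part := (colour_part col).
Local Notation colw := (map col).
Local Notation colours := (colours m).
Local Notation cs := (sorted_colours m).
Local Notation N := (size colours).

Variables (W : kalg k) (D : vv_data k W).
Hypothesis DW : vv_presents p q KK nn n D.
Variables (A : bool -> kalg k) (DA : forall b, vv_data k (A b)).
Hypothesis DAP : forall b, vv_presents p q (K b) (nu b) (m b) (DA b).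
Local Notation R := (tensor_kalg (A false) (A true)).

Definition factor b : khom (A b) R :=
  match b with
  | false => tensor_inl_khom (A false) (A true)
  | true => tensor_inr_khom (A false) (A true)
  end.

Definition factor_data b : vv_data k R := data_image (factor b) (DA b).

Lemma factor_axioms b : vv_axioms p q (K b) (nu b) (m b) (factor_data b).
Proof. exact: vv_axioms_image (presents_axioms (DAP b)). Qed.

Lemma factorC b a a' : factor b a * factor (~~ b) a' = factor (~~ b) a' * factor b a.
Proof. by case: b a a' => a a' /=; rewrite tensor_inC. Qed.

Lemma factor_comm b : data_all (m b) (factor_data b) (fun z =>
  data_all (m (~~ b)) (factor_data (~~ b)) (fun z' => z * z' = z' * z)).
Proof. by split=> *; split=> *; apply: factorC. Qed.

Let ax := presents_axioms DW.
Local Notation part_data b := (part_data KK nn m col D b).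

(** The families of the two colours satisfy the relations and commute. *)
Lemma tensor_to_W : exists Phi : khom R W,
  forall b, data_map (m b) (factor_data b) (part_data b) Phi.
Proof.
have [f fD] := presents_lift (DAP false) (part_axioms sep ax false).
have [g gD] := presents_lift (DAP true) (part_axioms sep ax true).
have fg a b : g b * f a = f a * g b.
  move: b; apply: (presents_ind (DAP true)); first exact: subalgebra_commutant.
  apply: (data_all_map (Q := fun z => z * f a = f a * z) gD).
  have /data_all_sym comm := part_comm sep ax false.
  have Q z : data_all (m false) (part_data false) (fun z' => z' * z = z * z') ->
      forall a, f a * z = z * f a.
    move=> Hz; apply: (presents_ind (DAP false)); first exact: subalgebra_commutant.
    exact: (data_all_map fD Hz).
  case: comm => hx hs hp he.
  by split=> *; apply/esym/Q; auto.
have [Phi [Phil Phir]] := tensor_lift fg.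
exists Phi => -[].
  by case: gD => gx gs gp ge; split=> *; rewrite /= Phir; auto.
by case: fD => fx fs fp fe; split=> *; rewrite /= Phil; auto.
Qed.

(** Both families lie in the commutant of the matrix units, which is a
    subalgebra. *)
Lemma tensor_W_commute (Phi : khom R W) :
  (forall b, data_map (m b) (factor_data b) (part_data b) Phi) ->
  forall r, units_commute KK nn m col D (Phi r).
Proof.
move=> PhiD.
have alg (B : kalg k) (h : khom B W) : subalgebra (fun a => units_commute KK nn m col D (h a)).
  split=> [c|a a' ha ha'|a a' ha ha'].
  - by move=> d d' _ _; rewrite khom_emb kalg_embC.
  - by rewrite rmorphD; apply: units_commuteD.
  - by rewrite rmorphM; apply: units_commuteM.
have fac b a : units_commute KK nn m col D (Phi (factor b a)).
  move: a; apply: (presents_ind (DAP b)); first exact: (alg _ (khom_comp Phi (factor b))).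
  have := data_all_map (PhiD b) (part_commute sep ax b).
  by case=> hx hs hp he; split.
apply: tensor_ind; first exact: alg.
  exact: (fac false).
exact: (fac true).
Qed.

Lemma W_to_matrix : exists Psi : khom W (mx_kalg R N),
  data_map n D (matrix_data m col factor_data) Psi.
Proof.
exact: (presents_lift DW (C := mx_kalg R N)
  (matrix_axioms sep factor_axioms factor_comm)).
Qed.

Section Isomorphism.
Local Notation MD := (matrix_data m col factor_data).
Local Notation U := (@entry _ ([::] : seq bool) colours R).
Local Notation cidem := (cidem KK nn m col D).
Local Notation cunit := (cunit KK nn m col D).
Local Notation c0 := (cs false).
Variables (Phi : khom R W) (Psi : khom W (mx_kalg R N)).
Hypothesis PhiD : forall b, data_map (m b) (factor_data b) (part_data b) Phi.
Hypothesis PsiD : data_map n D MD Psi.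

Let Psi' (z : W) : 'M[R]_N := Psi z.
Let Psi'M z z' : Psi' (z * z') = Psi' z * Psi' z'. Proof. exact: rmorphM. Qed.
Let Psi'_sum (I : Type) (r : seq I) (P : pred I) (F : I -> W) :
  Psi' (\sum_(i <- r | P i) F i) = \sum_(i <- r | P i) Psi' (F i).
Proof. exact: rmorph_sum. Qed.
Let Psi'1 : Psi' 1 = 1. Proof. exact: rmorph1. Qed.
Let Psi'_s l : (l.+1 < n)%N -> Psi' (ds D l) = ds MD l.
Proof. by case: PsiD => _ Ps _ _; apply: Ps. Qed.
Let Psi'_x l : (l < n)%N -> Psi' (dx D l) = dx MD l.
Proof. by case: PsiD => Px _ _ _; apply: Px. Qed.
Let Psi'_p : (0 < n)%N -> Psi' (dp D) = dp MD.
Proof. by case: PsiD. Qed.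
Let Psi'_e i : Psi' (de D i) = de MD i.
Proof. by case: PsiD. Qed.

Lemma matrix_one c : c \in colours -> Psi' (cidem c) = U c c 1.
Proof.
move=> cL; rewrite Psi'_sum -(colour_sum sep factor_axioms cL) entry_sum.
by apply: eq_bigr => i /eqP <-; rewrite Psi'_e.
Qed.

Let cat_lt (a d : seq bool) u v : a ++ u :: v :: d \in colours -> ((size a).+1 < n)%N.
Proof.
by move=> cL; rewrite -(colours_size cL) size_cat /= !addnS !ltnS leq_addr.
Qed.

Lemma matrix_sort_to c : c \in colours -> Psi' (sort_to D c) * U c0 c0 1 = U c c0 1.
Proof.
move: c; apply: colours_step => [|a d cL IHc].
  by rewrite (sort_to_sorted m D).1 Psi'1 mul1r.
rewrite (sort_swap ax cL).1 Psi'M Psi'_s ?(cat_lt cL) // -mulrA IHc.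
by apply: s_entry_diff => //; rewrite -colours_swap.
Qed.

Lemma matrix_sort_from c : c \in colours -> U c0 c0 1 * Psi' (sort_from D c) = U c0 c 1.
Proof.
move: c; apply: colours_step => [|a d cL IHc].
  by rewrite (sort_to_sorted m D).2 Psi'1 mulr1.
rewrite (sort_swap ax cL).2 Psi'M Psi'_s ?(cat_lt cL) // mulrA IHc.
by rewrite entry_s ?mulr1 //= -colours_swap.
Qed.

(** The products of exchanges act on the column of the sorted colour word by
    permuting the colour words, so the units of W go to the elementary
    matrices. *)
Lemma matrix_cunit c d : c \in colours -> d \in colours -> Psi' (cunit c d) = U c d 1.
Proof.
move=> cL dL; have c0L := sorted_colours_in m false.
rewrite cunitE !Psi'M matrix_one // matrix_sort_to //.
have -> : U c c0 1 = U c c0 1 * U c0 c0 1 by rewrite entryM ?colours_uniq // eqxx mulr1.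
by rewrite -mulrA matrix_sort_from // entryM ?colours_uniq // eqxx mulr1.
Qed.

Lemma scalar_entry c d r r' : r%:M * U c d r' = U c d (r * r').
Proof.
apply/matrixP => i j; rewrite -[_ * _]/(_ *m _) mul_scalar_mx !mxE.
by case: ifP; rewrite ?mulr0.
Qed.

Lemma scalar_sum r : \sum_(c <- colours) U c c r = r%:M.
Proof.
rewrite -[RHS]mulr1 -(entry_sum1 [::] R (colours_uniq m)) mulr_sumr.
by apply: eq_bigr => c _; rewrite scalar_entry mulr1.
Qed.

(** An amplified element is repeated along the diagonal, so it goes to a
    scalar matrix; the scalar can be read off at one colour word. *)
Lemma matrix_amplify b g r : (Psi' g) * U (cs b) (cs b) 1 = U (cs b) (cs b) r ->
  Psi' (amplify KK nn m col D (cs b) g) = r%:M.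
Proof.
move=> gr; have csL := sorted_colours_in m b.
rewrite -scalar_sum Psi'_sum big_seq [RHS]big_seq; apply: eq_bigr => c cL.
rewrite !Psi'M !matrix_cunit //.
have -> : U (cs b) c 1 = U (cs b) (cs b) 1 * U (cs b) c 1.
  by rewrite entryM ?colours_uniq // eqxx mulr1.
rewrite !mulrA -(mulrA (U c _ _)) gr.
by rewrite entryM ?colours_uniq // eqxx mul1r entryM ?colours_uniq // eqxx mulr1.
Qed.

(** Read off at the colour word where b comes first, position and rank of a
    letter b coincide, so the scalars are the generators of the factor. *)
Lemma matrix_scalar r : Psi' (Phi r) = r%:M.
Proof.
have genx b a : Psi (Phi (factor b a)) = mx_scalar R N (factor b a).
  move: a; apply: (presents_ind (DAP b)).
    exact: (subalgebra_equalizer (khom_comp (khom_comp Psi Phi) (factor b))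
      (khom_comp (mx_scalar R N) (factor b))).
  have csL := sorted_colours_in m b; have [Px Ps Pp Pe] := PhiD b.
  have ltmn l : (l < m b)%N -> (l < n)%N.
    by move=> lm; apply: leq_trans lm _; case: (b); rewrite ?leq_addl ?leq_addr.
  split=> [l lm|l lm|lm|w].
  - rewrite -[factor b _]/(dx (factor_data b) l) Px //; apply: matrix_amplify.
    rewrite Psi'_x ?ltmn //; have cE := sorted_coloursE lm; rewrite cE in csL *.
    by have := x_entry col factor_data _ 1 csL; rewrite size_nseq count_nseq /= eqxx mul1n mulr1; apply.
  - rewrite -[factor b _]/(ds (factor_data b) l) Ps //; apply: matrix_amplify.
    rewrite Psi'_s; last by case: (b) lm => lm; apply: leq_trans lm _; rewrite ?leq_addl ?leq_addr.
    have cE := sorted_coloursE (ltnW lm); rewrite -(subnSK lm) in cE; rewrite cE in csL *.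
    by have := s_entry_same col factor_data _ 1 csL; rewrite size_nseq count_nseq /= eqxx mul1n mulr1; apply.
  - rewrite -[factor b _]/(dp (factor_data b)) Pp //; apply: matrix_amplify.
    rewrite Psi'_p; last by apply: leq_trans (ltmn _ lm).
    have cE := sorted_coloursE lm; rewrite cE in csL *.
    by have := p_entry col factor_data _ 1 csL; rewrite mulr1; apply.
  rewrite -[factor b _]/(de (factor_data b) w) Pe; change (Psi' (\sum_(i <- words | part b i == w) de D i) = (de (factor_data b) w)%:M).
  rewrite Psi'_sum -[RHS]mulr1 -(matrix_de_sum sep factor_axioms) mulr_sumr big_mkcond.
  apply: eq_bigr => i _; rewrite Psi'_e; have [iw|iw] := boolP (i \in words); last first.
    by rewrite (e_out sep factor_axioms iw) mulr0 if_same.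
  have cL := word_colours sep iw.
  rewrite /= scalar_entry; case: eqP => [pw|pw].
    by rewrite -pw (word_idemE col factor_comm b) mulrA (de_de (factor_axioms b)) eqxx.
  rewrite (word_idemE col factor_comm b) mulrA (de_de (factor_axioms b)) eq_sym.
  by rewrite (introF eqP pw) mul0r entry0.
apply: (tensor_ind (Q := fun r => Psi (Phi r) = mx_scalar R N r)).
- exact: (subalgebra_equalizer (khom_comp Psi Phi) (mx_scalar R N)).
- exact: (genx false).
- exact: (genx true).
Qed.

Let unit_at (i j : 'I_N) : W := cunit (nth [::] colours i) (nth [::] colours j).

Let nth_colour (i : 'I_N) : nth [::] colours i \in colours.
Proof. exact: mem_nth. Qed.

Let unit_at_mul i j l t : unit_at i j * unit_at l t = if j == l then unit_at i t else 0.
Proof.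
rewrite -val_eqE -(nth_uniq [::] (ltn_ord j) (ltn_ord l) (colours_uniq m)).
case: eqP => [jl|/eqP jl]; first by rewrite /unit_at -jl (cunitM sep ax).
by rewrite /unit_at (cunitM0 sep ax).
Qed.

Let unit_at_sum : \sum_i unit_at i i = 1.
Proof.
rewrite -(sum_one sep ax) [RHS](big_nth [::]) big_mkord; apply: eq_bigr => i _.
by rewrite /unit_at (cunit_id sep ax).
Qed.

Let unit_at_comm r i j : Phi r * unit_at i j = unit_at i j * Phi r.
Proof. exact: tensor_W_commute. Qed.

Definition matrix_to_W : khom (mx_kalg R N) W :=
  mx_units_hom unit_at_mul unit_at_sum unit_at_comm.

Lemma matrix_to_W_entry c d r : c \in colours -> d \in colours ->
  matrix_to_W (U c d r) = Phi r * cunit c d.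
Proof.
move=> cL dL; have [ci di] : (index c colours < N)%N /\ (index d colours < N)%N.
  by rewrite !index_mem.
rewrite /= /mx_eval (bigD1 (Ordinal ci)) //= (bigD1 (Ordinal di)) //= mxE /=.
rewrite !nth_index // !eqxx /= big1 => [|j /eqP jd]; last first.
  rewrite mxE; case: andP => [[_ /eqP dE]|_]; last by rewrite rmorph0 mul0r.
  by case: jd; apply: val_inj; rewrite /= -dE index_uniq ?colours_uniq.
rewrite addr0 big1 ?addr0 => [|i /eqP ic]; first by rewrite /unit_at /= !nth_index.
rewrite big1 // => j _.
rewrite mxE; case: andP => [[/eqP cE _]|_]; last by rewrite rmorph0 mul0r.
by case: ic; apply: val_inj; rewrite /= -cE index_uniq ?colours_uniq.
Qed.

Lemma matrix_to_WK : cancel matrix_to_W Psi.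
Proof.
pose h (M : 'M[R]_N) : 'M[R]_N := Psi (matrix_to_W M).
have h_sum (F : 'I_N -> 'M[R]_N) : h (\sum_i F i) = \sum_i h (F i).
  by rewrite /h -(rmorph_sum Psi); congr (khom_fun Psi _); apply: (rmorph_sum matrix_to_W).
have hU c d r : c \in colours -> d \in colours -> h (U c d r) = U c d r.
  move=> cL dL; rewrite /h matrix_to_W_entry // -[LHS]/(Psi' _) Psi'M matrix_scalar.
  by rewrite matrix_cunit // scalar_entry mulr1.
move=> M; rewrite -[LHS]/(h M) {1}(matrix_sum_entry [::] (colours_uniq m) M) h_sum.
rewrite [RHS](matrix_sum_entry [::] (colours_uniq m) M).
by apply: eq_bigr => i _; rewrite h_sum; apply: eq_bigr => j _; rewrite hU.
Qed.

(** Both composites are compared on generators. A generator of W is the sum of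
    its restrictions to the colour words, and each restriction is an element
    of one of the families times a matrix unit (seen_x, seen_s, seen_p,
    cunit_step). *)
Lemma W_to_matrixK : cancel Psi matrix_to_W.
Proof.
have sumW (g : seq bool -> seq bool) (y : seq bool -> R) (z : W) :
    (forall c, c \in colours -> g c \in colours) ->
    (forall c, c \in colours -> Phi (y c) * cunit (g c) c = z * cidem c) ->
    matrix_to_W (\sum_(c <- colours) U (g c) c (y c)) = z.
  move=> gL yE; rewrite [LHS](rmorph_sum matrix_to_W) -[RHS]mulr1 -(sum_one sep ax) mulr_sumr.
  rewrite big_seq [RHS]big_seq; apply: eq_bigr => c cL.
  by rewrite -yE //; apply: matrix_to_W_entry; auto.
apply: (presents_ind DW (Q := fun z => matrix_to_W (Psi z) = z)).
  exact: (subalgebra_equalizer (khom_comp matrix_to_W Psi) (khom_id W)).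
split=> [l ln|l ln|n0|i].
- rewrite -[Psi _]/(Psi' _) Psi'_x //; apply: (sumW id) => // c cL.
  rewrite (cunit_id sep ax) //; move: ln; rewrite -(colours_size cL).
  move=> /split_at1[a [b [d [cE <-]]]]; rewrite cE in cL *.
  rewrite /x_coef nth_mid take_size_cat //; have [Px _ _ _] := PhiD b.
  rewrite Px; first exact: (seen_x sep ax cL).2.
  by have /coloursP <- := cL; rewrite count_cat /= eqxx addnCA leq_addr.
- rewrite -[Psi _]/(Psi' _) Psi'_s //; apply: (sumW (s_target l)) => c cL.
    by rewrite /s_target; case: ifP => // _; apply: swap_colours_in.
  move: ln; rewrite -(colours_size cL) => /split_at[a [u [v [d [cE <-]]]]].
  rewrite cE in cL *; rewrite /s_target /s_coef nth_mid nth_midS take_size_cat //.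
  case: eqP => [uv|/eqP uv].
    rewrite -uv in cL *; rewrite (cunit_id sep ax) //; have [_ Ps _ _] := PhiD u.
    rewrite Ps; first exact: (seen_s sep ax cL).2.
    by have /coloursP <- := cL; rewrite count_cat /= eqxx !add1n !addnS !ltnS leq_addr.
  have {}uv : u = ~~ v by case: (u) (v) uv => -[].
  rewrite rmorph1 mul1r swap_coloursE uv; apply: (cunit_step sep ax).
  by rewrite colours_swap -uv.
- rewrite -[Psi _]/(Psi' _) Psi'_p //; apply: (sumW id) => // c cL.
  rewrite (cunit_id sep ax) //; move: n0; rewrite -(colours_size cL).
  case: c cL => // b d cL _; have [_ _ Pp _] := PhiD b.
  rewrite /= Pp; first exact: (seen_p sep ax cL).2.
  by have /coloursP <- := cL; rewrite /= eqxx.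
rewrite -[Psi _]/(Psi' _) Psi'_e.
have [iw|iw] := boolP (i \in words); last first.
  by rewrite (e_out sep factor_axioms iw) (de_out ax) // [LHS](rmorph0 matrix_to_W).
rewrite [LHS]matrix_to_W_entry ?(word_colours sep) //.
rewrite (cunit_id sep ax) ?(word_colours sep) // -[RHS](E_colours col ax).
by rewrite word_idem_def rmorphM; congr (_ * _ * _); [case: (PhiD false)|case: (PhiD true)].
Qed.

End Isomorphism.

(** Stated for any presentations, so that the weights and orbits enter only
    through the separation. *)
Theorem separated_morita : morita_equivalent W R.
Proof.
have [Phi PhiD] := tensor_to_W; have [Psi PsiD] := W_to_matrix.
have i0 : (index (cs false) colours < N)%N by rewrite index_mem sorted_colours_in.
exact: (morita_matrix (Ordinal i0) (W_to_matrixK PhiD PsiD) (matrix_to_WK PhiD PsiD)).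
Qed.

End Assembly.

(** * The two orbits *)

Section HalfWeight.
Variables (k : fieldType) (p : k) (I : set k) (nu : {mset k}%mset).
Hypotheses (p0 : p != 0) (Iorb : vv_orbit p I) (I1 : ~ I 1) (IN1 : ~ I (-1)).
Hypothesis nuP : theta_NN I nu.

Lemma orbit_weight : exists a, nu = word_weight a.
Proof.
case: nuP => nuI nuV; apply: weight_exists => // u /nuI.
exact: (orbit_neq_inv p0 Iorb).
Qed.

Lemma mset_half_eq0 : mset_half nu = 0%N -> nu = mset0.
Proof.
have [a ->] := orbit_weight; rewrite mset_half_weight => /size0nil->.
by apply/msetP => u; rewrite word_weightE mset0E.
Qed.

End HalfWeight.

Section TwoOrbits.
Variables (k : fieldType) (p : k) (I J : set k) (nu1 nu2 : {mset k}%mset).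
Hypotheses (p0 : p != 0) (Jorb : vv_orbit p J).
Hypothesis disjIJ : (I `&` J = set0)%classic.
Hypotheses (nu1P : theta_NN I nu1) (nu2P : theta_NN J nu2).

Definition orbit_colour (u : k) : bool := `[< J u >].
Local Notation col := orbit_colour.
Let K b : set k := if b then J else I.
Let nu b : {mset k}%mset := if b then nu2 else nu1.

Let colE b u : K b u -> col u = b.
Proof.
case: b => [|Iu]; first exact: asboolT.
apply: asboolF => Ju; have : (I `&` J)%classic u by [].
by rewrite disjIJ.
Qed.

Lemma orbit_colour_inv u : col u^-1 = col u.
Proof. by apply/asbool_equiv_eq/(orbit_invE Jorb). Qed.

Let in_union b u : col u = b -> (I `|` J)%classic u = K b u.
Proof.
move=> ub; apply/propext; split=> [[Iu|Ju]|].
- by rewrite -ub (@colE false u Iu).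
- by rewrite -ub (@colE true u Ju).
by case: (b) => Ku; [right|left].
Qed.

Let count_part b u i : count_mem u (colour_part col b i) =
  if col u == b then count_mem u i else 0%N.
Proof.
rewrite count_filter; case: eqP => [ub|ub].
  by apply: eq_count => v /=; case: eqP => //= ->; rewrite ub eqxx.
rewrite -(count_pred0 i); apply: eq_count => v /=; case: eqP => //= ->.
exact/eqP.
Qed.

Let weight_part b i : word_weight i = (nu1 `+` nu2)%mset ->
  word_weight (colour_part col b i) = nu b.
Proof.
move=> wi; apply/msetP => u; rewrite word_weightE !count_part orbit_colour_inv.
have nuK b' : nu b' u != 0%N -> col u = b'.
  by move=> nub; apply: colE; case: b' nub => /=; [case: nu2P|case: nu1P] => + _; apply.
have := word_weightE i u; rewrite wi msetE2.
move: (nuK false) (nuK true); rewrite /nu; case: (b); case: (col u) => /= N1 N2 E.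
- by rewrite -E; case: eqVneq N1 => [->|_] //= /(_ isT).
- by case: eqVneq N2 => [->|_] //= /(_ isT).
- by case: eqVneq N1 => [->|_] //= /(_ isT).
by rewrite -E; case: eqVneq N2 => [->|_] /=; rewrite ?addn0 // => /(_ isT).
Qed.

(** The letters of different colours are separated because orbits are stable
    under inversion and under multiplication and division by the square of p.
    A letter of one orbit has coefficient zero in the weight of the other, so
    the total weight determines the weights of the parts. *)
Lemma orbit_separation : separation p (I `|` J)%classic (nu1 `+` nu2)%mset K nu
  (fun b => mset_half (nu b)) col.
Proof.
have arrow_in b u : col u = b -> (u \in (I `|` J)%classic) = (u \in K b).
  by move=> ub; apply/idP/idP; rewrite !in_setE (in_union ub).
split.
- move=> i; apply/vv_wordsP/andP => [[_ Ki wi]|].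
    have part_in b : colour_part col b i \in vv_words (K b) (nu b) (mset_half (nu b)).
      apply/vv_wordsP; split; last exact: weight_part.
        by rewrite -(weight_part b wi) mset_half_weight.
      move=> u; rewrite mem_filter => /andP[/eqP ub /Ki].
      by rewrite (in_union ub).
    by split; apply: part_in.
  case=> /vv_wordsP[s1 K1 w1] /vv_wordsP[s2 K2 w2].
  have pi : perm_eq i (colour_part col false i ++ colour_part col true i).
    rewrite perm_sym perm_catC -(permPr (permEl (perm_filterC col i))).
    have -> : colour_part col true i = filter col i.
      by apply: eq_filter => u; rewrite eqb_id.
    have -> // : colour_part col false i = filter (predC col) i.
    by apply: eq_filter => u; rewrite eqbF_neg.
  split.
  + by rewrite (perm_size pi) size_cat s1 s2.
  + by move=> u; rewrite (perm_mem pi) mem_cat => /orP[/K1|/K2]; [left|right].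
  by rewrite (word_weight_perm pi) word_weight_cat w1 w2.
- by move=> b i /vv_wordsP[_ Ki _]; apply/allP => u /Ki /colE /eqP.
- exact: orbit_colour_inv.
- by move=> b u v ub vb; rewrite /arrow !(arrow_in b).
move=> u v; rewrite /arrow; case: (u =P _) => [->|_]; last by rewrite !andbF.
case/eqP; apply/asbool_equiv_eq; split; first exact: orbit_divp2.
exact: orbit_mulp2.
Qed.

End TwoOrbits.

Theorem corollary2p8 (k : fieldType) (p q : k)
    (I J : set k) (nu nu1 nu2 : {mset k}%mset)
    (chark : 2%N \notin [pchar k])
    (p_neq0 : p != 0) (q_neq0 : q != 0)
    (p_neq1 : p != 1) (p_neqN1 : p != -1)
    (p_not_power : forall n : int, p != q ^ n)
    (q_not_power : forall n : int, q != p ^ n)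
    (orbitI : vv_orbit p I) (orbitJ : vv_orbit p J)
    (I_neq1 : ~ I 1) (I_neqN1 : ~ I (-1))
    (J_neq1 : ~ J 1) (J_neqN1 : ~ J (-1))
    (disjIJ : (I `&` J = set0)%classic)
    (nuP : theta_NN (I `|` J)%classic nu)
    (nu1P : theta_NN I nu1) (nu2P : theta_NN J nu2)
    (nuE : nu = (nu1 `+` nu2)%mset) :
  morita_equivalent (VV p q (I `|` J)%classic nu)
                    (tensor_kalg (VV p q I nu1) (VV p q J nu2)).
Proof.
subst nu; have sep := orbit_separation p_neq0 orbitJ disjIJ nu1P nu2P.
have [a1 nu1E] := orbit_weight p_neq0 orbitI I_neq1 I_neqN1 nu1P.
have [a2 nu2E] := orbit_weight p_neq0 orbitJ J_neq1 J_neqN1 nu2P.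
have half : mset_half (nu1 `+` nu2)%mset = (mset_half nu1 + mset_half nu2)%N.
  by rewrite nu1E nu2E -word_weight_cat !mset_half_weight size_cat.
have nu0 : mset_half (nu1 `+` nu2)%mset = 0%N -> (nu1 `+` nu2)%mset = mset0.
  rewrite half => /eqP; rewrite addn_eq0 => /andP[/eqP h1 /eqP h2].
  rewrite (mset_half_eq0 p_neq0 orbitI I_neq1 I_neqN1 nu1P h1).
  by rewrite (mset_half_eq0 p_neq0 orbitJ J_neq1 J_neqN1 nu2P h2) mset0D.
have [D DP] := VV_presents p q nuP nu0; rewrite half in DP.
have [D1 D1P] := VV_presents p q nu1P
  (mset_half_eq0 p_neq0 orbitI I_neq1 I_neqN1 nu1P).
have [D2 D2P] := VV_presents p q nu2P
  (mset_half_eq0 p_neq0 orbitJ J_neq1 J_neqN1 nu2P).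
pose A b := if b then VV p q J nu2 else VV p q I nu1.
pose DA b : vv_data k (A b) := if b return vv_data k (A b) then D2 else D1.
apply: (separated_morita sep DP (A := A) (DA := DA)).
by case.
Qed.
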